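(* Let $A,C,\eta,N_0$ and $S_N$ be as in the context. Assume the following (conjectural hypothesis): for every admissible initial function $w_0\not\equiv0$, every $t>0$ and every integer $N>N_0$, $$|(S_N(t)w_0)''(-h)|<\|(S_N(t)w_0)''\|_\infty\quad\text{and}\quad|(S_N(t)w_0)''(1+h)|<\|(S_N(t)w_0)''\|_\infty .$$ Let $u_0\not\equiv0$ be an admissible initial function. For each integer $N>N_0$ with $Q_N:=\sum_{k=0}^Nu_0(k/N)>0$, let $(p_0,\dots,p_N)$ be the solution of $$\dot p_k=a_{k-1}p_{k-1}-(a_k+c_k)p_k+c_{k+1}p_{k+1},\quad k=0,\dots,N,\qquad p_k(0)=u_0(k/N)/Q_N,$$ where $a_k=NA(k/N)$, $c_k=NC(k/N)$ for $0\le k\le N$ and $a_{-1}=c_{N+1}=0$ (the corresponding terms are absent), and let $v(t,\cdot)=S_N(t)(u_0^N/Q_N)$ be the solution of the Fokker-Planck equation $\partial_tv=\frac1{2N}\partial_{zz}((A+C)v)-\partial_z((A-C)v)$ on $[-h,1+h]$ with boundary conditions $\frac1{2N}\partial_z((A+C)v)-(A-C)v=0$ at $z=-h$ and $z=1+h$ and initial condition $v(0,\cdot)=u_0^N/Q_N$. Then for any $t_0>0$ there exists a constant $K$, independent of $N$, such that $$\left|v\!\left(t,\tfrac kN\right)-p_k(t)\right|\le\frac K{N^2}\qquad\text{for all }t\in[0,t_0],\ k=0,1,\dots,N,$$ for all such $N$.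
   Context: Let $\eta>0$ and let $A,C\in C^4[-\eta,1+\eta]$ be real-valued functions, non-negative on $[0,1]$, with $A+C>0$ on $[-\eta,1+\eta]$, $A(1)=C(0)=0$, $A-C>0$ on $[-\eta,0]$ and $A-C<0$ on $[1,1+\eta]$. Let $N_0>1/(2\eta)$ be a positive integer such that $2N_0|A(x)-C(x)|>|A'(x)+C'(x)|$ for all $x\in[-\eta,0]\cup[1,1+\eta]$. For each $N$ put $h=\frac1{2N}$. An admissible initial function is a non-negative $u_0\in C^2[0,1]$ with $u_0(0)=u_0'(0)=u_0(1)=u_0'(1)=0$ whose extension $u_0^N$ to $[-h,1+h]$ by the constant $0$ outside $[0,1]$ belongs to $C^2[-h,1+h]$; $S_N(t)u_0$ means $S_N(t)u_0^N$. On $C[-h,1+h]$ (complex-valued functions, sup norm), the operator $\mathcal A_Nf=\frac1{2N}((A+C)f)''-((A-C)f)'$ with domain $D(\mathcal A_N)=\{f\in C^2[-h,1+h]:\frac1{2N}((A+C)f)'(z)-((A-C)f)(z)=0\text{ for }z=-h,\,1+h\}$ generates an analytic strongly continuous semigroup $(S_N(t))_{t\ge0}$, which gives the solutions of the Fokker-Planck equation with the stated boundary conditions. *)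

(* Defs.v *)
(* Stdlib reals with Coquelicot. *)
From Stdlib Require Export Reals.
From Coquelicot Require Export Coquelicot.
Open Scope R_scope.

Definition Icc (a b x : R) : Prop := a <= x <= b.

(* Derivatives relative to a set: at an endpoint of [Icc a b] they are the
   one-sided derivatives. *)
Definition is_derive_within {V : NormedModule R_AbsRing}
  (D : R -> Prop) (f : R -> V) (x : R) (l : V) : Prop :=
  filterdiff f (within D (locally x)) (fun y : R => scal y l).

(* The values are meaningful only at the points x of [a,b], with a < b, where
   f is differentiable relative to [a,b]. *)
Definition Derive_on {V : CompleteNormedModule R_AbsRing}
  (a b : R) (f : R -> V) (x : R) : V :=
  iota (fun l : V => is_derive_within (Icc a b) f x l).

Fixpoint Ck_on {V : CompleteNormedModule R_AbsRing}
  (k : nat) (a b : R) (f : R -> V) : Prop :=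
  match k with
  | O => continuous_on (Icc a b) f
  | S j => (forall x, Icc a b x -> exists l : V, is_derive_within (Icc a b) f x l)
           /\ Ck_on j a b (Derive_on a b f)
  end.

(* For complex-valued functions C is taken as a normed module over R. *)
Definition C0C (a b : R) (f : R -> C) : Prop :=
  Ck_on (V := C_R_CompleteNormedModule) 0 a b f.
Definition C2C (a b : R) (f : R -> C) : Prop :=
  Ck_on (V := C_R_CompleteNormedModule) 2 a b f.
Definition DC (a b : R) (f : R -> C) : R -> C :=
  Derive_on (V := C_R_CompleteNormedModule) a b f.

Definition supnorm (a b : R) (f : R -> C) : R :=
  real (Lub_Rbar (fun r => exists x, Icc a b x /\ r = Cmod (f x))).

Definition eq_on (a b : R) (f g : R -> C) : Prop :=
  forall x, Icc a b x -> f x = g x.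

(* The Banach space C[a,b] is represented by total functions R -> C that are
   continuous on [a,b]; two of them are identified when they agree on [a,b].
   Linearity and boundedness make the operators below compatible with this
   identification. *)
Definition bounded_operator (a b : R) (T : (R -> C) -> R -> C) : Prop :=
  (forall f, C0C a b f -> C0C a b (T f)) /\
  (forall f g, C0C a b f -> C0C a b g ->
     eq_on a b (T (fun x => (f x + g x)%C)) (fun x => (T f x + T g x)%C)) /\
  (forall (c : C) f, C0C a b f ->
     eq_on a b (T (fun x => (c * f x)%C)) (fun x => (c * T f x)%C)) /\
  (exists M : R, forall f, C0C a b f -> supnorm a b (T f) <= M * supnorm a b f).

Definition C0_semigroup (a b : R) (S : R -> (R -> C) -> R -> C) : Prop :=
  (forall t, 0 <= t -> bounded_operator a b (S t)) /\
  (forall f, C0C a b f -> eq_on a b (S 0 f) f) /\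
  (forall s t f, 0 <= s -> 0 <= t -> C0C a b f ->
     eq_on a b (S (s + t) f) (S s (S t f))) /\
  (forall f, C0C a b f ->
     filterlim (fun t => supnorm a b (fun x => (S t f x - f x)%C))
       (at_right 0) (locally 0)).

(* The open sector { z <> 0 : |arg z| < theta }. *)
Definition sector (theta : R) (z : C) : Prop :=
  exists r phi : R, 0 < r /\ Rabs phi < theta /\ z = (r * cos phi, r * sin phi).

(* S extends to a sector as a semigroup that is holomorphic for the operator
   norm and strongly continuous at 0 in every smaller sector. *)
Definition analytic_semigroup (a b : R) (S : R -> (R -> C) -> R -> C) : Prop :=
  exists (theta : R) (T : C -> (R -> C) -> R -> C),
    0 < theta <= PI / 2 /\
    (forall t f, 0 < t -> C0C a b f -> eq_on a b (T (RtoC t) f) (S t f)) /\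
    (forall z, sector theta z -> bounded_operator a b (T z)) /\
    (forall z w f, sector theta z -> sector theta w -> C0C a b f ->
       eq_on a b (T (z + w)%C f) (T z (T w f))) /\
    (forall z, sector theta z ->
       exists L : (R -> C) -> R -> C, bounded_operator a b L /\
         forall eps, 0 < eps -> exists delta, 0 < delta /\
           forall w, sector theta w -> w <> z -> Cmod (w - z)%C < delta ->
             forall f, C0C a b f ->
               supnorm a b (fun x => ((T w f x - T z f x) / (w - z) - L f x)%C)
                 <= eps * supnorm a b f) /\
    (forall theta' f, 0 < theta' < theta -> C0C a b f ->
       filterlim (fun z : C => supnorm a b (fun x => (T z f x - f x)%C))
         (within (sector theta') (locally (RtoC 0))) (locally 0)).

(* The generator of S is the operator G with domain dom. *)
Definition has_generator (a b : R) (S : R -> (R -> C) -> R -> C)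
  (dom : (R -> C) -> Prop) (G : (R -> C) -> R -> C) : Prop :=
  forall f g, C0C a b f -> C0C a b g ->
    (filterlim
       (fun t => supnorm a b (fun x => ((S t f x - f x) / RtoC t - g x)%C))
       (at_right 0) (locally 0)
     <-> dom f /\ eq_on a b (G f) g).

Definition mesh (N : nat) : R := / (2 * INR N).

Definition lo (N : nat) : R := - mesh N.
Definition hi (N : nat) : R := 1 + mesh N.

Definition FP_op (A B : R -> R) (N : nat) (f : R -> C) (z : R) : C :=
  (RtoC (mesh N)
     * DC (lo N) (hi N)
         (DC (lo N) (hi N) (fun y => RtoC (A y + B y) * f y)) z
   - DC (lo N) (hi N) (fun y => RtoC (A y - B y) * f y) z)%C.

Definition FP_flux (A B : R -> R) (N : nat) (f : R -> C) (z : R) : C :=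
  (RtoC (mesh N) * DC (lo N) (hi N) (fun y => RtoC (A y + B y) * f y) z
   - RtoC (A z - B z) * f z)%C.

Definition FP_dom (A B : R -> R) (N : nat) (f : R -> C) : Prop :=
  C2C (lo N) (hi N) f /\
  FP_flux A B N f (lo N) = RtoC 0 /\ FP_flux A B N f (hi N) = RtoC 0.

Definition FP_semigroup (A B : R -> R) (N : nat)
  (S : R -> (R -> C) -> R -> C) : Prop :=
  C0_semigroup (lo N) (hi N) S /\
  analytic_semigroup (lo N) (hi N) S /\
  has_generator (lo N) (hi N) S (FP_dom A B N) (FP_op A B N).

Definition zero_ext (u : R -> R) (x : R) : R :=
  if Rle_dec 0 x then if Rle_dec x 1 then u x else 0 else 0.

(* Only the values of u on [0,1] matter.  The smoothness of the extension does
   not depend on the choice of N > 0. *)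
Definition admissible (u : R -> R) : Prop :=
  (forall x, Icc 0 1 x -> 0 <= u x) /\
  Ck_on 2 0 1 u /\
  u 0 = 0 /\ Derive_on 0 1 u 0 = 0 /\ u 1 = 0 /\ Derive_on 0 1 u 1 = 0 /\
  (forall N : nat, (0 < N)%nat -> Ck_on 2 (lo N) (hi N) (zero_ext u)).

Definition nonzero01 (u : R -> R) : Prop := exists x, Icc 0 1 x /\ u x <> 0.

Definition mass (u : R -> R) (N : nat) : R :=
  sum_f_R0 (fun k => u (INR k / INR N)) N.

Definition rate (A : R -> R) (N k : nat) : R := INR N * A (INR k / INR N).

Definition master_rhs (A B : R -> R) (N : nat) (p : nat -> R) (k : nat) : R :=
  match k with O => 0 | S j => rate A N j * p j end
  - (rate A N k + rate B N k) * p k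
  + (if Nat.ltb k N then rate B N (S k) * p (S k) else 0).

Definition master_solution (A B : R -> R) (N : nat) (p0 : nat -> R)
  (p : nat -> R -> R) : Prop :=
  forall k : nat, (k <= N)%nat ->
    p k 0 = p0 k /\
    forall t, 0 <= t ->
      is_derive_within (fun s => 0 <= s) (p k) t
        (master_rhs A B N (fun j => p j t) k).

(* Main.v *)
(** With h = 1/(2N), flux h((A+C)v)' - (A-C)v and cells [k/N - h, k/N + h], both evolutions are
    flux differences over the cells with zero flux through the two outer ends.  Taylor expansion at
    the cell ends shows that the right-hand sides differ by O(1/N) times the C^2 norm of v.  Since
    Q_N grows like N, a bound on the C^2 norm of S_N(t) u_0 that is uniform in N makes this
    truncation error O(1/N^2), and the maximum principle for the master equation, whose
    coefficients vary by O(1) between neighbours, propagates it to the solutions.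

    The C^2 bound comes from two maximum principles.  At a maximum of |v| the boundary conditions
    and the drift condition exclude the end points.  At a maximum of |v''|, which is interior by the
    conjectural hypothesis, the fourth and third order terms of (A_N v)'' drop out, and what
    remains is bounded by a multiple of |v| + |v'| + |v''| independent of N.  Complex values are
    handled by the real functionals z -> p Re z + q Im z with p^2 + q^2 = 1. *)
Require Import Defs.
From Stdlib Require Import Reals Arith Lra Lia FunctionalExtensionality.
From Coquelicot Require Import Coquelicot.
Open Scope R_scope.

(** * Derivatives relative to an interval *)

(** Sup norms need not be differentiable in time. Each growth bound therefore freezes, at the time
    considered, a maximum point and a real functional realising the modulus there. This gives a
    linear quantity that stays below the norm and touches it; a maximum principle controls its left
    derivative, and [gronwall_touching] concludes.

    For v'' this needs a time derivative of v'' and two more space derivatives than membership in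
    the domain provides. Both come from A_N v. The zero extension of u_0 vanishes near both ends, so
    it lies in the domain and A_N S_N(t) u_0 = S_N(t) A_N u_0. For t > 0 analyticity puts this
    function into the domain as well; hence A_N v is C^2, and solving for v'' shows that v'' is
    twice differentiable inside. An elliptic estimate bounds r'' by r and A_N r, which transfers
    continuity and differentiability in time from the orbits of u_0 and A_N u_0 to v''. Its constant
    blows up with N, but it serves only at fixed N; the bounds uniform in N come from the maximum
    principles. *)

(** [filterdiff] quantifies over all limit points of the filter. Here x is the only one: since D x
    holds, x lies in every set of the filter, so a limit x' has x in each of its neighbourhoods. *)
Lemma is_derive_within_iff {V : NormedModule R_AbsRing} (D : R -> Prop)
  (f : R -> V) (x : R) (l : V) :
  D x ->
  (is_derive_within D f x l <->
   forall eps, 0 < eps -> exists d, 0 < d /\ forall y, D y -> Rabs (y - x) < d ->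
     norm (minus (minus (f y) (f x)) (scal (y - x) l)) <= eps * Rabs (y - x)).
Proof.
  intros Dx. split.
  - intros [_ H] eps Heps.
    assert (L : is_filter_lim (within D (locally x)) x).
    { intros P HP. unfold within. revert HP. apply filter_imp. auto. }
    destruct (H x L (mkposreal eps Heps)) as [d Hd].
    exists d. split. apply cond_pos.
    intros y Dy Hy. exact (Hd y Hy Dy).
  - intros H. split.
    + apply (is_linear_scal_l (V := V) l).
    + intros x' L.
      assert (x' = x) as ->.
      { destruct (Req_dec x' x) as [E|E]; [exact E|exfalso].
        assert (Hp : 0 < Rabs (x - x')) by (apply Rabs_pos_lt; lra).
        destruct (L (fun y => Rabs (y - x') < Rabs (x - x'))) as [d Hd].
        { exists (mkposreal _ Hp). intros y Hy. exact Hy. }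
        specialize (Hd x (ball_center x d) Dx). lra. }
      intros [eps Heps]. destruct (H eps Heps) as [d [Hd0 Hd]].
      exists (mkposreal d Hd0). intros y Hy Dy. exact (Hd y Dy Hy).
Qed.

Lemma is_derive_within_R (D : R -> Prop) (f : R -> R) (x l : R) :
  D x ->
  (is_derive_within D f x l <->
   forall eps, 0 < eps -> exists d, 0 < d /\ forall y, D y -> Rabs (y - x) < d ->
     Rabs (f y - f x - (y - x) * l) <= eps * Rabs (y - x)).
Proof. intros Dx. exact (is_derive_within_iff D f x l Dx). Qed.

Lemma norm_Cmod (z : C) : @norm R_AbsRing C_R_NormedModule z = Cmod z.
Proof.
  destruct z as [x y]. unfold Cmod. simpl. unfold norm; simpl. unfold prod_norm; simpl.
  unfold norm; simpl. unfold abs; simpl. f_equal.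
  rewrite !Rmult_1_r. rewrite <- !Rabs_mult. f_equal; apply Rabs_pos_eq; nra.
Qed.

Lemma Cmod_le_abs (z : C) : Cmod z <= Rabs (fst z) + Rabs (snd z).
Proof.
  destruct z as [x y]; unfold Cmod; simpl.
  apply Rsqr_incr_0_var.
  2:{ pose proof (Rabs_pos x); pose proof (Rabs_pos y); lra. }
  rewrite Rsqr_sqrt by nra. unfold Rsqr.
  pose proof (Rabs_pos x); pose proof (Rabs_pos y).
  assert (Rabs x * Rabs x = x * x) by (rewrite <- Rabs_mult; apply Rabs_pos_eq; nra).
  assert (Rabs y * Rabs y = y * y) by (rewrite <- Rabs_mult; apply Rabs_pos_eq; nra).
  nra.
Qed.

Lemma abs_le_Cmod (z : C) : Rabs (fst z) <= Cmod z /\ Rabs (snd z) <= Cmod z.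
Proof.
  pose proof (Rmax_Cmod z). pose proof (Rmax_l (Rabs (fst z)) (Rabs (snd z))).
  pose proof (Rmax_r (Rabs (fst z)) (Rabs (snd z))). lra.
Qed.

Lemma is_derive_within_C (D : R -> Prop) (f : R -> C) (x : R) (l : C) :
  D x ->
  (is_derive_within (V := C_R_CompleteNormedModule) D f x l <->
   is_derive_within D (fun y => fst (f y)) x (fst l) /\
   is_derive_within D (fun y => snd (f y)) x (snd l)).
Proof.
  intros Dx.
  assert (Hn : forall y, @norm R_AbsRing C_R_NormedModule
     (minus (minus (f y : C_R_NormedModule) (f x)) (scal (y - x) (l : C_R_NormedModule)))
     = Cmod (fst (f y) - fst (f x) - (y - x) * fst l,
             snd (f y) - snd (f x) - (y - x) * snd l)).
  { intros y. rewrite norm_Cmod. reflexivity. }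
  rewrite (is_derive_within_R D (fun y => fst (f y))), (is_derive_within_R D (fun y => snd (f y))) by exact Dx.
  split.
  - intros H0. pose proof (proj1 (is_derive_within_iff (V := C_R_NormedModule) D f x l Dx) H0) as H.
    split; intros eps He; destruct (H eps He) as [d [Hd K]]; exists d; (split; [exact Hd|]);
    intros y Dy Hy; specialize (K y Dy Hy); rewrite Hn in K;
    refine (Rle_trans _ _ _ _ K).
    + apply (proj1 (abs_le_Cmod (_, _))).
    + apply (proj2 (abs_le_Cmod (_, _))).
  - intros [H1 H2]. apply (proj2 (is_derive_within_iff (V := C_R_NormedModule) D f x l Dx)).
    intros eps He.
    destruct (H1 (eps / 2)) as [d1 [Hd1 K1]]; [lra|].
    destruct (H2 (eps / 2)) as [d2 [Hd2 K2]]; [lra|].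
    exists (Rmin d1 d2). split. apply Rmin_pos; auto.
    intros y Dy Hy. rewrite Hn.
    pose proof (Rmin_l d1 d2). pose proof (Rmin_r d1 d2).
    eapply Rle_trans. apply Cmod_le_abs. simpl.
    specialize (K1 y Dy ltac:(lra)). specialize (K2 y Dy ltac:(lra)). simpl in *. lra.
Qed.

Lemma is_derive_eps (f : R -> R) (x l : R) :
  is_derive f x l <->
  forall eps, 0 < eps -> exists d, 0 < d /\ forall y, Rabs (y - x) < d ->
     Rabs (f y - f x - (y - x) * l) <= eps * Rabs (y - x).
Proof.
  split.
  - intros [_ H] eps He.
    destruct (H x (fun P HP => HP) (mkposreal eps He)) as [d Hd].
    exists d. split. apply cond_pos. exact Hd.
  - intros H. split. apply (is_linear_scal_l (V := R_NormedModule) l).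
    intros x' L. assert (x' = x) as ->.
    { symmetry. apply is_filter_lim_locally_unique. exact L. }
    intros [eps He]. destruct (H eps He) as [d [Hd K]].
    exists (mkposreal d Hd). intros y Hy. exact (K y Hy).
Qed.

Lemma is_derive_within_of_is_derive (D : R -> Prop) (f g : R -> R) (x l : R) :
  D x -> (forall y, D y -> f y = g y) -> is_derive g x l -> is_derive_within D f x l.
Proof.
  intros Dx E H. apply is_derive_within_R; auto. intros eps He.
  destruct (proj1 (is_derive_eps g x l) H eps He) as [d [Hd K]].
  exists d. split; auto. intros y Dy Hy. rewrite !E; auto.
Qed.

Lemma is_derive_of_within (a b : R) (f : R -> R) (x l : R) :
  a < x < b -> is_derive_within (Icc a b) f x l -> is_derive f x l.
Proof.
  intros Hx H. apply is_derive_eps. intros eps He.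
  assert (Dx : Icc a b x) by (split; lra).
  destruct (proj1 (is_derive_within_R _ f x l Dx) H eps He) as [d [Hd K]].
  exists (Rmin d (Rmin (x - a) (b - x))). split.
  - repeat apply Rmin_pos; lra.
  - intros y Hy. apply K.
    + pose proof (Rmin_r d (Rmin (x - a) (b - x))). pose proof (Rmin_l (x - a) (b - x)).
      pose proof (Rmin_r (x - a) (b - x)).
      assert (Hy' := Hy). apply Rabs_def2 in Hy'. split; lra.
    + pose proof (Rmin_l d (Rmin (x - a) (b - x))). lra.
Qed.

(** Makes the [iota] in [Derive_on] return the derivative. As a < b, there are points of the
    interval arbitrarily close to x on at least one side, and they determine the slope. *)
Lemma is_derive_within_unique (a b : R) (f : R -> R) (x l1 l2 : R) :
  a < b -> Icc a b x -> is_derive_within (Icc a b) f x l1 ->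
  is_derive_within (Icc a b) f x l2 -> l1 = l2.
Proof.
  intros Hab Dx H1 H2.
  destruct (Req_dec l1 l2) as [E|E]; [exact E|exfalso].
  assert (Hp : 0 < Rabs (l1 - l2)) by (apply Rabs_pos_lt; lra).
  destruct (proj1 (is_derive_within_R _ f x l1 Dx) H1 (Rabs (l1 - l2) / 4)) as [d1 [Hd1 K1]]; [lra|].
  destruct (proj1 (is_derive_within_R _ f x l2 Dx) H2 (Rabs (l1 - l2) / 4)) as [d2 [Hd2 K2]]; [lra|].
  assert (Hex : exists y, Icc a b y /\ y <> x /\ Rabs (y - x) < d1 /\ Rabs (y - x) < d2).
  { destruct Dx as [Ha Hb].
    set (d := Rmin d1 d2).
    assert (Hd : 0 < d) by (apply Rmin_pos; auto).
    pose proof (Rmin_l d1 d2); pose proof (Rmin_r d1 d2). fold d in H, H0.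
    destruct (Rlt_dec x b) as [L|L].
    - exists (x + Rmin (d / 2) (b - x)).
      pose proof (Rmin_l (d / 2) (b - x)); pose proof (Rmin_r (d / 2) (b - x)).
      assert (0 < Rmin (d / 2) (b - x)) by (apply Rmin_pos; lra).
      unfold Icc. repeat split; try lra; rewrite Rabs_pos_eq; lra.
    - exists (x - Rmin (d / 2) (x - a)).
      pose proof (Rmin_l (d / 2) (x - a)); pose proof (Rmin_r (d / 2) (x - a)).
      assert (0 < Rmin (d / 2) (x - a)) by (apply Rmin_pos; lra).
      unfold Icc. repeat split; try lra; rewrite Rabs_left; lra. }
  destruct Hex as [y [Dy [Ny [Y1 Y2]]]].
  specialize (K1 y Dy Y1). specialize (K2 y Dy Y2).
  assert (Hq : 0 < Rabs (y - x)) by (apply Rabs_pos_lt; lra).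
  assert (Rabs ((y - x) * (l1 - l2)) <= Rabs (l1 - l2) / 2 * Rabs (y - x)).
  { replace ((y - x) * (l1 - l2)) with
      ((f y - f x - (y - x) * l2) - (f y - f x - (y - x) * l1)) by ring.
    eapply Rle_trans. apply Rabs_triang. rewrite Rabs_Ropp. lra. }
  rewrite Rabs_mult in H. nra.
Qed.

Lemma Derive_on_eq (a b : R) (f : R -> R) (x l : R) :
  a < b -> Icc a b x -> is_derive_within (Icc a b) f x l -> Derive_on a b f x = l.
Proof.
  intros Hab Dx H. unfold Derive_on.
  apply (iota_unique (V := R_CompleteNormedModule)); auto.
  intros y Hy. exact (is_derive_within_unique a b f x y l Hab Dx Hy H).
Qed.

Lemma DC_eq (a b : R) (f : R -> C) (x : R) (l : C) :
  a < b -> Icc a b x -> is_derive_within (V := C_R_CompleteNormedModule) (Icc a b) f x l ->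
  DC a b f x = l.
Proof.
  intros Hab Dx H. unfold DC, Derive_on.
  apply (iota_unique (V := C_R_CompleteNormedModule)); auto.
  intros y Hy. apply is_derive_within_C in Hy; auto. apply is_derive_within_C in H; auto.
  destruct y, l. f_equal.
  - exact (is_derive_within_unique a b _ x _ _ Hab Dx (proj1 Hy) (proj1 H)).
  - exact (is_derive_within_unique a b _ x _ _ Hab Dx (proj2 Hy) (proj2 H)).
Qed.

(** The extension is f composed with the clamping map onto [a,b], which is 1-Lipschitz. Global
    continuity gives access to integrals and mean value theorems without one-sided limits. *)
Lemma continuous_on_extend (a b : R) (f : R -> R) :
  a <= b -> continuous_on (Icc a b) f ->
  exists G : R -> R, (forall x, continuous G x) /\ forall x, Icc a b x -> f x = G x.
Proof.
  intros Hab H. exists (fun x => f (Rmax a (Rmin b x))). split.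
  - intros x.
    assert (Dc : forall y, Icc a b (Rmax a (Rmin b y))).
    { intros y. split. apply Rmax_l. apply Rmax_lub; auto. apply Rmin_l. }
    apply filterlim_locally. intros eps.
    pose proof (proj1 (filterlim_locally f _) (H _ (Dc x)) eps) as [d Hd].
    exists d. intros y Hy. apply Hd; [|apply Dc].
    change (Rabs (Rmax a (Rmin b y) - Rmax a (Rmin b x)) < d).
    change (Rabs (y - x) < d) in Hy.
    apply Rabs_def2 in Hy. apply Rabs_def1;
    unfold Rmax, Rmin; repeat destruct Rle_dec; lra.
  - intros x [H1 H2]. rewrite Rmin_right by lra. rewrite Rmax_right by lra. reflexivity.
Qed.

Lemma MVT_global (f f' : R -> R) (a b : R) :
  (forall x, is_derive f x (f' x)) ->
  exists c, Rmin a b <= c <= Rmax a b /\ f b - f a = f' c * (b - a).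
Proof.
  intros H. apply (MVT_gen f a b f').
  - intros x _. apply H.
  - intros x _. apply derivable_continuous_pt. exists (f' x). apply is_derive_Reals, H.
Qed.

Lemma is_derive_continuous (f : R -> R) (x l : R) : is_derive f x l -> continuous f x.
Proof. intros H. apply (ex_derive_continuous (V := R_NormedModule)). exists l. exact H. Qed.

Lemma is_derive_within_continuous_at (D : R -> Prop) (f : R -> R) (x l : R) :
  D x -> is_derive_within D f x l ->
  forall eps, 0 < eps -> exists d, 0 < d /\ forall y, D y -> Rabs (y - x) < d ->
    Rabs (f y - f x) < eps.
Proof.
  intros Dx H eps He.
  destruct (proj1 (is_derive_within_R D f x l Dx) H 1) as [d [Hd K]]; [lra|].
  set (m := 2 + Rabs l).
  assert (Hm : 2 <= m) by (unfold m; pose proof (Rabs_pos l); lra).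
  assert (Hq : 0 < eps / m) by (apply Rdiv_lt_0_compat; lra).
  exists (Rmin d (eps / m)). split. apply Rmin_pos; auto.
  intros y Dy Hy.
  pose proof (Rmin_l d (eps / m)); pose proof (Rmin_r d (eps / m)).
  specialize (K y Dy ltac:(lra)).
  replace (f y - f x) with ((f y - f x - (y - x) * l) + (y - x) * l) by ring.
  eapply Rle_lt_trans. apply Rabs_triang. rewrite Rabs_mult.
  apply Rle_lt_trans with (Rabs (y - x) * (m - 1)).
  { unfold m. lra. }
  apply Rle_lt_trans with (Rabs (y - x) * m).
  { pose proof (Rabs_pos (y - x)). nra. }
  apply Rlt_le_trans with (eps / m * m). apply Rmult_lt_compat_r; lra.
  right. field. lra.
Qed.

Lemma is_derive_within_continuous_on (a b : R) (f f' : R -> R) :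
  (forall x, Icc a b x -> is_derive_within (Icc a b) f x (f' x)) ->
  continuous_on (Icc a b) f.
Proof.
  intros H x Dx. apply filterlim_locally. intros [eps He].
  destruct (is_derive_within_continuous_at _ f x (f' x) Dx (H x Dx) eps He) as [e [He1 K]].
  exists (mkposreal e He1). intros y Hy Dy. exact (K y Dy Hy).
Qed.

(** The extension is the primitive of the extended derivative with value f a at a. On [a,b] its
    difference from f has derivative 0 and vanishes at a. *)
Lemma derive_within_extend (a b : R) (f f' G' : R -> R) :
  a < b ->
  (forall x, Icc a b x -> is_derive_within (Icc a b) f x (f' x)) ->
  (forall x, continuous G' x) -> (forall x, Icc a b x -> f' x = G' x) ->
  exists G : R -> R, (forall x, is_derive G x (G' x)) /\ forall x, Icc a b x -> f x = G x.
Proof.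
  intros Hab H HG E.
  set (G := fun x => f a + RInt G' a x).
  assert (HdG : forall x, is_derive G x (G' x)).
  { intros x. unfold G.
    replace (G' x) with (0 + G' x) by ring.
    apply (is_derive_plus (K := R_AbsRing) (V := R_NormedModule) (fun _ => f a)).
    - apply (is_derive_const (f a)).
    - apply (is_derive_RInt (V := R_NormedModule) G' _ a x); [|apply HG].
      apply filter_forall. intros y. apply (RInt_correct (V := R_CompleteNormedModule)).
      apply (ex_RInt_continuous (V := R_CompleteNormedModule)). intros z _. apply HG. }
  exists G. split; [exact HdG|].
  intros x Dx.
  set (D := fun y => f y - G y).
  assert (HD : forall y, Icc a b y -> is_derive_within (Icc a b) D y 0).
  { intros y Dy. apply is_derive_within_R; auto. intros eps He.
    destruct (proj1 (is_derive_within_R _ f y _ Dy) (H y Dy) (eps / 2)) as [d1 [Hd1 K1]]; [lra|].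
    destruct (proj1 (is_derive_eps G y _) (HdG y) (eps / 2)) as [d2 [Hd2 K2]]; [lra|].
    exists (Rmin d1 d2). split. apply Rmin_pos; auto.
    intros z Dz Hz. pose proof (Rmin_l d1 d2). pose proof (Rmin_r d1 d2).
    specialize (K1 z Dz ltac:(lra)). specialize (K2 z ltac:(lra)).
    rewrite (E y Dy) in K1. unfold D.
    replace (f z - G z - (f y - G y) - (z - y) * 0)
      with ((f z - f y - (z - y) * G' y) - (G z - G y - (z - y) * G' y)) by ring.
    eapply Rle_trans. apply Rabs_triang. rewrite Rabs_Ropp. lra. }
  destruct (continuous_on_extend a b D) as [D' [CD' ED']]; [lra| |].
  { apply (is_derive_within_continuous_on a b D (fun _ => 0)). exact HD. }
  assert (Da : Icc a b a) by (split; lra).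
  destruct Dx as [H1 H2].
  (* The mean value theorem is applied to the clamped difference [D'], which is continuous
     everywhere and has an ordinary derivative at the interior points. *)
  destruct (MVT_gen D' a x (fun _ => 0)) as [c [_ Hc]].
  - intros y Hy. rewrite Rmin_left, Rmax_right in Hy by lra.
    apply (is_derive_of_within a b); [lra|].
    assert (Dy : Icc a b y) by (split; lra).
    specialize (HD y Dy). rewrite is_derive_within_R by auto.
    rewrite is_derive_within_R in HD by auto.
    intros eps He; destruct (HD eps He) as [d [Hd K]]. exists d; split; auto.
    intros z Dz. rewrite <- !ED'; auto.
  - intros y _. apply continuity_pt_filterlim. apply CD'.
  - rewrite <- !ED' in Hc; try (split; lra). unfold D in Hc.
    assert (G a = f a).
    { unfold G. rewrite (RInt_point (V := R_CompleteNormedModule)). change (f a + 0 = f a). ring. }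
    lra.
Qed.

(** * Chains of derivatives, complex values and the sup norm *)

(** A C^k function on the whole line carried together with its derivatives [r 0], ..., [r k]; later
    entries are arbitrary. Working with such extensions removes one-sided derivatives from all later
    computations. *)
Definition chain (k : nat) (r : nat -> R -> R) : Prop :=
  (forall i x, (i < k)%nat -> is_derive (r i) x (r (S i) x)) /\
  (forall x, continuous (r k) x).

(** The top derivative is extended by clamping and the lower ones by successive integration, so that
    the extensions remain derivatives of one another. *)
Lemma Ck_on_chain (k : nat) (a b : R) (f : R -> R) :
  a < b -> Ck_on k a b f ->
  exists r, chain k r /\ forall x, Icc a b x -> f x = r 0%nat x.
Proof.
  intros Hab. revert f. induction k as [|k IH]; intros f Hf.
  - destruct (continuous_on_extend a b f) as [G [CG EG]]; [lra|exact Hf|].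
    exists (fun _ => G). split; auto. split; auto. intros i x Hi. lia.
  - destruct Hf as [Hd Hk]. destruct (IH _ Hk) as [r' [[H1 H2] E]].
    assert (Hd' : forall x, Icc a b x -> is_derive_within (Icc a b) f x (Derive_on a b f x)).
    { intros x Dx. destruct (Hd x Dx) as [l Hl].
      rewrite (Derive_on_eq a b f x l); auto. }
    destruct (derive_within_extend a b f (Derive_on a b f) (r' 0%nat)) as [G [HG EG]]; auto.
    { intros x. destruct k. apply H2. apply (is_derive_continuous _ _ (r' 1%nat x)). apply H1. lia. }
    exists (fun i => match i with O => G | S j => r' j end). split; auto.
    split.
    + intros [|i] x Hi. apply HG. apply H1. lia.
    + exact H2.
Qed.

Lemma chain_continuous (k : nat) (r : nat -> R -> R) (i : nat) (x : R) :
  chain k r -> (i <= k)%nat -> continuous (r i) x.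
Proof.
  intros [H1 H2] Hi. destruct (Nat.eq_dec i k) as [->|Hn]; [apply H2|].
  apply (is_derive_continuous _ _ (r (S i) x)). apply H1. lia.
Qed.

Lemma continuous_bounded_on (f : R -> R) (a b : R) :
  (forall x, continuous f x) -> exists M, forall x, Icc a b x -> Rabs (f x) <= M.
Proof.
  intros H. destruct (Rle_dec a b) as [L|L].
  - destruct (continuity_ab_maj (fun x => Rabs (f x)) a b L) as [m [Hm _]].
    + intros c _. apply continuity_pt_filterlim.
      apply (continuous_comp f Rabs); [apply H|]. apply continuous_Rabs.
    + exists (Rabs (f m)). intros x Hx. apply Hm. exact Hx.
  - exists 0. intros x [H1 H2]. lra.
Qed.

Lemma chain_bounded (k : nat) (r : nat -> R -> R) (a b : R) :
  chain k r -> exists M, 0 < M /\ forall i x, (i <= k)%nat -> Icc a b x -> Rabs (r i x) <= M.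
Proof.
  intros H.
  assert (G : forall j, (j <= k)%nat ->
    exists M, 0 < M /\ forall i x, (i <= j)%nat -> Icc a b x -> Rabs (r i x) <= M).
  { induction j as [|j IH]; intros Hj.
    - destruct (continuous_bounded_on (r 0%nat) a b) as [M HM].
      { intros x. apply (chain_continuous k); auto. }
      exists (Rmax M 1). split. pose proof (Rmax_r M 1); lra.
      intros i x Hi Dx. replace i with 0%nat by lia.
      eapply Rle_trans; [apply HM; auto|apply Rmax_l].
    - destruct IH as [M1 [HM1 K1]]; [lia|].
      destruct (continuous_bounded_on (r (S j)) a b) as [M HM].
      { intros x. apply (chain_continuous k); auto. }
      exists (Rmax M M1). split. pose proof (Rmax_r M M1); lra.
      intros i x Hi Dx. destruct (Nat.eq_dec i (S j)) as [->|Hn].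
      + eapply Rle_trans; [apply HM; auto|apply Rmax_l].
      + eapply Rle_trans; [apply K1; auto; lia|apply Rmax_r]. }
  apply (G k). lia.
Qed.

Definition cpair (U V : R -> R) (x : R) : C := (U x, V x).

Lemma is_derive_within_cpair (a b : R) (f : R -> C) (U V : R -> R) (x : R) (u v : R) :
  Icc a b x -> eq_on a b f (cpair U V) -> is_derive U x u -> is_derive V x v ->
  is_derive_within (V := C_R_CompleteNormedModule) (Icc a b) f x (u, v).
Proof.
  intros Dx E HU HV. apply is_derive_within_C; auto. split.
  - apply (is_derive_within_of_is_derive _ _ U); auto. intros y Dy. rewrite E; auto.
  - apply (is_derive_within_of_is_derive _ _ V); auto. intros y Dy. rewrite E; auto.
Qed.

Lemma DC_cpair (a b : R) (f : R -> C) (U V : R -> R) (x : R) (u v : R) :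
  a < b -> Icc a b x -> eq_on a b f (cpair U V) -> is_derive U x u -> is_derive V x v ->
  DC a b f x = (u, v).
Proof. intros Hab Dx E HU HV. apply DC_eq; auto. eapply is_derive_within_cpair; eauto. Qed.

Lemma continuous_on_cpair (a b : R) (f : R -> C) (U V : R -> R) :
  eq_on a b f (cpair U V) -> (forall x, continuous U x) -> (forall x, continuous V x) ->
  C0C a b f.
Proof.
  intros E HU HV x Dx. apply filterlim_locally. intros eps.
  pose proof (proj1 (filterlim_locally U _) (HU x) eps) as [d1 H1].
  pose proof (proj1 (filterlim_locally V _) (HV x) eps) as [d2 H2].
  exists (mkposreal (Rmin d1 d2) (Rmin_pos _ _ (cond_pos d1) (cond_pos d2))).
  intros y Hy Dy. change (Rabs (y - x) < Rmin d1 d2) in Hy.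
  pose proof (Rmin_l d1 d2). pose proof (Rmin_r d1 d2).
  rewrite !E by auto. split; simpl.
  - apply H1. change (Rabs (y - x) < d1). lra.
  - apply H2. change (Rabs (y - x) < d2). lra.
Qed.

Lemma C0C_extend (a b : R) (f : R -> C) :
  a <= b -> C0C a b f ->
  exists U V, (forall x, continuous U x) /\ (forall x, continuous V x) /\ eq_on a b f (cpair U V).
Proof.
  intros Hab H.
  destruct (continuous_on_extend a b (fun x => fst (f x))) as [U [CU EU]]; auto.
  { intros x Dx. apply filterlim_locally. intros eps.
    pose proof (proj1 (filterlim_locally f _) (H x Dx) eps) as [d Hd].
    exists d. intros y Hy Dy. exact (proj1 (Hd y Hy Dy)). }
  destruct (continuous_on_extend a b (fun x => snd (f x))) as [V [CV EV]]; auto.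
  { intros x Dx. apply filterlim_locally. intros eps.
    pose proof (proj1 (filterlim_locally f _) (H x Dx) eps) as [d Hd].
    exists d. intros y Hy Dy. exact (proj2 (Hd y Hy Dy)). }
  exists U, V. split; [exact CU|split; [exact CV|]].
  intros x Dx. unfold cpair. rewrite <- EU, <- EV by auto.
  destruct (f x); reflexivity.
Qed.

Lemma C2C_chain (a b : R) (f : R -> C) :
  a < b -> C2C a b f ->
  exists U V, chain 2 U /\ chain 2 V /\
    eq_on a b f (cpair (U 0%nat) (V 0%nat)) /\
    eq_on a b (DC a b f) (cpair (U 1%nat) (V 1%nat)) /\
    eq_on a b (DC a b (DC a b f)) (cpair (U 2%nat) (V 2%nat)).
Proof.
  intros Hab [H1 [H2 H3]].
  assert (step : forall g g' : R -> C, g' = DC a b g ->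
    (forall x, Icc a b x -> exists l : C, is_derive_within (V := C_R_CompleteNormedModule) (Icc a b) g x l) ->
    forall U' V' : R -> R, (forall x, continuous U' x) -> (forall x, continuous V' x) ->
    eq_on a b g' (cpair U' V') ->
    exists U V, (forall x, is_derive U x (U' x)) /\ (forall x, is_derive V x (V' x)) /\
      eq_on a b g (cpair U V)).
  { intros g g' -> Hg U' V' CU CV E.
    assert (Hd : forall x, Icc a b x ->
      is_derive_within (V := C_R_CompleteNormedModule) (Icc a b) g x (DC a b g x)).
    { intros x Dx. destruct (Hg x Dx) as [l Hl]. rewrite (DC_eq a b g x l); auto. }
    destruct (derive_within_extend a b (fun x => fst (g x)) U' U') as [U [HU EU]]; auto.
    { intros x Dx. pose proof (proj1 (is_derive_within_C _ g x _ Dx) (Hd x Dx)) as [K _].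
      rewrite E in K by auto. exact K. }
    destruct (derive_within_extend a b (fun x => snd (g x)) V' V') as [V [HV EV]]; auto.
    { intros x Dx. pose proof (proj1 (is_derive_within_C _ g x _ Dx) (Hd x Dx)) as [_ K].
      rewrite E in K by auto. exact K. }
    exists U, V. split; [exact HU|split; [exact HV|]].
    intros x Dx. unfold cpair. rewrite <- EU, <- EV by auto.
    destruct (g x); reflexivity. }
  destruct (C0C_extend a b (DC a b (DC a b f))) as [U2 [V2 [CU2 [CV2 E2]]]]; [lra|exact H3|].
  destruct (step (DC a b f) _ eq_refl H2 U2 V2 CU2 CV2 E2) as [U1 [V1 [HU1 [HV1 E1]]]].
  assert (CU1 : forall x, continuous U1 x) by (intros x; eapply is_derive_continuous; eauto).
  assert (CV1 : forall x, continuous V1 x) by (intros x; eapply is_derive_continuous; eauto).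
  destruct (step f _ eq_refl H1 U1 V1 CU1 CV1 E1) as [U0 [V0 [HU0 [HV0 E0]]]].
  exists (fun i => match i with O => U0 | 1%nat => U1 | _ => U2 end).
  exists (fun i => match i with O => V0 | 1%nat => V1 | _ => V2 end).
  split; [|split; [|split; [|split; [|]]]]; auto.
  - split; [|exact CU2]. intros [|[|i]] x Hi; auto. lia.
  - split; [|exact CV2]. intros [|[|i]] x Hi; auto. lia.
Qed.

Lemma eq_on_trans (a b : R) (f g k : R -> C) : eq_on a b f g -> eq_on a b g k -> eq_on a b f k.
Proof. intros H1 H2 x Dx. rewrite H1, H2; auto. Qed.

Lemma C2C_of_chain (a b : R) (f : R -> C) (U V : nat -> R -> R) :
  a < b -> chain 2 U -> chain 2 V -> eq_on a b f (cpair (U 0%nat) (V 0%nat)) ->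
  C2C a b f /\
  eq_on a b (DC a b f) (cpair (U 1%nat) (V 1%nat)) /\
  eq_on a b (DC a b (DC a b f)) (cpair (U 2%nat) (V 2%nat)).
Proof.
  intros Hab [HU CU] [HV CV] E0.
  assert (E1 : eq_on a b (DC a b f) (cpair (U 1%nat) (V 1%nat))).
  { intros x Dx. apply (DC_cpair a b f (U 0%nat) (V 0%nat)); auto. }
  assert (E2 : eq_on a b (DC a b (DC a b f)) (cpair (U 2%nat) (V 2%nat))).
  { intros x Dx. apply (DC_cpair a b _ (U 1%nat) (V 1%nat)); auto. }
  split; [split; [|split]|split]; auto.
  - intros x Dx. exists (U 1%nat x, V 1%nat x). apply (is_derive_within_cpair a b f (U 0%nat) (V 0%nat)); auto.
  - intros x Dx. exists (U 2%nat x, V 2%nat x). apply (is_derive_within_cpair a b _ (U 1%nat) (V 1%nat)); auto.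
  - exact (continuous_on_cpair a b _ _ _ E2 CU CV).
Qed.

(** * Real functionals of complex values *)

(** For p^2 + q^2 = 1 this is the real part after a rotation. It commutes with operators that have
    real coefficients, and the modulus is the maximum over all rotations. *)
Definition proj (p q : R) (z : C) : R := p * fst z + q * snd z.

Lemma proj_le_Cmod (p q : R) (z : C) : p * p + q * q = 1 -> Rabs (proj p q z) <= Cmod z.
Proof.
  intros H. destruct z as [x y]. unfold proj, Cmod; simpl.
  rewrite <- sqrt_Rsqr_abs. apply sqrt_le_1_alt. unfold Rsqr.
  pose proof (Rle_0_sqr (p * y - q * x)) as Hs. unfold Rsqr in Hs.
  assert (x * (x * 1) + y * (y * 1) =
    (p * x + q * y) * (p * x + q * y) + (p * y - q * x) * (p * y - q * x)).
  { replace (x * (x * 1) + y * (y * 1)) with ((p * p + q * q) * (x * x + y * y)) by (rewrite H; ring). ring. }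
  lra.
Qed.

Lemma proj_attains (z : C) : exists p q, p * p + q * q = 1 /\ proj p q z = Cmod z.
Proof.
  destruct (Req_dec (Cmod z) 0) as [E|E].
  - exists 1, 0. split; [ring|]. apply Cmod_eq_0 in E as ->. rewrite Cmod_0. unfold proj; simpl. ring.
  - assert (Hsq : Cmod z * Cmod z = fst z * fst z + snd z * snd z).
    { unfold Cmod. rewrite sqrt_sqrt by nra. ring. }
    exists (fst z / Cmod z), (snd z / Cmod z). unfold proj. split.
    + replace (fst z / Cmod z * (fst z / Cmod z) + snd z / Cmod z * (snd z / Cmod z))
        with ((fst z * fst z + snd z * snd z) / (Cmod z * Cmod z)) by (field; auto).
      rewrite <- Hsq. field; auto.
    + replace (fst z / Cmod z * fst z + snd z / Cmod z * snd z)
        with ((fst z * fst z + snd z * snd z) / Cmod z) by (field; auto).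
      rewrite <- Hsq. field; auto.
Qed.

Lemma Cmod_le_of_proj (z : C) (m : R) :
  (forall p q, p * p + q * q = 1 -> proj p q z <= m) -> Cmod z <= m.
Proof. intros H. destruct (proj_attains z) as [p [q [H1 H2]]]. rewrite <- H2. auto. Qed.

(** Valid for arbitrary real p and q, hence also used to pass between A, C and A + C, A - C and to
    rescale a chain. *)
Lemma chain_proj (k : nat) (p q : R) (U V : nat -> R -> R) :
  chain k U -> chain k V -> chain k (fun i x => p * U i x + q * V i x).
Proof.
  intros [HU CU] [HV CV]. split.
  - intros i x Hi. apply (is_derive_plus (K := R_AbsRing) (V := R_NormedModule)
      (fun x => p * U i x) (fun x => q * V i x)).
    + apply (is_derive_scal (fun x => U i x)). auto.
    + apply (is_derive_scal (fun x => V i x)). auto.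
  - intros x. apply (continuous_plus (V := R_NormedModule) (fun x => p * U k x) (fun x => q * V k x)).
    + apply (continuous_scal_r (V := R_NormedModule) p (U k)). auto.
    + apply (continuous_scal_r (V := R_NormedModule) q (V k)). auto.
Qed.

(** * The sup norm on continuous functions *)

(** [real] sends infinite values to 0, which could exceed m; the value of f at a shows that the
    supremum is not minus infinity. *)
Lemma supnorm_le (a b : R) (f : R -> C) (m : R) :
  a <= b -> (forall x, Icc a b x -> Cmod (f x) <= m) -> supnorm a b f <= m.
Proof.
  intros Hab H. unfold supnorm.
  pose proof (Lub_Rbar_correct (fun r => exists x, Icc a b x /\ r = Cmod (f x))) as [H1 H2].
  assert (Rbar_le (Lub_Rbar (fun r => exists x, Icc a b x /\ r = Cmod (f x))) m) as K.
  { apply H2. intros r [x [Dx ->]]. simpl. auto. }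
  specialize (H1 (Cmod (f a)) (ex_intro _ a (conj (conj (Rle_refl a) Hab) eq_refl))).
  destruct (Lub_Rbar _); simpl in *; lra.
Qed.

Lemma supnorm_attained (a b : R) (f : R -> C) :
  a <= b -> C0C a b f -> exists x, Icc a b x /\ Cmod (f x) = supnorm a b f /\
    forall y, Icc a b y -> Cmod (f y) <= supnorm a b f.
Proof.
  intros Hab H. destruct (C0C_extend a b f Hab H) as [U [V [CU [CV E]]]].
  destruct (continuity_ab_maj (fun x => Cmod (cpair U V x)) a b Hab) as [m [Hm Dm]].
  { intros c _. apply continuity_pt_filterlim. unfold Cmod.
    change (continuous (fun x => sqrt (U x ^ 2 + V x ^ 2)) c).
    apply (continuous_comp (fun x => U x ^ 2 + V x ^ 2) sqrt); [|apply continuous_sqrt].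
    apply (continuous_plus (V := R_NormedModule) (fun x => U x ^ 2) (fun x => V x ^ 2)).
    - apply (continuous_comp U (fun y => y ^ 2)); auto. apply (ex_derive_continuous (V := R_NormedModule)). auto_derive; auto.
    - apply (continuous_comp V (fun y => y ^ 2)); auto. apply (ex_derive_continuous (V := R_NormedModule)). auto_derive; auto. }
  assert (Hs : supnorm a b f = Cmod (f m)).
  { unfold supnorm. rewrite (is_lub_Rbar_unique _ (Cmod (f m))); [reflexivity|].
    split.
    - intros r [x [Dx ->]]. simpl. rewrite !E; auto.
    - intros u Hu. apply Hu. exists m. auto. }
  exists m. rewrite Hs. split; [exact Dm|split; [reflexivity|]].
  intros y Dy. rewrite !E; auto.
Qed.

Lemma supnorm_ge (a b : R) (f : R -> C) (x : R) :
  C0C a b f -> Icc a b x -> Cmod (f x) <= supnorm a b f.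
Proof.
  intros H Dx. assert (Hab : a <= b) by (destruct Dx; lra).
  destruct (supnorm_attained a b f Hab H) as [y [Dy [_ K]]]. auto.
Qed.

Lemma C0C_ext (a b : R) (f g : R -> C) : eq_on a b f g -> C0C a b g -> C0C a b f.
Proof.
  intros E H x Dx. apply filterlim_locally. intros eps.
  pose proof (proj1 (filterlim_locally g _) (H x Dx) eps) as [d Hd].
  exists d. intros y Hy Dy. rewrite !E by auto. exact (Hd y Hy Dy).
Qed.

Lemma C0C_plus (a b : R) (f g : R -> C) :
  a <= b -> C0C a b f -> C0C a b g -> C0C a b (fun x => (f x + g x)%C).
Proof.
  intros Hab Hf Hg. destruct (C0C_extend a b f Hab Hf) as [U [V [CU [CV E]]]].
  destruct (C0C_extend a b g Hab Hg) as [U' [V' [CU' [CV' E']]]].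
  apply (continuous_on_cpair a b _ (fun y => U y + U' y) (fun y => V y + V' y)).
  - intros x Dx. rewrite E, E' by auto. reflexivity.
  - intros x. apply (continuous_plus (V := R_NormedModule) U U'); auto.
  - intros x. apply (continuous_plus (V := R_NormedModule) V V'); auto.
Qed.

Lemma Cmult_scal_pair (c z : C) :
  (c * z)%C = (fst c * fst z - snd c * snd z, fst c * snd z + snd c * fst z).
Proof. destruct c, z. reflexivity. Qed.

Lemma C0C_scal (a b : R) (c : C) (f : R -> C) :
  a <= b -> C0C a b f -> C0C a b (fun x => (c * f x)%C).
Proof.
  intros Hab Hf. destruct (C0C_extend a b f Hab Hf) as [U [V [CU [CV E]]]].
  assert (Hl : forall p q x, continuous (fun y => p * U y + q * V y) x).
  { intros p q x. apply (continuous_plus (V := R_NormedModule) (fun x => p * U x) (fun x => q * V x)).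
    - apply (continuous_scal_r (V := R_NormedModule) p U). auto.
    - apply (continuous_scal_r (V := R_NormedModule) q V). auto. }
  apply (continuous_on_cpair a b _ (fun y => fst c * U y + - snd c * V y)
    (fun y => snd c * U y + fst c * V y)); auto.
  intros x Dx. rewrite E by auto. rewrite Cmult_scal_pair. unfold cpair. simpl. f_equal; ring.
Qed.

(** * The Fokker-Planck expression and its maximum principles *)

Lemma is_derive_add (f g : R -> R) (x f' g' : R) :
  is_derive f x f' -> is_derive g x g' -> is_derive (fun t => f t + g t) x (f' + g').
Proof. exact (is_derive_plus (K := R_AbsRing) (V := R_NormedModule) f g x f' g'). Qed.

Lemma is_derive_sub (f g : R -> R) (x f' g' : R) :
  is_derive f x f' -> is_derive g x g' -> is_derive (fun t => f t - g t) x (f' - g').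
Proof. exact (is_derive_minus (K := R_AbsRing) (V := R_NormedModule) f g x f' g'). Qed.

Lemma is_derive_mul (f g : R -> R) (x f' g' : R) :
  is_derive f x f' -> is_derive g x g' ->
  is_derive (fun t => f t * g t) x (f' * g x + f x * g').
Proof.
  intros H1 H2. apply (is_derive_mult (K := R_AbsRing) f g x f' g' H1 H2).
  exact Rmult_comm.
Qed.

Lemma is_derive_cmul (c : R) (f : R -> R) (x f' : R) :
  is_derive f x f' -> is_derive (fun t => c * f t) x (c * f').
Proof. intros H. apply (is_derive_scal f x c f' H). Qed.

Lemma is_derive_cst (c x : R) : is_derive (fun _ : R => c) x 0.
Proof. exact (is_derive_const (K := R_AbsRing) (V := R_NormedModule) c x). Qed.

Lemma is_derive_val (f : R -> R) (x l l' : R) : is_derive f x l -> l = l' -> is_derive f x l'.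
Proof. intros H <-. exact H. Qed.

Ltac derive_rules :=
  lazymatch goal with
  | |- is_derive (fun t => @?f t - @?g t) _ _ => apply (is_derive_sub f g); derive_rules
  | |- is_derive (fun t => @?f t + @?g t) _ _ => apply (is_derive_add f g); derive_rules
  | |- is_derive (fun t => @?f t * @?g t) _ _ => apply (is_derive_mul f g); derive_rules
  | |- _ => first [eassumption | apply is_derive_cst]
  end.

(** This is h (s r)' - d r by the Leibniz rule, where s and d are the chains of A + C and A - C. The
    next definition is its derivative h (s r)'' - (d r)'. *)
Definition flux (h : R) (s d r : nat -> R -> R) (x : R) : R :=
  h * (s 0%nat x * r 1%nat x + s 1%nat x * r 0%nat x) - d 0%nat x * r 0%nat x.

Definition fp_expr (h : R) (s d r : nat -> R -> R) (x : R) : R :=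
  h * (s 0%nat x * r 2%nat x + 2 * (s 1%nat x * r 1%nat x) + s 2%nat x * r 0%nat x)
  - (d 0%nat x * r 1%nat x + d 1%nat x * r 0%nat x).

Lemma flux_derive (h : R) (s d r : nat -> R -> R) (x : R) :
  chain 4 s -> chain 4 d -> chain 2 r ->
  is_derive (flux h s d r) x (fp_expr h s d r x).
Proof.
  intros [Hs _] [Hd _] [Hr _].
  pose proof (Hs 0%nat x ltac:(lia)). pose proof (Hs 1%nat x ltac:(lia)).
  pose proof (Hd 0%nat x ltac:(lia)).
  pose proof (Hr 0%nat x ltac:(lia)). pose proof (Hr 1%nat x ltac:(lia)).
  unfold flux, fp_expr. eapply is_derive_val; [derive_rules|]. simpl. ring.
Qed.

Record fp_coefs (eta : R) (A B : R -> R) (s d : nat -> R -> R) : Prop := {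
  coef_s : chain 4 s;
  coef_d : chain 4 d;
  coef_sE : forall x, Icc (- eta) (1 + eta) x -> A x + B x = s 0%nat x;
  coef_dE : forall x, Icc (- eta) (1 + eta) x -> A x - B x = d 0%nat x }.

(** For N = 0 the convention / 0 = 0 gives mesh 0, so that [lo_lt_hi] holds for every N. *)
Lemma mesh_nonneg (N : nat) : 0 <= mesh N.
Proof.
  unfold mesh. destruct N as [|N].
  - simpl. rewrite Rmult_0_r, Rinv_0. lra.
  - left. apply Rinv_0_lt_compat. pose proof (lt_0_INR (S N) ltac:(lia)). lra.
Qed.

Lemma lo_lt_hi (N : nat) : lo N < hi N.
Proof. unfold lo, hi. pose proof (mesh_nonneg N). lra. Qed.

Lemma FP_cpair (eta : R) (A B : R -> R) (s d : nat -> R -> R) (N : nat) (f : R -> C)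
  (U V : nat -> R -> R) :
  fp_coefs eta A B s d -> mesh N < eta -> chain 2 U -> chain 2 V ->
  eq_on (lo N) (hi N) f (cpair (U 0%nat) (V 0%nat)) ->
  eq_on (lo N) (hi N) (FP_op A B N f)
    (cpair (fp_expr (mesh N) s d U) (fp_expr (mesh N) s d V)) /\
  eq_on (lo N) (hi N) (FP_flux A B N f)
    (cpair (flux (mesh N) s d U) (flux (mesh N) s d V)).
Proof.
  intros [Cs Cd sE dE] Hh [HU _] [HV _] E0. pose proof (lo_lt_hi N) as Hab.
  destruct Cs as [Hs _]. destruct Cd as [Hd _].
  assert (Dx' : forall x, Icc (lo N) (hi N) x -> Icc (- eta) (1 + eta) x).
  { unfold Icc, lo, hi. intros x Hx. lra. }
  set (g := fun y => (RtoC (A y + B y) * f y)%C).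
  set (k := fun y => (RtoC (A y - B y) * f y)%C).
  assert (Eg : eq_on (lo N) (hi N) g
    (cpair (fun x => s 0%nat x * U 0%nat x) (fun x => s 0%nat x * V 0%nat x))).
  { intros x Dx. unfold g. rewrite E0, sE by auto. unfold cpair.
    apply injective_projections; simpl; ring. }
  assert (Ek : eq_on (lo N) (hi N) k
    (cpair (fun x => d 0%nat x * U 0%nat x) (fun x => d 0%nat x * V 0%nat x))).
  { intros x Dx. unfold k. rewrite E0, dE by auto. unfold cpair.
    apply injective_projections; simpl; ring. }
  assert (Eg1 : eq_on (lo N) (hi N) (DC (lo N) (hi N) g)
    (cpair (fun x => s 1%nat x * U 0%nat x + s 0%nat x * U 1%nat x)
           (fun x => s 1%nat x * V 0%nat x + s 0%nat x * V 1%nat x))).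
  { intros x Dx. eapply DC_cpair; eauto; apply is_derive_mul; auto with arith. }
  assert (Ek1 : eq_on (lo N) (hi N) (DC (lo N) (hi N) k)
    (cpair (fun x => d 1%nat x * U 0%nat x + d 0%nat x * U 1%nat x)
           (fun x => d 1%nat x * V 0%nat x + d 0%nat x * V 1%nat x))).
  { intros x Dx. eapply DC_cpair; eauto; apply is_derive_mul; auto with arith. }
  split; intros x Dx.
  - unfold FP_op. fold g k. rewrite Ek1 by auto.
    (* With h = 1 and zero drift [fp_expr] is just (s U)'', the second derivative wanted here. *)
    rewrite (DC_cpair _ _ _ _ _ x
      (fp_expr 1 s (fun _ _ => 0) U x) (fp_expr 1 s (fun _ _ => 0) V x) Hab Dx Eg1).
    + unfold cpair, fp_expr. apply injective_projections; simpl; ring.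
    + eapply is_derive_val.
      * apply is_derive_add; apply is_derive_mul; auto with arith.
      * unfold fp_expr. ring.
    + eapply is_derive_val.
      * apply is_derive_add; apply is_derive_mul; auto with arith.
      * unfold fp_expr. ring.
  - unfold FP_flux. fold g. rewrite Eg1, E0, dE by auto.
    unfold cpair, flux. apply injective_projections; simpl; ring.
Qed.

(** The coefficients are real, so every real functional of f satisfies the same real expression and
    the same boundary conditions. All later estimates are made on this real chain. *)
Lemma FP_dom_chain (eta : R) (A B : R -> R) (s d : nat -> R -> R) (N : nat) (f : R -> C)
  (p q : R) :
  fp_coefs eta A B s d -> mesh N < eta -> FP_dom A B N f ->
  exists r, chain 2 r /\
    (forall x, Icc (lo N) (hi N) x ->
       proj p q (f x) = r 0%nat x /\
       proj p q (DC (lo N) (hi N) f x) = r 1%nat x /\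
       proj p q (DC (lo N) (hi N) (DC (lo N) (hi N) f) x) = r 2%nat x /\
       proj p q (FP_op A B N f x) = fp_expr (mesh N) s d r x) /\
    flux (mesh N) s d r (lo N) = 0 /\ flux (mesh N) s d r (hi N) = 0.
Proof.
  intros Hc Hh [H2 [Fl Fh]]. pose proof (lo_lt_hi N) as Hab.
  destruct (C2C_chain _ _ f Hab H2) as [U [V [HU [HV [E0 [E1 E2]]]]]].
  destruct (FP_cpair eta A B s d N f U V Hc Hh HU HV E0) as [Eop Efl].
  exists (fun i x => p * U i x + q * V i x). split; [apply chain_proj; auto|split; [|split]].
  - intros x Dx. rewrite E0, E1, E2, Eop by auto. unfold proj, cpair, fp_expr. simpl.
    repeat split. ring.
  - rewrite Efl in Fl by (split; lra). unfold cpair in Fl. injection Fl as F1 F2.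
    transitivity (p * flux (mesh N) s d U (lo N) + q * flux (mesh N) s d V (lo N)).
    { unfold flux. ring. } rewrite F1, F2. ring.
  - rewrite Efl in Fh by (split; lra). unfold cpair in Fh. injection Fh as F1 F2.
    transitivity (p * flux (mesh N) s d U (hi N) + q * flux (mesh N) s d V (hi N)).
    { unfold flux. ring. } rewrite F1, F2. ring.
Qed.

Lemma abs_mul_le (x y X Y : R) : Rabs x <= X -> Rabs y <= Y -> Rabs (x * y) <= X * Y.
Proof.
  intros. rewrite Rabs_mult. apply Rmult_le_compat; auto; apply Rabs_pos.
Qed.

Lemma abs_div_le (c y Y k : R) : 0 < k -> k <= c -> Rabs (c * y) <= Y -> Rabs y <= Y / k.
Proof.
  intros Hk Hc H. rewrite Rabs_mult, (Rabs_pos_eq c) in H by lra.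
  pose proof (Rabs_pos y).
  apply (Rmult_le_reg_l k); auto. replace (k * (Y / k)) with Y by (field; lra). nra.
Qed.

(* Integrating [flux' = fp_expr] from the end where the flux vanishes bounds the flux, hence r',
   hence r''. *)
Lemma elliptic_bound (a b h sig M : R) (s d : nat -> R -> R) :
  a < b -> 0 < h -> 0 < sig -> 0 < M -> chain 4 s -> chain 4 d ->
  (forall x, Icc a b x -> sig <= s 0%nat x) ->
  (forall i x, (i <= 4)%nat -> Icc a b x -> Rabs (s i x) <= M /\ Rabs (d i x) <= M) ->
  exists K, 0 < K /\ forall r m, chain 2 r -> flux h s d r a = 0 ->
    (forall x, Icc a b x -> Rabs (r 0%nat x) <= m /\ Rabs (fp_expr h s d r x) <= m) ->
    forall x, Icc a b x -> Rabs (r 2%nat x) <= K * m.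
Proof.
  intros Hab Hh Hsig HM Cs Cd Hs HB.
  (* Bound for r': in h s r' = flux - h s' r + d r the three terms are at most (b - a) m, h M m and
     M m, and h s is at least h sig. *)
  set (K1 := ((b - a) + h * M + M) / (h * sig)).
  assert (Hhs : 0 < h * sig) by nra.
  assert (HK1 : 0 < K1).
  { apply Rdiv_lt_0_compat; auto. nra. }
  (* One summand for each term of h s r'' = [fp_expr] - 2 h s' r' - h s'' r + d r' + d' r. *)
  exists ((1 + 2 * h * (M * K1) + h * M + M * K1 + M) / (h * sig)). split.
  { apply Rdiv_lt_0_compat; auto. assert (0 < M * K1) by nra. nra. }
  intros r m Cr Fa Hr x Dx.
  destruct (Hr x Dx) as [Hr0 Hg].
  assert (Hm : 0 <= m) by (pose proof (Rabs_pos (r 0%nat x)); lra).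
  destruct (HB 0%nat x ltac:(lia) Dx) as [S0 D0].
  destruct (HB 1%nat x ltac:(lia) Dx) as [S1 D1].
  destruct (HB 2%nat x ltac:(lia) Dx) as [S2 _].
  assert (Hflux : Rabs (flux h s d r x) <= (b - a) * m).
  { destruct (MVT_global (flux h s d r) (fp_expr h s d r) a x) as [c [Hc E]].
    { intros y. apply flux_derive; auto. }
    destruct Dx as [Dx1 Dx2]. rewrite Rmin_left, Rmax_right in Hc by lra.
    rewrite Fa, Rminus_0_r in E. rewrite E. rewrite Rmult_comm.
    apply abs_mul_le. rewrite Rabs_pos_eq; lra. apply Hr. split; lra. }
  pose proof (abs_mul_le _ _ _ _ S1 Hr0) as P1.
  pose proof (abs_mul_le _ _ _ _ D0 Hr0) as P2.
  assert (sh : h * sig <= h * s 0%nat x) by (specialize (Hs x Dx); nra).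
  assert (Hr1 : Rabs (r 1%nat x) <= K1 * m).
  { replace (K1 * m) with (((b - a) * m + h * (M * m) + M * m) / (h * sig))
      by (unfold K1; field; lra).
    apply (abs_div_le (h * s 0%nat x)); auto.
    replace (h * s 0%nat x * r 1%nat x) with
      (flux h s d r x - h * (s 1%nat x * r 0%nat x) + d 0%nat x * r 0%nat x) by (unfold flux; ring).
    apply Rabs_le_between in P1, P2, Hflux. apply Rabs_le. nra. }
  pose proof (abs_mul_le _ _ _ _ S1 Hr1) as P3.
  pose proof (abs_mul_le _ _ _ _ D0 Hr1) as P4.
  pose proof (abs_mul_le _ _ _ _ S2 Hr0) as P5.
  pose proof (abs_mul_le _ _ _ _ D1 Hr0) as P6.
  match goal with |- _ <= ?X / ?Y * m => replace (X / Y * m) with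
    ((m + 2 * h * (M * (K1 * m)) + h * (M * m) + M * (K1 * m) + M * m) / Y) by (field; lra) end.
  apply (abs_div_le (h * s 0%nat x)); auto.
  replace (h * s 0%nat x * r 2%nat x) with
    (fp_expr h s d r x - 2 * h * (s 1%nat x * r 1%nat x) - h * (s 2%nat x * r 0%nat x)
     + d 0%nat x * r 1%nat x + d 1%nat x * r 0%nat x) by (unfold fp_expr; ring).
  apply Rabs_le_between in P3, P4, P5, P6, Hg. apply Rabs_le.
  set (u := s 1%nat x * r 1%nat x) in *. set (v := s 2%nat x * r 0%nat x) in *.
  assert (- (h * (M * (K1 * m))) <= h * u <= h * (M * (K1 * m))) by (split; nra).
  assert (- (h * (M * m)) <= h * v <= h * (M * m)) by (split; nra).
  lra.
Qed.

(** On an interval of length at least 1 the mean slope is at most 2 m0 and is attained by r' at some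
    c; from there r' changes by at most m2 times the length, which is at most 2. *)
Lemma first_derivative_bound (r : nat -> R -> R) (a b m0 m2 : R) :
  chain 2 r -> 1 <= b - a <= 2 ->
  (forall x, Icc a b x -> Rabs (r 0%nat x) <= m0) ->
  (forall x, Icc a b x -> Rabs (r 2%nat x) <= m2) ->
  forall x, Icc a b x -> Rabs (r 1%nat x) <= 2 * (m0 + m2).
Proof.
  intros [Hr _] Hab H0 H2 x Dx.
  destruct (MVT_global (r 0%nat) (r 1%nat) a b) as [c [Hc E]]; [intros; apply Hr; lia|].
  rewrite Rmin_left, Rmax_right in Hc by lra.
  destruct (MVT_global (r 1%nat) (r 2%nat) c x) as [e [He E']]; [intros; apply Hr; lia|].
  assert (De : Icc a b e).
  { destruct Dx. unfold Icc. unfold Rmin, Rmax in He. repeat destruct Rle_dec; lra. }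
  pose proof (H0 a ltac:(split; lra)) as Ha. pose proof (H0 b ltac:(split; lra)) as Hb.
  assert (Hc1 : Rabs (r 1%nat c) <= 2 * m0).
  { assert (Rabs (r 1%nat c * (b - a)) <= 2 * m0).
    { rewrite <- E. apply Rabs_le_between in Ha, Hb. apply Rabs_le. lra. }
    rewrite Rabs_mult, (Rabs_pos_eq (b - a)) in H by lra.
    pose proof (Rabs_pos (r 1%nat c)). nra. }
  assert (Hx1 : Rabs (r 2%nat e * (x - c)) <= m2 * 2).
  { apply abs_mul_le; auto. apply Rabs_le. destruct Dx. lra. }
  rewrite <- E' in Hx1. apply Rabs_le_between in Hc1, Hx1. apply Rabs_le. lra.
Qed.

Lemma local_max_derive (f : R -> R) (x l e : R) :
  0 < e -> (forall y, Rabs (y - x) < e -> f y <= f x) -> is_derive f x l -> l = 0.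
Proof.
  intros He Hm Hd. destruct (Req_dec l 0) as [E|E]; [exact E|exfalso].
  assert (Hl : 0 < Rabs l) by (apply Rabs_pos_lt; auto).
  destruct (proj1 (is_derive_eps f x l) Hd (Rabs l / 2)) as [w [Hw K]]; [lra|].
  set (z := Rmin w e / 2).
  assert (Hz : 0 < z) by (unfold z; pose proof (Rmin_pos w e Hw He); lra).
  assert (z < w /\ z < e).
  { unfold z in *; pose proof (Rmin_l w e); pose proof (Rmin_r w e); lra. }
  destruct (Rlt_dec 0 l) as [L|L].
  - rewrite (Rabs_pos_eq l) in * by lra.
    specialize (K (x + z)). specialize (Hm (x + z)).
    replace (x + z - x) with z in * by ring. rewrite (Rabs_pos_eq z) in * by lra.
    specialize (K ltac:(lra)). specialize (Hm ltac:(lra)).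
    apply Rabs_le_between in K. nra.
  - rewrite (Rabs_left l) in * by lra.
    specialize (K (x - z)). specialize (Hm (x - z)).
    replace (x - z - x) with (- z) in * by ring. rewrite Rabs_Ropp, (Rabs_pos_eq z) in * by lra.
    specialize (K ltac:(lra)). specialize (Hm ltac:(lra)).
    apply Rabs_le_between in K. nra.
Qed.

Lemma local_max_second (f f1 : R -> R) (x l e : R) :
  0 < e -> (forall y, Rabs (y - x) < e -> f y <= f x) ->
  (forall y, Rabs (y - x) < e -> is_derive f y (f1 y)) ->
  is_derive f1 x l -> f1 x = 0 /\ l <= 0.
Proof.
  intros He Hm Hd Hl.
  assert (E1 : f1 x = 0).
  { apply (local_max_derive f x _ e); auto. apply Hd. rewrite Rminus_diag, Rabs_R0; auto. }
  split; auto. destruct (Rle_dec l 0) as [L|L]; [exact L|exfalso].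
  destruct (proj1 (is_derive_eps f1 x l) Hl (l / 2)) as [w [Hw K]]; [lra|].
  set (z := Rmin w e / 2).
  assert (Hz : 0 < z) by (unfold z; pose proof (Rmin_pos w e Hw He); lra).
  assert (z < w /\ z < e).
  { unfold z in *; pose proof (Rmin_l w e); pose proof (Rmin_r w e); lra. }
  destruct (MVT_cor2 f f1 x (x + z)) as [c [Hc Dc]]; [lra| |].
  { intros c Hc. apply is_derive_Reals, Hd. rewrite Rabs_pos_eq; lra. }
  specialize (Hm (x + z)). replace (x + z - x) with z in * by ring.
  rewrite (Rabs_pos_eq z) in Hm by lra. specialize (Hm ltac:(lra)).
  specialize (K c). rewrite E1, (Rabs_pos_eq (c - x)) in K by lra.
  specialize (K ltac:(lra)). apply Rabs_le_between in K.
  assert (0 < f1 c) by nra. nra.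
Qed.

(* The drift condition at the two ends gives r' the sign of r at a and the opposite sign at b,
   so that the positive maximum of r is interior. *)
Lemma max_principle_value (a b h m M : R) (s d r : nat -> R -> R) (x : R) :
  a < b -> 0 < h <= 1 -> chain 4 s -> chain 4 d -> chain 2 r ->
  (forall y, Icc a b y -> 0 < s 0%nat y) ->
  Rabs (s 2%nat x) <= M -> Rabs (d 1%nat x) <= M ->
  0 < d 0%nat a - h * s 1%nat a -> d 0%nat b - h * s 1%nat b < 0 ->
  flux h s d r a = 0 -> flux h s d r b = 0 ->
  Icc a b x -> 0 < r 0%nat x -> (forall y, Icc a b y -> r 0%nat y <= r 0%nat x) ->
  fp_expr h s d r x <= 2 * M * r 0%nat x.
Proof.
  intros Hab Hh Cs Cd [Hr Cr] Hs HM1 HM2 Da Db Fa Fb Dx Hpos Hm.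
  assert (Hd : forall y, is_derive (r 0%nat) y (r 1%nat y)) by (intros; apply Hr; lia).
  assert (Ha : x <> a).
  { intros ->. assert (0 < r 1%nat a).
    { unfold flux in Fa. pose proof (Hs a Dx).
      assert (h * s 0%nat a * r 1%nat a = (d 0%nat a - h * s 1%nat a) * r 0%nat a) by lra.
      assert (0 < h * s 0%nat a) by nra.
      assert (0 < h * s 0%nat a * r 1%nat a) by (rewrite H0; nra). nra. }
    destruct (proj1 (is_derive_eps _ a _) (Hd a) (r 1%nat a / 2)) as [w [Hw K]]; [lra|].
    set (z := Rmin w (b - a) / 2).
    assert (Hz : 0 < z) by (unfold z; pose proof (Rmin_pos w (b - a) Hw); lra).
    assert (z < w /\ z < b - a).
    { unfold z in *; pose proof (Rmin_l w (b - a)); pose proof (Rmin_r w (b - a)); lra. }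
    specialize (K (a + z)). specialize (Hm (a + z) ltac:(split; lra)).
    replace (a + z - a) with z in K by ring. rewrite (Rabs_pos_eq z) in K by lra.
    specialize (K ltac:(lra)). apply Rabs_le_between in K. nra. }
  assert (Hb : x <> b).
  { intros ->. assert (r 1%nat b < 0).
    { unfold flux in Fb. pose proof (Hs b Dx).
      assert (h * s 0%nat b * r 1%nat b = (d 0%nat b - h * s 1%nat b) * r 0%nat b) by lra.
      assert (0 < h * s 0%nat b) by nra.
      assert (h * s 0%nat b * r 1%nat b < 0) by (rewrite H0; nra). nra. }
    destruct (proj1 (is_derive_eps _ b _) (Hd b) (- r 1%nat b / 2)) as [w [Hw K]]; [lra|].
    set (z := Rmin w (b - a) / 2).
    assert (Hz : 0 < z) by (unfold z; pose proof (Rmin_pos w (b - a) Hw); lra).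
    assert (z < w /\ z < b - a).
    { unfold z in *; pose proof (Rmin_l w (b - a)); pose proof (Rmin_r w (b - a)); lra. }
    specialize (K (b - z)). specialize (Hm (b - z) ltac:(split; lra)).
    replace (b - z - b) with (- z) in K by ring. rewrite Rabs_Ropp, (Rabs_pos_eq z) in K by lra.
    specialize (K ltac:(lra)). apply Rabs_le_between in K. nra. }
  set (e := Rmin (x - a) (b - x)).
  assert (He : 0 < e) by (destruct Dx; apply Rmin_pos; lra).
  assert (Hin : forall y, Rabs (y - x) < e -> Icc a b y).
  { intros y Hy. apply Rabs_def2 in Hy. unfold e in Hy.
    pose proof (Rmin_l (x - a) (b - x)). pose proof (Rmin_r (x - a) (b - x)). split; lra. }
  destruct (local_max_second (r 0%nat) (r 1%nat) x (r 2%nat x) e) as [E1 E2]; auto.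
  (* With r' = 0 and r'' <= 0 only (h s'' - d') r remains, and h <= 1 bounds the bracket by 2 M. *)
  unfold fp_expr. rewrite E1. pose proof (Hs x Dx).
  assert (s 0%nat x * r 2%nat x <= 0) by nra.
  assert (h * (s 0%nat x * r 2%nat x) <= 0) by nra.
  assert (HM0 : 0 <= M) by (pose proof (Rabs_pos (s 2%nat x)); lra).
  apply Rabs_le_between in HM1, HM2.
  assert (h * s 2%nat x <= M).
  { destruct (Rle_dec 0 (s 2%nat x)); nra. }
  assert ((h * s 2%nat x - d 1%nat x) * r 0%nat x <= 2 * M * r 0%nat x).
  { apply Rmult_le_compat_r; lra. }
  lra.
Qed.

Lemma is_derive_quot (f g : R -> R) (x f' g' : R) :
  g x <> 0 -> is_derive f x f' -> is_derive g x g' ->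
  is_derive (fun t => f t / g t) x ((f' - f x / g x * g') / g x).
Proof.
  intros Hg Hf Hd. eapply is_derive_val. apply is_derive_div; eauto. field. auto.
Qed.

(* At an interior maximum of r'' the terms of [(fp_expr r)''] that involve r''' and r'''' drop out. *)
Lemma max_principle_second (a b h M : R) (s d r g : nat -> R -> R) (x : R) :
  a < x < b -> 0 < h <= 1 -> chain 4 s -> chain 4 d -> chain 2 r -> chain 2 g ->
  (forall y, Icc a b y -> 0 < s 0%nat y) ->
  (forall i, (i <= 4)%nat -> Rabs (s i x) <= M /\ Rabs (d i x) <= M) ->
  (forall y, Icc a b y -> g 0%nat y = fp_expr h s d r y) ->
  (forall y, Icc a b y -> r 2%nat y <= r 2%nat x) ->
  g 2%nat x <= 9 * M * (Rabs (r 0%nat x) + Rabs (r 1%nat x) + Rabs (r 2%nat x)).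
Proof.
  intros Hx Hh [Hs _] [Hd _] [Hr _] [Hg _] Hpos HB Eg Hm.
  set (e := Rmin (x - a) (b - x)).
  assert (He : 0 < e) by (apply Rmin_pos; lra).
  assert (Hin : forall y, Rabs (y - x) < e -> a < y < b).
  { intros y Hy. apply Rabs_def2 in Hy. unfold e in Hy.
    pose proof (Rmin_l (x - a) (b - x)). pose proof (Rmin_r (x - a) (b - x)). lra. }
  (* Gain of regularity: r is only C^2, but g = [fp_expr] r is C^2 too. Solving for the leading term
     gives r'' = P / q with q = h s, and P is differentiable because it contains no r''. *)
  set (P := fun y => g 0%nat y - ((2 * h) * (s 1%nat y * r 1%nat y) + h * (s 2%nat y * r 0%nat y)
     - (d 0%nat y * r 1%nat y + d 1%nat y * r 0%nat y))).
  set (P1 := fun y => g 1%nat y - ((2 * h) * (s 2%nat y * r 1%nat y + s 1%nat y * r 2%nat y)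
     + h * (s 3%nat y * r 0%nat y + s 2%nat y * r 1%nat y)
     - (d 1%nat y * r 1%nat y + d 0%nat y * r 2%nat y + (d 2%nat y * r 0%nat y + d 1%nat y * r 1%nat y)))).
  set (q := fun y => h * s 0%nat y).
  assert (Hq : forall y, a < y < b -> q y <> 0).
  { intros y Hy. unfold q. pose proof (Hpos y ltac:(split; lra)). nra. }
  assert (Er : forall y, a < y < b -> r 2%nat y = P y / q y).
  { intros y Hy. specialize (Hq y Hy).
    apply (Rmult_eq_reg_l (q y)); auto. replace (q y * (P y / q y)) with (P y) by (field; auto).
    unfold P. rewrite Eg by (split; lra). unfold q, fp_expr. ring. }
  assert (dq : forall y, is_derive q y (h * s 1%nat y)).
  { intros y. apply is_derive_cmul. apply Hs; lia. }
  assert (dP : forall y, is_derive P y (P1 y)).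
  { intros y.
    pose proof (Hs 0%nat y ltac:(lia)). pose proof (Hs 1%nat y ltac:(lia)). pose proof (Hs 2%nat y ltac:(lia)).
    pose proof (Hd 0%nat y ltac:(lia)). pose proof (Hd 1%nat y ltac:(lia)).
    pose proof (Hr 0%nat y ltac:(lia)). pose proof (Hr 1%nat y ltac:(lia)).
    pose proof (Hg 0%nat y ltac:(lia)).
    eapply is_derive_val; [unfold P; derive_rules|]. simpl. unfold P1. ring. }
  (* The derivative of P / q, with P / q written back as r''. As r'' is now differentiable, so is
     this expression, which yields a fourth derivative. *)
  set (r3 := fun y => (P1 y - r 2%nat y * (h * s 1%nat y)) / q y).
  assert (dr2 : forall y, a < y < b -> is_derive (r 2%nat) y (r3 y)).
  { intros y Hy. apply (is_derive_ext_loc (fun t => P t / q t)).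
    - assert (Hw : 0 < Rmin (y - a) (b - y)) by (apply Rmin_pos; lra).
      exists (mkposreal _ Hw). intros z Hz. symmetry. apply Er.
      change (Rabs (z - y) < Rmin (y - a) (b - y)) in Hz. apply Rabs_def2 in Hz.
      pose proof (Rmin_l (y - a) (b - y)). pose proof (Rmin_r (y - a) (b - y)). lra.
    - eapply is_derive_val; [apply is_derive_quot; eauto|]. simpl. unfold r3. rewrite Er by auto. reflexivity. }
  (* Leibniz coefficients 1, 4, 6, 4, 1 of (s r)'''' and 1, 3, 3, 1 of (d r)''', solved for the term
     with the fourth derivative. *)
  assert (dr3 : exists r4, is_derive r3 x r4 /\
    q x * r4 = g 2%nat x
      - (h * (6 * (s 2%nat x * r 2%nat x) + 4 * (s 3%nat x * r 1%nat x) + s 4%nat x * r 0%nat x)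
         - (3 * (d 1%nat x * r 2%nat x) + 3 * (d 2%nat x * r 1%nat x) + d 3%nat x * r 0%nat x))
      - (4 * h * s 1%nat x - d 0%nat x) * r3 x).
  { pose proof (Hs 0%nat x ltac:(lia)). pose proof (Hs 1%nat x ltac:(lia)). pose proof (Hs 2%nat x ltac:(lia)).
    pose proof (Hs 3%nat x ltac:(lia)).
    pose proof (Hd 0%nat x ltac:(lia)). pose proof (Hd 1%nat x ltac:(lia)). pose proof (Hd 2%nat x ltac:(lia)).
    pose proof (Hr 0%nat x ltac:(lia)). pose proof (Hr 1%nat x ltac:(lia)). pose proof (dr2 x Hx).
    pose proof (Hg 1%nat x ltac:(lia)). pose proof (dq x).
    eexists. split.
    - unfold r3. apply is_derive_quot; [apply Hq; auto| |eassumption].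
      unfold P1. derive_rules.
    - cbv beta. specialize (Hq x Hx).
      match goal with |- q x * ((?u - ?v / q x * ?w) / q x) = _ =>
        replace (q x * ((u - v / q x * w) / q x)) with (u - v / q x * w) by (field; auto);
        change (v / q x) with (r3 x) end.
      simpl. ring. }
  destruct dr3 as [r4 [dr3 E4]].
  destruct (local_max_second (r 2%nat) r3 x r4 e) as [E1 E2]; auto.
  { intros y Hy. apply Hm. specialize (Hin y Hy). split; lra. }
  rewrite E1 in E4.
  assert (q x * r4 <= 0).
  { unfold q. pose proof (Hpos x ltac:(split; lra)). assert (0 < h * s 0%nat x) by nra. nra. }
  destruct (HB 1%nat ltac:(lia)) as [_ D1]. destruct (HB 2%nat ltac:(lia)) as [S2 D2].
  destruct (HB 3%nat ltac:(lia)) as [S3 D3]. destruct (HB 4%nat ltac:(lia)) as [S4 _].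
  pose proof (abs_mul_le _ _ _ _ S2 (Rle_refl (Rabs (r 2%nat x)))) as Q1.
  pose proof (abs_mul_le _ _ _ _ S3 (Rle_refl (Rabs (r 1%nat x)))) as Q2.
  pose proof (abs_mul_le _ _ _ _ S4 (Rle_refl (Rabs (r 0%nat x)))) as Q3.
  pose proof (abs_mul_le _ _ _ _ D1 (Rle_refl (Rabs (r 2%nat x)))) as Q4.
  pose proof (abs_mul_le _ _ _ _ D2 (Rle_refl (Rabs (r 1%nat x)))) as Q5.
  pose proof (abs_mul_le _ _ _ _ D3 (Rle_refl (Rabs (r 0%nat x)))) as Q6.
  assert (HM : 0 <= M) by (pose proof (Rabs_pos (s 2%nat x)); lra).
  pose proof (Rabs_pos (r 0%nat x)). pose proof (Rabs_pos (r 1%nat x)). pose proof (Rabs_pos (r 2%nat x)).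
  apply Rabs_le_between in Q1, Q2, Q3, Q4, Q5, Q6.
  assert (0 <= M * Rabs (r 0%nat x)) by nra.
  assert (0 <= M * Rabs (r 1%nat x)) by nra.
  assert (0 <= M * Rabs (r 2%nat x)) by nra.
  (* The part carrying the factor h <= 1. Together with the drift part the coefficients of |r''|,
     |r'|, |r| are 6 + 3, 4 + 3 and 1 + 1, all at most 9. *)
  set (T := 6 * (s 2%nat x * r 2%nat x) + 4 * (s 3%nat x * r 1%nat x) + s 4%nat x * r 0%nat x) in *.
  assert (h * T <= 6 * (M * Rabs (r 2%nat x)) + 4 * (M * Rabs (r 1%nat x)) + M * Rabs (r 0%nat x)).
  { destruct (Rle_dec 0 T); [|nra]. apply Rle_trans with T. nra. unfold T. lra. }
  lra.
Qed.

(** * Comparison of the master equation with finite volumes *)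

Definition continuous_upto (t0 : R) (psi : R -> R) : Prop :=
  forall t, 0 <= t <= t0 -> forall eps, 0 < eps -> exists e, 0 < e /\
    forall r, 0 <= r <= t0 -> Rabs (r - t) < e -> Rabs (psi r - psi t) < eps.

(** One-sided because the barrier argument looks back from the first contact time, before which psi
    lies below the barrier. *)
Definition left_derivative (w : R -> R) (t l : R) : Prop :=
  forall eps, 0 < eps -> exists e, 0 < e /\
    forall r, 0 <= r <= t -> t - r < e -> Rabs (w t - w r - (t - r) * l) <= eps * (t - r).

(* At the first time when psi meets a barrier growing at rate K + 1, the function w touching psi
   from below would have to grow faster than its left derivative allows. *)
Lemma gronwall_touching (psi : R -> R) (t0 K : R) :
  0 <= K -> 0 <= psi 0 -> continuous_upto t0 psi ->
  (forall t, 0 < t <= t0 -> 0 < psi t -> exists w l,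
     w t = psi t /\ (forall r, 0 <= r <= t -> w r <= psi r) /\
     l <= K * psi t /\ left_derivative w t l) ->
  forall t, 0 <= t <= t0 -> psi t <= psi 0 * exp ((K + 1) * t).
Proof.
  intros HK H0 Hc Ht T HT.
  apply Rnot_lt_le. intros Hlt.
  (* Chosen so that the barrier [E] passes through psi T at time T; if the claim fails at T, it
     starts strictly above psi 0. *)
  set (c := psi T * exp (- ((K + 1) * T))).
  assert (Hex : forall t, 0 < exp ((K + 1) * t)) by (intros; apply exp_pos).
  assert (Hcc : c * exp ((K + 1) * T) = psi T).
  { unfold c. rewrite Rmult_assoc, <- exp_plus, Rplus_opp_l, exp_0. ring. }
  assert (Hc0 : psi 0 < c).
  { apply (Rmult_lt_reg_r (exp ((K + 1) * T))); [apply Hex|]. rewrite Hcc. exact Hlt. }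
  set (E := fun t => c * exp ((K + 1) * t)).
  assert (HE0 : E 0 = c) by (unfold E; rewrite Rmult_0_r, exp_0; ring).
  assert (HEpos : forall t, 0 < E t) by (intros t; unfold E; specialize (Hex t); nra).
  assert (HEd : forall t, is_derive E t ((K + 1) * E t)).
  { intros t. unfold E. auto_derive; auto. ring. }
  (* The supremum [t1] of this set is the first contact time; continuity forces equality of psi and
     [E] there. *)
  set (S := fun t => 0 <= t <= T /\ forall r, 0 <= r < t -> psi r < E r).
  destruct (completeness S) as [t1 [Hub Hlub]].
  { exists T. intros t [Hx _]. lra. }
  { exists 0. split; [lra|]. intros r Hr. lra. }
  assert (Ht1 : 0 <= t1 <= T).
  { split. apply Hub. split; [lra|]. intros r Hr. lra. apply Hlub. intros t [Hx _]. lra. }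
  assert (Hbelow : forall r, 0 <= r < t1 -> psi r < E r).
  { intros r Hr. destruct (Rlt_dec (psi r) (E r)) as [L|L]; [exact L|exfalso].
    assert (t1 <= r); [|lra]. apply Hlub. intros t [Hx Hy].
    apply Rnot_lt_le. intros Hrt. apply L, Hy. lra. }
  assert (Hclose : forall eps, 0 < eps -> exists e, 0 < e /\ forall r, 0 <= r <= t0 ->
     Rabs (r - t1) < e -> Rabs ((E r - psi r) - (E t1 - psi t1)) < eps).
  { intros eps He. destruct (Hc t1 ltac:(lra) (eps / 2)) as [e1 [He1 K1]]; [lra|].
    pose proof (proj1 (filterlim_locally E _) (is_derive_continuous _ _ _ (HEd t1))
      (mkposreal (eps / 2) ltac:(lra))) as [e2 K2].
    exists (Rmin e1 e2). split. apply Rmin_pos; auto. apply cond_pos.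
    intros r Hr Hrt. pose proof (Rmin_l e1 e2). pose proof (Rmin_r e1 e2).
    specialize (K1 r Hr ltac:(lra)).
    assert (K2' : Rabs (E r - E t1) < eps / 2) by (apply K2; change (Rabs (r - t1) < e2); lra).
    apply Rabs_def2 in K1, K2'. apply Rabs_def1; lra. }
  assert (Hge : E t1 <= psi t1).
  { apply Rnot_lt_le. intros L.
    destruct (Rle_lt_or_eq_dec t1 T ltac:(lra)) as [LT|ET].
    2:{ rewrite ET in L. unfold E in L. lra. }
    destruct (Hclose (E t1 - psi t1)) as [e [He K1]]; [lra|].
    set (t2 := t1 + Rmin (e / 2) (T - t1)).
    assert (0 < Rmin (e / 2) (T - t1)) by (apply Rmin_pos; lra).
    pose proof (Rmin_l (e / 2) (T - t1)). pose proof (Rmin_r (e / 2) (T - t1)).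
    assert (t2 <= t1); [|unfold t2 in *; lra].
    apply Hub. split; [unfold t2; lra|]. intros r Hr.
    destruct (Rlt_dec r t1) as [L1|L1]; [apply Hbelow; lra|].
    assert (Hx : Rabs (r - t1) < e) by (rewrite Rabs_pos_eq; unfold t2 in Hr; lra).
    specialize (K1 r ltac:(unfold t2 in Hr; lra) Hx). apply Rabs_def2 in K1. lra. }
  assert (Hpos : 0 < t1).
  { destruct (Req_dec t1 0) as [E0|E0]; [|lra]. rewrite E0, HE0 in Hge. lra. }
  assert (Hle : psi t1 <= E t1).
  { apply Rnot_lt_le. intros L.
    destruct (Hclose (psi t1 - E t1)) as [e [He K1]]; [lra|].
    set (r := t1 - Rmin (e / 2) t1).
    assert (0 < Rmin (e / 2) t1) by (apply Rmin_pos; lra).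
    pose proof (Rmin_l (e / 2) t1). pose proof (Rmin_r (e / 2) t1).
    assert (Hx : Rabs (r - t1) < e) by (rewrite Rabs_left1; unfold r; lra).
    specialize (K1 r ltac:(unfold r; lra) Hx). specialize (Hbelow r ltac:(unfold r; lra)).
    apply Rabs_def2 in K1. lra. }
  assert (Heq : psi t1 = E t1) by lra.
  destruct (Ht t1 ltac:(lra)) as [w [l [Hw [Hwle [Hl Hd]]]]]; [rewrite Heq; auto|].
  pose proof (HEpos t1) as HE1.
  (* The slope (K + 1) E of the barrier exceeds l <= K E by E; two tolerances of E / 4 use up only
     half of this gap. *)
  destruct (Hd (E t1 / 4)) as [e1 [He1 K1]]; [lra|].
  destruct (proj1 (is_derive_eps E t1 _) (HEd t1) (E t1 / 4)) as [e2 [He2 K2]]; [lra|].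
  set (m := Rmin (Rmin e1 e2 / 2) t1).
  assert (Hm : 0 < m) by (apply Rmin_pos; auto; pose proof (Rmin_pos e1 e2 He1 He2); lra).
  assert (m <= t1 /\ m < e1 /\ m < e2).
  { pose proof (Rmin_l (Rmin e1 e2 / 2) t1). pose proof (Rmin_r (Rmin e1 e2 / 2) t1).
    pose proof (Rmin_l e1 e2). pose proof (Rmin_r e1 e2). pose proof (Rmin_pos e1 e2 He1 He2).
    fold m in H, H1. lra. }
  set (r := t1 - m).
  specialize (K1 r ltac:(unfold r; lra) ltac:(unfold r; lra)).
  specialize (K2 r). replace (r - t1) with (- m) in K2 by (unfold r; ring).
  rewrite Rabs_Ropp, (Rabs_pos_eq m) in K2 by lra. specialize (K2 ltac:(lra)).
  replace (t1 - r) with m in K1 by (unfold r; ring).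
  specialize (Hwle r ltac:(unfold r; lra)). specialize (Hbelow r ltac:(unfold r; lra)).
  apply Rabs_le_between in K1, K2. rewrite Heq in *. rewrite Hw in K1.
  assert (m * l <= m * (K * E t1)) by (apply Rmult_le_compat_l; lra).
  assert (0 < m * E t1) by nra. lra.
Qed.

(** * Linear growth of the mass *)

(** The factor counts the indices of the block that are at most N; truncated subtraction makes it 0
    while the block has not begun. Allowing incomplete blocks lets the induction on N run. *)
Lemma sum_ge_count (f : nat -> R) (m : R) (k0 n N : nat) :
  (forall k, (k <= N)%nat -> 0 <= f k) ->
  (forall k, (k0 <= k < k0 + n)%nat -> m <= f k) ->
  INR (Nat.min (S N) (k0 + n) - k0) * m <= sum_f_R0 f N.
Proof.
  intros H0 Hm. induction N as [|N IH].
  - simpl sum_f_R0. destruct (Nat.min_spec 1 (k0 + n)) as [[L ->]|[L ->]].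
    + destruct k0; simpl Nat.sub.
      * simpl. rewrite Rmult_1_l. apply Hm. lia.
      * simpl. rewrite Rmult_0_l. apply H0. lia.
    + replace (k0 + n - k0)%nat with n by lia.
      destruct n as [|[|n]]; [|destruct k0; [|lia]|lia].
      * simpl. rewrite Rmult_0_l. apply H0. lia.
      * simpl. rewrite Rmult_1_l. apply Hm. lia.
  - specialize (IH ltac:(intros; apply H0; lia)). simpl sum_f_R0.
    specialize (H0 (S N) ltac:(lia)).
    destruct (le_lt_dec (k0 + n) (S N)) as [L|L].
    + rewrite Nat.min_r in * by lia. lra.
    + rewrite Nat.min_l in * by lia.
      destruct (le_lt_dec k0 (S N)) as [L1|L1].
      * replace (S (S N) - k0)%nat with (S (S N - k0)) by lia. rewrite S_INR.
        specialize (Hm (S N) ltac:(lia)). lra.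
      * replace (S (S N) - k0)%nat with 0%nat by lia.
        replace (S N - k0)%nat with 0%nat in IH by lia. simpl INR in *. lra.
Qed.

Lemma grid_Icc (N k : nat) : (0 < N)%nat -> (k <= N)%nat -> 0 <= INR k / INR N <= 1.
Proof.
  intros HN Hk. pose proof (lt_0_INR N HN). pose proof (pos_INR k). apply le_INR in Hk.
  split. apply Rmult_le_pos; auto. left; apply Rinv_0_lt_compat; auto.
  apply (Rmult_le_reg_r (INR N)); auto. unfold Rdiv. rewrite Rmult_assoc, Rinv_l by lra. lra.
Qed.

(** By continuity u is at least half of u x0 on an interval around x0 in [0,1], which contains a
    fixed proportion of the grid once N is large. The finitely many remaining N with positive mass
    only lower the constant. *)
Lemma mass_lower_bound (u : R -> R) :
  (forall x, Icc 0 1 x -> 0 <= u x) -> continuous_on (Icc 0 1) u -> nonzero01 u ->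
  exists c, 0 < c /\ forall N, (0 < N)%nat -> 0 < mass u N -> c * INR N <= mass u N.
Proof.
  intros Hu Hc [x0 [Dx Hx]].
  set (m := u x0 / 2).
  assert (Hm : 0 < m) by (unfold m; pose proof (Hu x0 Dx); lra).
  pose proof (proj1 (filterlim_locally u _) (Hc x0 Dx) (mkposreal m Hm)) as [e He].
  set (al := Rmax 0 (x0 - e / 2)). set (be := Rmin 1 (x0 + e / 2)).
  pose proof (cond_pos e) as He0.
  assert (Hal : 0 <= al) by apply Rmax_l.
  assert (Hbe : be <= 1) by apply Rmin_l.
  assert (Hl : 0 < be - al).
  { unfold al, be, Rmax, Rmin. destruct Dx. repeat destruct Rle_dec; lra. }
  assert (Hin : forall x, al <= x <= be -> m <= u x).
  { intros x Hab.
    assert (x0 - e / 2 <= al) by apply Rmax_r. assert (be <= x0 + e / 2) by apply Rmin_r.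
    assert (Hb : ball (u x0) m (u x)).
    { apply He. change (Rabs (x - x0) < e). apply Rabs_def1; lra. split; lra. }
    change (Rabs (u x - u x0) < m) in Hb. apply Rabs_def2 in Hb. unfold m in *. lra. }
  set (l := be - al) in *.
  assert (Hlarge : forall N, (0 < N)%nat -> 4 <= l * INR N -> m * l / 2 * INR N <= mass u N).
  { intros N HN H4. pose proof (lt_0_INR N HN) as HN'.
    (* The indices k1 + 1, ..., k1 + n have grid points in [al, be], and n > l N - 2 >= l N / 2
       because l N >= 4. *)
    destruct (nfloor_ex (al * INR N)) as [k1 Hk1]; [nra|].
    destruct (nfloor_ex (l * INR N - 1)) as [n Hn]; [lra|].
    assert (Hk0 : INR (S k1) = INR k1 + 1) by apply S_INR.
    assert (Hkn : (S k1 + n <= S N)%nat).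
    { apply INR_le. rewrite plus_INR, !S_INR.
      assert (be * INR N <= INR N) by nra. unfold l in Hn. lra. }
    pose proof (sum_ge_count (fun k => u (INR k / INR N)) m (S k1) n N) as Hs.
    rewrite Nat.min_r in Hs by lia. replace (S k1 + n - S k1)%nat with n in Hs by lia.
    unfold mass. eapply Rle_trans; [|apply Hs].
    - assert (l * INR N / 2 <= INR n) by lra. nra.
    - intros k Hk. apply Hu, grid_Icc; auto.
    - intros k [Hk2 Hk3]. apply Hin.
      assert (INR (S k1) <= INR k) by (apply le_INR; lia).
      assert (INR (S k) <= INR (S k1 + n)) by (apply le_INR; lia).
      rewrite plus_INR, !S_INR in H0. unfold l in *.
      split; apply (Rmult_le_reg_r (INR N)); auto; unfold Rdiv; rewrite Rmult_assoc, Rinv_l by lra; lra. }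
  assert (Hsmall : forall N1, exists c, 0 < c /\
     forall N, (N < N1)%nat -> 0 < mass u N -> c * INR N <= mass u N).
  { induction N1 as [|N1 [c [Hc0 IH]]].
    - exists 1. split; [lra|]. intros; lia.
    - destruct (Rlt_dec 0 (mass u N1)) as [L|L].
      + pose proof (pos_INR N1) as HN1.
        (* The added 1 keeps the denominator positive when N1 = 0. *)
        exists (Rmin c (mass u N1 / (INR N1 + 1))). split.
        { apply Rmin_pos; auto. apply Rdiv_lt_0_compat; lra. }
        intros N HN HmN. pose proof (pos_INR N).
        destruct (Nat.eq_dec N N1) as [->|Hne].
        * apply Rle_trans with (mass u N1 / (INR N1 + 1) * INR N1).
          { apply Rmult_le_compat_r; auto. apply Rmin_r. }
          apply (Rmult_le_reg_r (INR N1 + 1)); [lra|].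
          replace (mass u N1 / (INR N1 + 1) * INR N1 * (INR N1 + 1)) with (mass u N1 * INR N1) by (field; lra).
          nra.
        * eapply Rle_trans; [|apply IH; auto; lia]. apply Rmult_le_compat_r; auto. apply Rmin_l.
      + exists c. split; auto. intros N HN HmN. destruct (Nat.eq_dec N N1) as [->|Hne]; [lra|].
        apply IH; auto. lia. }
  destruct (nfloor_ex (4 / l)) as [n4 Hn4]. { left. apply Rdiv_lt_0_compat; lra. }
  destruct (Hsmall (S n4)) as [c [Hc0 Hcs]].
  exists (Rmin c (m * l / 2)). split. { apply Rmin_pos; nra. }
  intros N HN HmN. pose proof (pos_INR N).
  destruct (le_lt_dec (S n4) N) as [L|L].
  - eapply Rle_trans; [apply Rmult_le_compat_r; [auto|apply Rmin_r]|]. apply Hlarge; auto.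
    apply le_INR in L. rewrite S_INR in L.
    replace 4 with (l * (4 / l)) by (field; lra). apply Rmult_le_compat_l; lra.
  - eapply Rle_trans; [apply Rmult_le_compat_r; [auto|apply Rmin_l]|]. auto.
Qed.

(** * Truncation error at the grid points *)

(** Two mean value steps write the remainder as f2 b (c - y) e. The factor 1/2 of the sharp Taylor
    bound is given away. *)
Lemma taylor_two (f f1 f2 : R -> R) (y e m : R) :
  (forall x, is_derive f x (f1 x)) -> (forall x, is_derive f1 x (f2 x)) ->
  (forall x, Rabs (x - y) <= Rabs e -> Rabs (f2 x) <= m) ->
  Rabs (f (y + e) - (f y + e * f1 y)) <= m * (e * e).
Proof.
  intros H1 H2 Hm.
  destruct (MVT_global f f1 y (y + e)) as [c [Hc E]]; auto.
  destruct (MVT_global f1 f2 y c) as [b [Hb E']]; auto.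
  assert (Hcy : Rabs (c - y) <= Rabs e).
  { unfold Rabs, Rmin, Rmax in *. repeat destruct Rle_dec; repeat destruct Rcase_abs; lra. }
  assert (Hby : Rabs (b - y) <= Rabs e).
  { unfold Rabs, Rmin, Rmax in *. repeat destruct Rle_dec; repeat destruct Rcase_abs; lra. }
  replace (f (y + e) - (f y + e * f1 y)) with (f2 b * ((c - y) * e)).
  2:{ replace (y + e - y) with e in E by ring.
      replace (f2 b * ((c - y) * e)) with ((f1 c - f1 y) * e) by (rewrite E'; ring).
      replace (f (y + e)) with (f y + f1 c * e) by lra. ring. }
  rewrite Rabs_mult. apply Rmult_le_compat; try apply Rabs_pos; auto.
  rewrite Rabs_mult. replace (e * e) with (Rabs e * Rabs e).
  - apply Rmult_le_compat_r; auto. apply Rabs_pos.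
  - rewrite <- Rabs_mult. apply Rabs_pos_eq. nra.
Qed.

Definition prod0 (c r : nat -> R -> R) (x : R) := c 0%nat x * r 0%nat x.
Definition prod1 (c r : nat -> R -> R) (x : R) := c 1%nat x * r 0%nat x + c 0%nat x * r 1%nat x.
Definition prod2 (c r : nat -> R -> R) (x : R) :=
  c 2%nat x * r 0%nat x + 2 * (c 1%nat x * r 1%nat x) + c 0%nat x * r 2%nat x.

Lemma prod_derive (c r : nat -> R -> R) :
  chain 4 c -> chain 2 r ->
  (forall x, is_derive (prod0 c r) x (prod1 c r x)) /\
  (forall x, is_derive (prod1 c r) x (prod2 c r x)).
Proof.
  intros [Hc _] [Hr _]. split; intros x.
  - unfold prod0, prod1. apply is_derive_mul; auto with arith.
  - eapply is_derive_val.
    + unfold prod1. apply is_derive_add; apply is_derive_mul; auto with arith.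
    + unfold prod2. ring.
Qed.

Lemma prod2_bound (c r : nat -> R -> R) (x M m : R) :
  (forall i, (i <= 2)%nat -> Rabs (c i x) <= M) -> (forall i, (i <= 2)%nat -> Rabs (r i x) <= m) ->
  Rabs (prod2 c r x) <= 4 * (M * m).
Proof.
  intros Hc Hr.
  pose proof (abs_mul_le _ _ _ _ (Hc 2%nat ltac:(lia)) (Hr 0%nat ltac:(lia))) as P1.
  pose proof (abs_mul_le _ _ _ _ (Hc 1%nat ltac:(lia)) (Hr 1%nat ltac:(lia))) as P2.
  pose proof (abs_mul_le _ _ _ _ (Hc 0%nat ltac:(lia)) (Hr 2%nat ltac:(lia))) as P3.
  apply Rabs_le_between in P1, P2, P3. unfold prod2. apply Rabs_le. lra.
Qed.

(* The terms A(k/N) v(k/N) and C((k+1)/N) v((k+1)/N) of the jump flux are Taylor expanded at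
   y = k/N + h. *)
Lemma half_flux (a b h M m : R) (s d r : nat -> R -> R) (y : R) :
  0 < h -> chain 4 s -> chain 4 d -> chain 2 r ->
  (forall i x, (i <= 4)%nat -> Icc a b x -> Rabs (s i x) <= M /\ Rabs (d i x) <= M) ->
  (forall i x, (i <= 2)%nat -> Icc a b x -> Rabs (r i x) <= m) ->
  a <= y - h -> y + h <= b ->
  Rabs (flux h s d r y -
    ((s 0%nat (y + h) - d 0%nat (y + h)) / 2 * r 0%nat (y + h) -
     (s 0%nat (y - h) + d 0%nat (y - h)) / 2 * r 0%nat (y - h))) <= 8 * (M * m) * (h * h).
Proof.
  intros Hh Cs Cd Cr HB Hr Ha Hb.
  (* [al] and [be] are the chains of A and C recovered from their sum and difference. *)
  set (al := fun i x => / 2 * s i x + / 2 * d i x).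
  set (be := fun i x => / 2 * s i x + (- / 2) * d i x).
  assert (Cal : chain 4 al) by (apply (chain_proj 4 (/ 2) (/ 2)); auto).
  assert (Cbe : chain 4 be) by (apply (chain_proj 4 (/ 2) (- / 2)); auto).
  assert (Bal : forall x, Icc a b x -> Rabs (prod2 al r x) <= 4 * (M * m)).
  { intros x Dx. apply prod2_bound; intros i Hi; [|auto].
    destruct (HB i x ltac:(lia) Dx) as [H1 H2]. unfold al.
    apply Rabs_le_between in H1, H2. apply Rabs_le. lra. }
  assert (Bbe : forall x, Icc a b x -> Rabs (prod2 be r x) <= 4 * (M * m)).
  { intros x Dx. apply prod2_bound; intros i Hi; [|auto].
    destruct (HB i x ltac:(lia) Dx) as [H1 H2]. unfold be.
    apply Rabs_le_between in H1, H2. apply Rabs_le. lra. }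
  destruct (prod_derive al r Cal Cr) as [Da1 Da2].
  destruct (prod_derive be r Cbe Cr) as [Db1 Db2].
  (* In be r (y + h) - al r (y - h) the zeroth-order part is (be - al) r = - d r and the first-order
     part is h ((be + al) r)' = h (s r)', together exactly the flux. Each remainder is at most 4 M m
     h^2. *)
  pose proof (taylor_two _ _ _ y (- h) (4 * (M * m)) Da1 Da2) as Ta.
  pose proof (taylor_two _ _ _ y h (4 * (M * m)) Db1 Db2) as Tb.
  assert (Hin : forall x, Rabs (x - y) <= h -> Icc a b x).
  { intros x Hx. apply Rabs_le_between in Hx. split; lra. }
  rewrite Rabs_Ropp, (Rabs_pos_eq h) in Ta by lra. rewrite (Rabs_pos_eq h) in Tb by lra.
  specialize (Ta ltac:(auto)). specialize (Tb ltac:(auto)).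
  replace (y + - h) with (y - h) in Ta by ring.
  unfold flux. unfold prod0, prod1, al, be in Ta, Tb.
  apply Rabs_le_between in Ta, Tb. apply Rabs_le. split; lra.
Qed.

(** No third derivative of r enters: the diffusion part has the factor h in front and is estimated
    by its size, giving 8 M m h; only the drift part (d r)' uses the mean value theorem, giving 4 M
    m h. *)
Lemma fp_expr_lipschitz (a b h M m : R) (s d r : nat -> R -> R) (x y : R) :
  0 < h -> chain 4 s -> chain 4 d -> chain 2 r ->
  (forall i x, (i <= 4)%nat -> Icc a b x -> Rabs (s i x) <= M /\ Rabs (d i x) <= M) ->
  (forall i x, (i <= 2)%nat -> Icc a b x -> Rabs (r i x) <= m) ->
  Icc a b x -> Icc a b y -> Rabs (y - x) <= h ->
  Rabs (fp_expr h s d r y - fp_expr h s d r x) <= 12 * (M * m) * h.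
Proof.
  intros Hh Cs Cd Cr HB Hr Dx Dy Hxy.
  destruct (prod_derive d r Cd Cr) as [_ Dd2].
  destruct (MVT_global (prod1 d r) (prod2 d r) x y Dd2) as [c [Hc E]].
  assert (Dc : Icc a b c).
  { destruct Dx, Dy. unfold Icc, Rmin, Rmax in *. repeat destruct Rle_dec; lra. }
  assert (Bd : Rabs (prod2 d r c * (y - x)) <= 4 * (M * m) * h).
  { apply abs_mul_le; auto. apply prod2_bound; intros i Hi; [|auto]. apply HB; auto; lia. }
  rewrite <- E in Bd.
  assert (Bs : forall z, Icc a b z -> Rabs (prod2 s r z) <= 4 * (M * m)).
  { intros z Dz. apply prod2_bound; intros i Hi; [|auto]. apply HB; auto; lia. }
  replace (fp_expr h s d r y - fp_expr h s d r x)
    with (h * (prod2 s r y - prod2 s r x) - (prod1 d r y - prod1 d r x))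
    by (unfold fp_expr, prod1, prod2; ring).
  assert (Rabs (h * (prod2 s r y - prod2 s r x)) <= h * (8 * (M * m))).
  { apply abs_mul_le. rewrite Rabs_pos_eq; lra.
    pose proof (Bs x Dx) as B1. pose proof (Bs y Dy) as B2.
    apply Rabs_le_between in B1, B2. apply Rabs_le. lra. }
  apply Rabs_le_between in H, Bd. apply Rabs_le. lra.
Qed.

Lemma INR_mesh (N : nat) : (0 < N)%nat -> 0 < mesh N /\ INR N = / (2 * mesh N).
Proof.
  intros HN. pose proof (lt_0_INR N HN). unfold mesh. split.
  - apply Rinv_0_lt_compat. lra.
  - field. lra.
Qed.

Lemma grid_S (N k : nat) : (0 < N)%nat -> INR (S k) / INR N = INR k / INR N + 2 * mesh N.
Proof. intros HN. pose proof (lt_0_INR N HN). rewrite S_INR. unfold mesh. field. lra. Qed.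

(** The constant 20 is 12 + 8: replacing [fp_expr] at the cell centre by a difference quotient of
    the flux costs 12 M m h, and replacing the two fluxes by jump fluxes costs N times 16 M m
    h^2. *)
Lemma truncation_error (eta : R) (A B : R -> R) (s d r : nat -> R -> R) (N : nat) (M m : R)
  (k : nat) :
  fp_coefs eta A B s d -> (0 < N)%nat -> mesh N < eta -> A 1 = 0 -> B 0 = 0 -> chain 2 r ->
  (forall i x, (i <= 4)%nat -> Icc (lo N) (hi N) x -> Rabs (s i x) <= M /\ Rabs (d i x) <= M) ->
  (forall i x, (i <= 2)%nat -> Icc (lo N) (hi N) x -> Rabs (r i x) <= m) ->
  flux (mesh N) s d r (lo N) = 0 -> flux (mesh N) s d r (hi N) = 0 -> (k <= N)%nat ->
  Rabs (fp_expr (mesh N) s d r (INR k / INR N)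
        - master_rhs A B N (fun j => r 0%nat (INR j / INR N)) k) <= 20 * (M * m) * mesh N.
Proof.
  intros [Cs Cd sE dE] HN Heta A1 B0 Cr HB Hr Fl Fh Hk.
  destruct (INR_mesh N HN) as [Hh EN]. set (h := mesh N) in *.
  set (X := fun j => INR j / INR N).
  assert (HX : forall j, (j <= N)%nat -> 0 <= X j <= 1) by (intros; apply grid_Icc; auto).
  assert (HA : forall j, (j <= N)%nat -> A (X j) = (s 0%nat (X j) + d 0%nat (X j)) / 2).
  { intros j Hj. specialize (HX j Hj). rewrite <- sE, <- dE by (split; lra). lra. }
  assert (HBB : forall j, (j <= N)%nat -> B (X j) = (s 0%nat (X j) - d 0%nat (X j)) / 2).
  { intros j Hj. specialize (HX j Hj). rewrite <- sE, <- dE by (split; lra). lra. }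
  assert (Hmid : forall j, (j < N)%nat ->
    Rabs (flux h s d r (X j + h) - (B (X (S j)) * r 0%nat (X (S j)) - A (X j) * r 0%nat (X j)))
      <= 8 * (M * m) * (h * h)).
  { intros j Hj. rewrite HA, HBB by lia.
    assert (ES : X (S j) = X j + h + h) by (unfold X; rewrite grid_S by auto; fold h; ring).
    pose proof (HX j ltac:(lia)). pose proof (HX (S j) ltac:(lia)).
    pose proof (half_flux (lo N) (hi N) h M m s d r (X j + h) Hh Cs Cd Cr HB Hr) as P.
    rewrite <- ES in P. replace (X j + h - h) with (X j) in P by ring.
    apply P; unfold lo, hi; fold h; lra. }
  assert (Dk : Icc (lo N) (hi N) (X k)).
  { pose proof (HX k Hk). unfold Icc, lo, hi. fold h. lra. }
  (* As N = 1 / (2 h) and the cell has length 2 h, the scaled flux difference is the value of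
     [fp_expr] at some point within h of the centre. *)
  assert (Hcell : Rabs (fp_expr h s d r (X k) -
     INR N * (flux h s d r (X k + h) - flux h s d r (X k - h))) <= 12 * (M * m) * h).
  { destruct (MVT_global (flux h s d r) (fp_expr h s d r) (X k - h) (X k + h)) as [c [Hc E]].
    { intros; apply flux_derive; auto. }
    rewrite Rmin_left, Rmax_right in Hc by lra. rewrite E, EN.
    replace (/ (2 * h) * (fp_expr h s d r c * (X k + h - (X k - h)))) with (fp_expr h s d r c) by (field; lra).
    apply (fp_expr_lipschitz (lo N) (hi N)); auto.
    - pose proof (HX k Hk). unfold Icc, lo, hi. fold h. lra.
    - apply Rabs_le. lra. }
  assert (Hright : Rabs (flux h s d r (X k + h) -
     ((if Nat.ltb k N then B (X (S k)) * r 0%nat (X (S k)) else 0) - A (X k) * r 0%nat (X k)))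
     <= 8 * (M * m) * (h * h)).
  { destruct (Nat.ltb k N) eqn:E.
    - apply Nat.ltb_lt in E. apply Hmid. auto.
    (* The outer end of the last cell is [hi N]: the flux vanishes there by the boundary condition
       and the jump flux because A 1 = 0. At the first cell B 0 = 0 plays this part. *)
    - apply Nat.ltb_ge in E. assert (k = N) by lia. subst k.
      assert (EX : X N = 1) by (unfold X; field; rewrite EN; apply Rinv_neq_0_compat; lra).
      rewrite EX, A1. replace (1 + h) with (hi N) by reflexivity. rewrite Fh.
      replace (0 - (0 - 0 * r 0%nat 1)) with 0 by ring. rewrite Rabs_R0.
      pose proof (abs_mul_le _ _ _ _ (proj1 (HB 0%nat _ ltac:(lia) Dk)) (Hr 0%nat _ ltac:(lia) Dk)) as Q.
      pose proof (Rabs_pos (s 0%nat (X N) * r 0%nat (X N))). nra. }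
  assert (Hleft : Rabs (flux h s d r (X k - h) -
     (B (X k) * r 0%nat (X k) - match k with O => 0 | S j => A (X j) * r 0%nat (X j) end))
     <= 8 * (M * m) * (h * h)).
  { destruct k as [|j].
    - assert (EX : X 0%nat = 0) by (unfold X; simpl; unfold Rdiv; ring).
      rewrite EX, B0. replace (0 - h) with (lo N) by (unfold lo; fold h; ring). rewrite Fl.
      replace (0 - (0 * r 0%nat 0 - 0)) with 0 by ring. rewrite Rabs_R0.
      pose proof (abs_mul_le _ _ _ _ (proj1 (HB 0%nat _ ltac:(lia) Dk)) (Hr 0%nat _ ltac:(lia) Dk)) as Q.
      pose proof (Rabs_pos (s 0%nat (X 0%nat) * r 0%nat (X 0%nat))). nra.
    - replace (X (S j) - h) with (X j + h) by (unfold X; rewrite grid_S by auto; fold h; ring).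
      apply Hmid. lia. }
  set (Rr := (if Nat.ltb k N then B (X (S k)) * r 0%nat (X (S k)) else 0)) in *.
  set (Ll := match k with O => 0 | S j => A (X j) * r 0%nat (X j) end) in *.
  assert (Em : master_rhs A B N (fun j => r 0%nat (X j)) k =
     INR N * ((Rr - A (X k) * r 0%nat (X k)) - (B (X k) * r 0%nat (X k) - Ll))).
  { unfold master_rhs, rate, Rr, Ll. unfold X. destruct k as [|j]; destruct (Nat.ltb _ N); ring. }
  unfold X in Em at 1. rewrite Em. fold (X k).
  set (a1 := Rr - A (X k) * r 0%nat (X k)) in *.
  set (a2 := B (X k) * r 0%nat (X k) - Ll) in *.
  assert (Hd : Rabs (INR N * ((flux h s d r (X k + h) - a1) - (flux h s d r (X k - h) - a2)))
     <= INR N * (16 * (M * m) * (h * h))).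
  { apply abs_mul_le.
    - rewrite Rabs_pos_eq; [lra|apply pos_INR].
    - apply Rabs_le_between in Hright, Hleft. apply Rabs_le. lra. }
  replace (INR N * (16 * (M * m) * (h * h))) with (8 * (M * m) * h) in Hd by (rewrite EN; field; lra).
  apply Rabs_le_between in Hd, Hcell. apply Rabs_le. lra.
Qed.

(** * Maximum principle for the master equation *)

Lemma master_rhs_linear (A B : R -> R) (N : nat) (f g : nat -> R) (c : R) (k : nat) :
  master_rhs A B N (fun j => f j - c * g j) k
  = master_rhs A B N f k - c * master_rhs A B N g k.
Proof. unfold master_rhs. destruct k; destruct (Nat.ltb _ N); ring. Qed.

(** The system conserves total mass rather than constants, so constants may grow. Inserting the
    maximum E for the neighbours leaves the differences of a and of c between adjacent sites, each
    at most M, because the factor N in the rates cancels the grid spacing 1/N. *)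
Lemma master_max_principle (A B : R -> R) (N : nat) (M E : R) (f : nat -> R) (k : nat) :
  (0 < N)%nat ->
  (forall x, 0 <= x <= 1 -> 0 <= A x) -> (forall x, 0 <= x <= 1 -> 0 <= B x) ->
  0 <= M ->
  (forall x y, 0 <= x <= 1 -> 0 <= y <= 1 -> Rabs (A x - A y) <= M * Rabs (x - y)) ->
  (forall x y, 0 <= x <= 1 -> 0 <= y <= 1 -> Rabs (B x - B y) <= M * Rabs (x - y)) ->
  0 <= E -> (k <= N)%nat -> (forall j, (j <= N)%nat -> f j <= E) -> f k = E ->
  master_rhs A B N f k <= 2 * M * E.
Proof.
  intros HN HA HB HM LA LB HE Hk Hf Ek.
  pose proof (lt_0_INR N HN) as HN'.
  set (X := fun j => INR j / INR N).
  assert (HX : forall j, (j <= N)%nat -> 0 <= X j <= 1) by (intros; apply grid_Icc; auto).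
  assert (HS : forall j, X (S j) - X j = / INR N).
  { intros j. unfold X. rewrite S_INR. field. lra. }
  assert (Hi : 0 < / INR N) by (apply Rinv_0_lt_compat; auto).
  assert (step : forall F : R -> R,
    (forall x y, 0 <= x <= 1 -> 0 <= y <= 1 -> Rabs (F x - F y) <= M * Rabs (x - y)) ->
    forall j, (S j <= N)%nat -> Rabs (INR N * F (X (S j)) - INR N * F (X j)) <= M).
  { intros F LF j Hj. rewrite <- Rmult_minus_distr_l.
    specialize (LF (X (S j)) (X j) (HX _ Hj) (HX j ltac:(lia))).
    rewrite HS, (Rabs_pos_eq (/ INR N)) in LF by lra.
    rewrite Rabs_mult, (Rabs_pos_eq (INR N)) by lra.
    replace M with (INR N * (M * / INR N)) by (field; lra). apply Rmult_le_compat_l; lra. }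
  assert (Ha : match k with O => 0 | S j => rate A N j * f j end <= rate A N k * E + M * E).
  { destruct k as [|j].
    - pose proof (HA (X 0%nat) (HX 0%nat ltac:(lia))). unfold rate. fold (X 0%nat).
      assert (0 <= INR N * A (X 0%nat)) by nra. nra.
    - pose proof (step A LA j Hk) as P. apply Rabs_le_between in P. unfold rate. fold (X j) (X (S j)).
      pose proof (HA (X j) (HX j ltac:(lia))). specialize (Hf j ltac:(lia)).
      assert (0 <= INR N * A (X j)) by nra. nra. }
  assert (Hb : (if Nat.ltb k N then rate B N (S k) * f (S k) else 0) <= rate B N k * E + M * E).
  { destruct (Nat.ltb k N) eqn:Lk.
    - apply Nat.ltb_lt in Lk.
      pose proof (step B LB k Lk) as P. apply Rabs_le_between in P. unfold rate. fold (X k) (X (S k)).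
      pose proof (HB (X (S k)) (HX (S k) ltac:(lia))). specialize (Hf (S k) ltac:(lia)).
      assert (0 <= INR N * B (X (S k))) by nra. nra.
    - pose proof (HB (X k) (HX k ltac:(lia))). unfold rate. fold (X k).
      assert (0 <= INR N * B (X k)) by nra. nra. }
  unfold master_rhs. rewrite Ek. lra.
Qed.

Fixpoint max_upto (f : nat -> R) (N : nat) : R :=
  match N with O => f O | S n => Rmax (max_upto f n) (f (S n)) end.

Lemma max_upto_ge (f : nat -> R) (N j : nat) : (j <= N)%nat -> f j <= max_upto f N.
Proof.
  induction N as [|N IH]; intros Hj; simpl.
  - replace j with 0%nat by lia. lra.
  - destruct (Nat.eq_dec j (S N)) as [->|Hn]; [apply Rmax_r|].
    eapply Rle_trans; [apply IH; lia|apply Rmax_l].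
Qed.

Lemma max_upto_attained (f : nat -> R) (N : nat) : exists j, (j <= N)%nat /\ f j = max_upto f N.
Proof.
  induction N as [|N [j [Hj E]]]; simpl.
  - exists 0%nat. auto.
  - unfold Rmax. destruct Rle_dec; [exists (S N)|exists j]; auto.
Qed.

Lemma max_upto_close (f g : nat -> R) (N : nat) (e : R) :
  (forall j, (j <= N)%nat -> Rabs (f j - g j) < e) -> Rabs (max_upto f N - max_upto g N) < e.
Proof.
  intros H. destruct (max_upto_attained f N) as [i [Hi Ei]].
  destruct (max_upto_attained g N) as [j [Hj Ej]].
  pose proof (max_upto_ge f N j Hj). pose proof (max_upto_ge g N i Hi).
  pose proof (H i Hi) as Q1. pose proof (H j Hj) as Q2. apply Rabs_def2 in Q1, Q2.
  apply Rabs_def1; lra.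
Qed.

(** * Time regularity of the semigroup *)

(** If f is unbounded, [real] returns 0, which also satisfies the inequality. *)
Lemma supnorm_nonneg (a b : R) (f : R -> C) : a <= b -> 0 <= supnorm a b f.
Proof.
  intros Hab. unfold supnorm.
  pose proof (Lub_Rbar_correct (fun r => exists x, Icc a b x /\ r = Cmod (f x))) as [H1 _].
  specialize (H1 (Cmod (f a)) (ex_intro _ a (conj (conj (Rle_refl a) Hab) eq_refl))).
  pose proof (Cmod_ge_0 (f a)).
  destruct (Lub_Rbar _); simpl in *; lra.
Qed.

Lemma supnorm_lim_iff (a b : R) (F : R -> R -> C) :
  a <= b -> (forall t, 0 < t -> C0C a b (F t)) ->
  (filterlim (fun t => supnorm a b (F t)) (at_right 0) (locally 0) <->
   forall eps, 0 < eps -> exists e, 0 < e /\ forall t, 0 < t < e ->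
     forall x, Icc a b x -> Cmod (F t x) <= eps).
Proof.
  intros Hab HF. split.
  - intros H eps He.
    pose proof (proj1 (filterlim_locally _ _) H (mkposreal eps He)) as [e K].
    exists e. split. apply cond_pos. intros t Ht x Dx.
    eapply Rle_trans; [apply (supnorm_ge a b (F t)); auto; apply HF; lra|].
    assert (Hb : ball 0 eps (supnorm a b (F t))).
    { apply K; [|lra]. change (Rabs (t - 0) < e). rewrite Rabs_pos_eq; lra. }
    change (Rabs (supnorm a b (F t) - 0) < eps) in Hb. apply Rabs_def2 in Hb. lra.
  - intros H. apply filterlim_locally. intros eps. pose proof (cond_pos eps).
    destruct (H (eps / 2)) as [e [He K]]; [lra|].
    exists (mkposreal e He). intros t Ht Htp.
    change (Rabs (t - 0) < e) in Ht. apply Rabs_def2 in Ht.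
    change (Rabs (supnorm a b (F t) - 0) < eps).
    pose proof (supnorm_nonneg a b (F t) Hab).
    assert (supnorm a b (F t) <= eps / 2).
    { apply supnorm_le; auto. intros x Dx. apply K; auto. lra. }
    rewrite Rabs_pos_eq; lra.
Qed.

Lemma C0C_comb (a b : R) (c c' : C) (f g : R -> C) :
  a <= b -> C0C a b f -> C0C a b g -> C0C a b (fun x => (c * f x + c' * g x)%C).
Proof. intros Hab Hf Hg. apply C0C_plus; auto; apply C0C_scal; auto. Qed.

Lemma bounded_operator_comb (a b : R) (T : (R -> C) -> R -> C) (c c' : C) (f g : R -> C) :
  a <= b -> bounded_operator a b T -> C0C a b f -> C0C a b g ->
  eq_on a b (T (fun x => (c * f x + c' * g x)%C)) (fun x => (c * T f x + c' * T g x)%C).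
Proof.
  intros Hab [_ [Ha [Hs _]]] Hf Hg x Dx.
  rewrite Ha; auto using C0C_scal. rewrite !Hs; auto.
Qed.

Lemma sector_pos (theta t : R) : 0 < theta -> 0 < t -> sector theta (RtoC t).
Proof.
  intros H1 H2. exists t, 0. split; [auto|split].
  - rewrite Rabs_R0. auto.
  - rewrite cos_0, sin_0. unfold RtoC. f_equal; ring.
Qed.

(** Brings difference quotients into the two-term form on which [C0C_comb] and
    [bounded_operator_comb] act. *)
Lemma quot_comb (u v w : C) (c : C) : ((u - v) / c - w)%C = (/ c * (1 * u + (-1) * v) + (-1) * w)%C.
Proof. unfold Cdiv. ring. Qed.

Lemma C0C_quot (a b : R) (c : C) (u v w : R -> C) :
  a <= b -> C0C a b u -> C0C a b v -> C0C a b w ->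
  C0C a b (fun x => ((u x - v x) / c - w x)%C).
Proof.
  intros Hab Hu Hv Hw.
  apply (C0C_ext a b _ (fun x => (/ c * ((fun x => (1 * u x + (-1) * v x)%C) x) + (-1) * w x)%C)).
  - intros x _. apply quot_comb.
  - apply (C0C_comb a b (/ c)%C (-1)%C (fun x => (1 * u x + (-1) * v x)%C) w); auto.
    apply C0C_comb; auto.
Qed.

Section FP.
Context {A B : R -> R} {N : nat} {S : R -> (R -> C) -> R -> C}.
Context (HS : FP_semigroup A B N S).
Local Notation a := (lo N).
Local Notation b := (hi N).

Lemma FP_semigroup_C0C t f : 0 <= t -> C0C a b f -> C0C a b (S t f).
Proof. intros Ht Hf. destruct HS as [[H _] _]. apply (H t Ht). auto. Qed.

(** Holomorphy provides a bounded derivative L of the semigroup at t. Since S (r + t) f = S r (S t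
    f), the quotients defining the generator at S t f converge to L f, which puts S t f into the
    domain for every continuous f and identifies L f with its image. *)
Lemma FP_semigroup_derivative f t :
  C0C a b f -> 0 < t ->
  FP_dom A B N (S t f) /\ C0C a b (FP_op A B N (S t f)) /\
  forall eps, 0 < eps -> exists e, 0 < e /\ forall r, 0 <= r -> Rabs (r - t) < e ->
    forall x, Icc a b x ->
    Cmod (S r f x - S t f x - RtoC (r - t) * FP_op A B N (S t f) x)%C <= eps * Rabs (r - t).
Proof.
  intros Hf Ht. pose proof (lo_lt_hi N) as Hab.
  destruct HS as [[Hb [_ [Hadd _]]] [[theta [T [Hth [HTS [HTb [_ [HTd _]]]]]]] Hgen]].
  pose proof (sector_pos theta t (proj1 Hth) Ht) as Hsec.
  destruct (HTd _ Hsec) as [L [HLb HL]].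
  assert (CL : C0C a b (L f)) by (apply HLb; auto).
  assert (CT : forall r, 0 < r -> C0C a b (T (RtoC r) f)).
  { intros r Hr. apply HTb; auto. apply sector_pos; auto. apply Hth. }
  assert (CS : C0C a b (S t f)) by (apply FP_semigroup_C0C; auto; lra).
  assert (Key : forall eps, 0 < eps -> exists e, 0 < e /\ forall r, 0 < r -> r <> t -> Rabs (r - t) < e ->
    forall x, Icc a b x -> Cmod ((S r f x - S t f x) / RtoC (r - t) - L f x)%C <= eps).
  { intros eps He. pose proof (supnorm_nonneg a b f ltac:(lra)) as Hn.
    (* The operator-norm estimate is divided by the norm of f; the added 1 covers f = 0. *)
    destruct (HL (eps / (supnorm a b f + 1))) as [e [He1 K]]; [apply Rdiv_lt_0_compat; lra|].
    exists e. split; auto. intros r Hr Hne Hrt x Dx.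
    assert (Hrt' : (RtoC r - RtoC t)%C = RtoC (r - t)) by (rewrite RtoC_minus; reflexivity).
    specialize (K (RtoC r) (sector_pos theta r (proj1 Hth) Hr)).
    rewrite Hrt', Cmod_R in K.
    specialize (K ltac:(intros E; apply Hne; injection E; auto) Hrt f Hf).
    rewrite <- (HTS r f Hr Hf x Dx), <- (HTS t f Ht Hf x Dx).
    apply Rle_trans with (eps / (supnorm a b f + 1) * supnorm a b f).
    - eapply Rle_trans; [|exact K].
      apply (supnorm_ge a b (fun x => ((T (RtoC r) f x - T (RtoC t) f x) / RtoC (r - t) - L f x)%C)); auto.
      apply C0C_quot; auto. lra.
    - apply (Rmult_le_reg_r (supnorm a b f + 1)); [lra|].
      replace (eps / (supnorm a b f + 1) * supnorm a b f * (supnorm a b f + 1))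
        with (eps * supnorm a b f) by (field; lra). nra. }
  assert (Hdom : FP_dom A B N (S t f) /\ eq_on a b (FP_op A B N (S t f)) (L f)).
  { apply (proj1 (Hgen (S t f) (L f) CS CL)).
    apply supnorm_lim_iff; [lra| |].
    - intros r Hr. apply C0C_quot; auto; try lra. apply FP_semigroup_C0C; auto; lra.
    - intros eps He. destruct (Key eps He) as [e [He1 K]]. exists e. split; auto.
      intros r Hr x Dx. rewrite <- (Hadd r t f); auto; try lra.
      specialize (K (r + t)). replace (r + t - t) with r in K by ring.
      apply K; auto; try lra. rewrite Rabs_pos_eq; lra. }
  destruct Hdom as [Hdom EL]. split; [exact Hdom|split; [exact (C0C_ext _ _ _ _ EL CL)|]].
  intros eps He. destruct (Key eps He) as [e [He1 K]].
  (* The minimum with t keeps r positive, hence inside the sector. *)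
  exists (Rmin e t). split; [apply Rmin_pos; auto|].
  intros r Hr0 Hrt x Dx. pose proof (Rmin_l e t). pose proof (Rmin_r e t).
  assert (Hr : 0 < r).
  { apply Rabs_def2 in Hrt. lra. }
  rewrite EL by auto.
  destruct (Req_dec r t) as [->|Hne].
  - rewrite Rminus_diag, Rabs_R0, Rmult_0_r.
    replace (S t f x - S t f x - RtoC 0 * L f x)%C with (RtoC 0) by ring. rewrite Cmod_0. lra.
  - specialize (K r Hr Hne ltac:(lra) x Dx).
    assert (Hc : RtoC (r - t) <> RtoC 0) by (intros E; injection E; lra).
    replace (S r f x - S t f x - RtoC (r - t) * L f x)%C
      with (((S r f x - S t f x) / RtoC (r - t) - L f x) * RtoC (r - t))%C by (field; auto).
    rewrite Cmod_mult, Cmod_R. apply Rmult_le_compat_r; auto. apply Rabs_pos.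
Qed.

(** (S r (S t f) - S t f) / r - S t g equals S t applied to (S r f - f) / r - g, and S t is bounded.
    In contrast to [FP_semigroup_derivative] this includes t = 0, at the price of f being in the
    domain. *)
Lemma FP_semigroup_commute f g t :
  FP_dom A B N f -> C0C a b f -> C0C a b g -> eq_on a b (FP_op A B N f) g -> 0 <= t ->
  FP_dom A B N (S t f) /\ eq_on a b (FP_op A B N (S t f)) (S t g).
Proof.
  intros Hdom Hf Hg E Ht. pose proof (lo_lt_hi N) as Hab.
  destruct HS as [[Hb [_ [Hadd _]]] [_ Hgen]].
  assert (CS : forall r k, 0 <= r -> C0C a b k -> C0C a b (S r k)) by (intros; apply FP_semigroup_C0C; auto).
  apply (proj1 (Hgen (S t f) (S t g) (CS _ _ Ht Hf) (CS _ _ Ht Hg))).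
  pose proof (proj2 (Hgen f g Hf Hg) (conj Hdom E)) as Hlim.
  rewrite supnorm_lim_iff in Hlim; [|lra|].
  2:{ intros r Hr. apply C0C_quot; auto; try lra. apply CS; auto; lra. }
  apply supnorm_lim_iff; [lra| |].
  { intros r Hr. apply C0C_quot; auto; try lra. apply CS; auto; lra. }
  destruct (Hb t Ht) as [_ [_ [_ [M HM]]]].
  assert (HM0 : 0 < Rabs M + 1) by (pose proof (Rabs_pos M); lra).
  intros eps He. destruct (Hlim (eps / (Rabs M + 1))) as [e [He1 K]]; [apply Rdiv_lt_0_compat; auto|].
  exists e. split; auto. intros r Hr x Dx.
  set (k1 := fun y => (1 * S r f y + (-1) * f y)%C).
  set (k := fun y => (/ RtoC r * k1 y + (-1) * g y)%C).
  assert (Ck1 : C0C a b k1) by (apply C0C_comb; auto; try lra; apply CS; auto; lra).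
  assert (Ck : C0C a b k) by (apply C0C_comb; auto; lra).
  assert (Ek : ((S r (S t f) x - S t f x) / RtoC r - S t g x)%C = S t k x).
  { unfold k. rewrite (bounded_operator_comb a b (S t) _ _ k1 g); auto; try lra.
    unfold k1. rewrite (bounded_operator_comb a b (S t) 1 (-1) (S r f) f); auto; try lra; [|apply CS; auto; lra].
    rewrite <- (Hadd r t f), <- (Hadd t r f), (Rplus_comm r t); auto; try lra.
    apply quot_comb. }
  rewrite Ek. eapply Rle_trans; [apply (supnorm_ge a b (S t k)); auto|].
  eapply Rle_trans; [apply HM; auto|].
  assert (Hk : supnorm a b k <= eps / (Rabs M + 1)).
  { apply supnorm_le; [lra|]. intros y Dy. unfold k, k1. rewrite <- quot_comb. apply K; auto. }
  pose proof (supnorm_nonneg a b k ltac:(lra)). pose proof (Rle_abs M).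
  apply Rle_trans with ((Rabs M + 1) * supnorm a b k); [nra|].
  apply Rle_trans with ((Rabs M + 1) * (eps / (Rabs M + 1))); [apply Rmult_le_compat_l; lra|].
  right. field. lra.
Qed.

(** At 0 this is strong continuity; at t > 0 it follows from differentiability, whose derivative is
    bounded on the interval. *)
Lemma FP_semigroup_continuous f t :
  C0C a b f -> 0 <= t ->
  forall eps, 0 < eps -> exists e, 0 < e /\ forall r, 0 <= r -> Rabs (r - t) < e ->
    forall x, Icc a b x -> Cmod (S r f x - S t f x)%C <= eps.
Proof.
  intros Hf Ht eps He. pose proof (lo_lt_hi N) as Hab.
  destruct (Req_dec t 0) as [->|Hne].
  - destruct HS as [[_ [H0 [_ Hlim]]] _]. specialize (Hlim f Hf).
    rewrite (supnorm_lim_iff a b (fun t x => (S t f x - f x)%C)) in Hlim; [|lra|].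
    + destruct (Hlim eps He) as [e [He1 K]]. exists e. split; auto.
      intros r Hr Hre x Dx. rewrite (H0 f Hf x Dx).
      destruct (Req_dec r 0) as [->|Hr0].
      * rewrite (H0 f Hf x Dx). replace (f x - f x)%C with (RtoC 0) by ring. rewrite Cmod_0. lra.
      * apply K; auto. rewrite Rminus_0_r in Hre. apply Rabs_def2 in Hre. lra.
    + intros r Hr. apply (C0C_ext a b _ (fun x => (1 * S r f x + (-1) * f x)%C)).
      intros x _. ring. apply C0C_comb; auto. lra. apply FP_semigroup_C0C; auto; lra.
  - assert (Ht0 : 0 < t) by lra.
    destruct (FP_semigroup_derivative f t Hf Ht0) as [_ [CG Hd]].
    destruct (Hd 1 ltac:(lra)) as [e [He1 K]].
    assert (CS : C0C a b (S t f)) by (apply FP_semigroup_C0C; auto).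
    assert (exists m, 0 <= m /\ forall x, Icc a b x -> Cmod (FP_op A B N (S t f) x) <= m) as [m [Hm0 Hm]].
    { exists (supnorm a b (FP_op A B N (S t f))). split; [apply supnorm_nonneg; lra|].
      intros x Dx. apply supnorm_ge; auto. }
    exists (Rmin e (eps / (m + 1))). split.
    { apply Rmin_pos; auto. apply Rdiv_lt_0_compat; lra. }
    intros r Hr Hrt x Dx.
    pose proof (Rmin_l e (eps / (m + 1))). pose proof (Rmin_r e (eps / (m + 1))).
    specialize (K r Hr ltac:(lra) x Dx). specialize (Hm x Dx).
    replace (S r f x - S t f x)%C with
      ((S r f x - S t f x - RtoC (r - t) * FP_op A B N (S t f) x) + RtoC (r - t) * FP_op A B N (S t f) x)%C by ring.
    eapply Rle_trans; [apply Cmod_triangle|]. rewrite Cmod_mult, Cmod_R.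
    pose proof (Rabs_pos (r - t)).
    apply Rle_trans with (Rabs (r - t) * (m + 1)); [nra|].
    apply Rle_trans with (eps / (m + 1) * (m + 1)); [apply Rmult_le_compat_r; lra|].
    right. field. lra.
Qed.
End FP.

(** * Uniform bounds for the solution and its second derivative *)

Lemma proj_minus (p q : R) (z w : C) : proj p q (z - w)%C = proj p q z - proj p q w.
Proof. unfold proj. destruct z, w; simpl. ring. Qed.

Lemma proj_real_mult (p q c : R) (z : C) : proj p q (RtoC c * z)%C = c * proj p q z.
Proof. unfold proj. destruct z; simpl. ring. Qed.

Lemma chain_comb (r r' g : nat -> R -> R) (c : R) :
  chain 2 r -> chain 2 r' -> chain 2 g -> chain 2 (fun i x => r i x - r' i x - c * g i x).
Proof.
  intros [Hr Cr] [Hr' Cr'] [Hg Cg]. split.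
  - intros i x Hi. apply is_derive_sub; [apply is_derive_sub|apply is_derive_cmul]; auto.
  - intros x.
    apply (continuous_minus (V := R_NormedModule) (fun x => r 2%nat x - r' 2%nat x) (fun x => c * g 2%nat x)).
    + apply (continuous_minus (V := R_NormedModule) (r 2%nat) (r' 2%nat)); auto.
    + apply (continuous_scal_r (V := R_NormedModule) c (g 2%nat)). auto.
Qed.

Lemma flux_comb (h c : R) (s d r r' g : nat -> R -> R) (x : R) :
  flux h s d (fun i x => r i x - r' i x - c * g i x) x
  = flux h s d r x - flux h s d r' x - c * flux h s d g x.
Proof. unfold flux. ring. Qed.

Lemma fp_expr_comb (h c : R) (s d r r' g : nat -> R -> R) (x : R) :
  fp_expr h s d (fun i x => r i x - r' i x - c * g i x) x
  = fp_expr h s d r x - fp_expr h s d r' x - c * fp_expr h s d g x.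
Proof. unfold fp_expr. ring. Qed.

Lemma supnorm_close (a b : R) (f g : R -> C) (e : R) :
  a <= b -> C0C a b f -> C0C a b g -> (forall x, Icc a b x -> Cmod (f x - g x)%C <= e) ->
  Rabs (supnorm a b f - supnorm a b g) <= e.
Proof.
  intros Hab Hf Hg H.
  assert (H1 : supnorm a b f <= supnorm a b g + e).
  { apply supnorm_le; auto. intros x Dx. specialize (H x Dx).
    pose proof (supnorm_ge a b g x Hg Dx).
    replace (f x) with ((f x - g x) + g x)%C by ring.
    eapply Rle_trans; [apply Cmod_triangle|]. lra. }
  assert (H2 : supnorm a b g <= supnorm a b f + e).
  { apply supnorm_le; auto. intros x Dx. specialize (H x Dx).
    pose proof (supnorm_ge a b f x Hf Dx).
    replace (g x) with (f x - (f x - g x))%C by ring. unfold Cminus at 1.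
    eapply Rle_trans; [apply Cmod_triangle|]. rewrite Cmod_opp. lra. }
  apply Rabs_le. lra.
Qed.

Ltac continuity_rules :=
  lazymatch goal with
  | |- continuous (fun t => @?f t - @?g t) _ =>
      apply (continuous_minus (V := R_NormedModule) f g); continuity_rules
  | |- continuous (fun t => @?f t + @?g t) _ =>
      apply (continuous_plus (V := R_NormedModule) f g); continuity_rules
  | |- continuous (fun t => @?f t * @?g t) _ =>
      apply (continuous_mult (K := R_AbsRing) f g); continuity_rules
  | |- _ => first [eassumption | apply continuous_const]
  end.

(** The bounds refer to the fixed interval, not to [-h, 1+h]; this makes [sig] and [M] independent
    of N. *)
Record fp_bounds (eta : R) (s d : nat -> R -> R) (sig M : R) : Prop := {
  sig_pos : 0 < sig;
  M_pos : 0 < M;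
  s_ge : forall x, Icc (- eta) (1 + eta) x -> sig <= s 0%nat x;
  sd_le : forall i x, (i <= 4)%nat -> Icc (- eta) (1 + eta) x ->
    Rabs (s i x) <= M /\ Rabs (d i x) <= M }.

Lemma C2C_C0C (N : nat) (f : R -> C) : C2C (lo N) (hi N) f ->
  C0C (lo N) (hi N) f /\ C0C (lo N) (hi N) (DC (lo N) (hi N) (DC (lo N) (hi N) f)).
Proof.
  intros H. pose proof (lo_lt_hi N) as Hab.
  destruct (C2C_chain _ _ f Hab H) as [U [V [HU [HV [E0 [_ _]]]]]]. split.
  - apply (continuous_on_cpair _ _ _ _ _ E0); intros x; apply (chain_continuous 2); auto.
  - apply H.
Qed.

Section Bounds.
Context {eta : R} {A B : R -> R} {s d : nat -> R -> R} {sig M : R} {N : nat}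
  {S : R -> (R -> C) -> R -> C} {phi : R -> C} {t0 : R}.
Context (Hco : fp_coefs eta A B s d) (Hbd : fp_bounds eta s d sig M)
  (HN : (0 < N)%nat) (Heta : mesh N < eta) (HS : FP_semigroup A B N S)
  (Hphi : FP_dom A B N phi).
Local Notation a := (lo N).
Local Notation b := (hi N).
Local Notation h := (mesh N).
Local Notation second t := (DC a b (DC a b (S t phi))).

Lemma Icc_sub x : Icc a b x -> Icc (- eta) (1 + eta) x.
Proof. unfold Icc, lo, hi. lra. Qed.

Lemma mesh_bounds : 0 < h <= 1 / 2.
Proof.
  destruct (INR_mesh N HN) as [H E]. split; auto.
  assert (1 <= INR N) by (change 1 with (INR 1); apply le_INR; lia).
  unfold mesh. apply (Rmult_le_reg_r (2 * INR N)); [lra|]. rewrite Rinv_l by lra. lra.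
Qed.

Lemma phi_C0C : C0C a b phi.
Proof. exact (proj1 (C2C_C0C N phi (proj1 Hphi))). Qed.

Lemma op_phi_C0C : C0C a b (FP_op A B N phi).
Proof.
  pose proof (lo_lt_hi N) as Hab. destruct Hphi as [H2 _].
  destruct (C2C_chain _ _ phi Hab H2) as [U [V [HU [HV [E0 _]]]]].
  destruct (FP_cpair eta A B s d N phi U V Hco Heta HU HV E0) as [Eop _].
  assert (Hc : forall r, chain 2 r -> forall x, continuous (fp_expr h s d r) x).
  { intros r Cr x. destruct Hco as [Cs Cd _ _].
    assert (Kr : forall i, (i <= 2)%nat -> continuous (r i) x) by (intros; apply (chain_continuous 2); auto).
    assert (Ks : forall i, (i <= 4)%nat -> continuous (s i) x) by (intros; apply (chain_continuous 4); auto).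
    assert (Kd : forall i, (i <= 4)%nat -> continuous (d i) x) by (intros; apply (chain_continuous 4); auto).
    pose proof (Kr 0%nat ltac:(lia)); pose proof (Kr 1%nat ltac:(lia)); pose proof (Kr 2%nat ltac:(lia)).
    pose proof (Ks 0%nat ltac:(lia)); pose proof (Ks 1%nat ltac:(lia)); pose proof (Ks 2%nat ltac:(lia)).
    pose proof (Kd 0%nat ltac:(lia)); pose proof (Kd 1%nat ltac:(lia)).
    unfold fp_expr.
    continuity_rules. }
  apply (continuous_on_cpair _ _ _ _ _ Eop); apply Hc; auto.
Qed.

(** Expresses A_N of the orbit as another orbit, that of the continuous function A_N phi, so that
    continuity in time of S t phi carries over to its image under A_N. *)
Lemma orbit_dom t : 0 <= t ->
  FP_dom A B N (S t phi) /\ eq_on a b (FP_op A B N (S t phi)) (S t (FP_op A B N phi)).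
Proof.
  intros Ht. apply (FP_semigroup_commute HS phi (FP_op A B N phi) t); auto.
  - apply phi_C0C.
  - apply op_phi_C0C.
  - intros x _. reflexivity.
Qed.

Lemma orbit_continuous_upto : continuous_upto t0 (fun t => supnorm a b (S t phi)).
Proof.
  intros t Ht eps He. pose proof (lo_lt_hi N).
  destruct (FP_semigroup_continuous HS phi t phi_C0C (proj1 Ht) (eps / 2)) as [e [He1 K]]; [lra|].
  exists e. split; auto. intros r Hr Hrt.
  apply Rle_lt_trans with (eps / 2); [|lra].
  apply supnorm_close.
  - lra.
  - exact (FP_semigroup_C0C HS r phi (proj1 Hr) phi_C0C).
  - exact (FP_semigroup_C0C HS t phi (proj1 Ht) phi_C0C).
  - exact (K r (proj1 Hr) Hrt).
Qed.

(** A maximum of the modulus is a positive maximum of a suitable real functional, where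
    [max_principle_value] gives the growth rate 2 M; the Gronwall lemma adds 1 to the rate. *)
Lemma value_bound U :
  0 < d 0%nat a - h * s 1%nat a -> d 0%nat b - h * s 1%nat b < 0 ->
  (forall x, Icc a b x -> Cmod (phi x) <= U) ->
  forall t x, 0 <= t <= t0 -> Icc a b x -> Cmod (S t phi x) <= U * exp ((2 * M + 1) * t0).
Proof.
  intros Da Db HU. pose proof (lo_lt_hi N) as Hab. pose proof (M_pos _ _ _ _ _ Hbd) as HM.
  pose proof mesh_bounds as Hh. pose proof phi_C0C as Cphi.
  destruct Hco as [Cs Cd sE dE].
  assert (H0 : supnorm a b (S 0 phi) <= U).
  { apply supnorm_le; [lra|]. intros x Dx. destruct HS as [[_ [H0 _]] _]. rewrite H0; auto. }
  assert (G : forall t, 0 <= t <= t0 ->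
     supnorm a b (S t phi) <= supnorm a b (S 0 phi) * exp ((2 * M + 1) * t)).
  { apply (gronwall_touching (fun t => supnorm a b (S t phi)) t0 (2 * M)); try lra.
    { apply supnorm_nonneg. lra. }
    { apply orbit_continuous_upto. }
    intros t Ht Hpos.
    assert (CS : C0C a b (S t phi)) by exact (FP_semigroup_C0C HS t phi (Rlt_le _ _ (proj1 Ht)) Cphi).
    destruct (supnorm_attained a b (S t phi)) as [x [Dx [Ex Hmax]]]; [lra|auto|].
    destruct (proj_attains (S t phi x)) as [p [q [Hpq Epq]]].
    destruct (orbit_dom t ltac:(lra)) as [Hdom _].
    destruct (FP_dom_chain eta A B s d N (S t phi) p q Hco Heta Hdom) as [r [Cr [Er [Fa Fb]]]].
    (* Point and functional stay fixed at their choice for time t; at earlier times the functional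
       is still at most the sup norm. *)
    exists (fun r => proj p q (S r phi x)), (proj p q (FP_op A B N (S t phi) x)).
    split; [rewrite Epq; exact Ex|split; [|split]].
    - intros w Hw. eapply Rle_trans; [apply Rle_abs|].
      eapply Rle_trans; [apply proj_le_Cmod; auto|].
      apply (supnorm_ge a b (S w phi)); auto.
      exact (FP_semigroup_C0C HS w phi (proj1 Hw) Cphi).
    - destruct (Er x Dx) as [E0 [_ [_ Eop]]]. rewrite Eop, <- Ex, <- Epq, E0.
      destruct (sd_le _ _ _ _ _ Hbd 2%nat x ltac:(lia) (Icc_sub x Dx)) as [S2 _].
      destruct (sd_le _ _ _ _ _ Hbd 1%nat x ltac:(lia) (Icc_sub x Dx)) as [_ D1].
      apply (max_principle_value a b h M M s d r x); auto; try lra.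
      + intros y Dy. pose proof (s_ge _ _ _ _ _ Hbd y (Icc_sub y Dy)).
        pose proof (sig_pos _ _ _ _ _ Hbd). lra.
      + intros y Dy. rewrite <- E0, Epq, Ex. destruct (Er y Dy) as [E0y _]. rewrite <- E0y.
        eapply Rle_trans; [apply Rle_abs|]. eapply Rle_trans; [apply proj_le_Cmod; auto|]. auto.
    - intros eps He.
      destruct (FP_semigroup_derivative HS phi t Cphi (proj1 Ht)) as [_ [_ Hd]].
      destruct (Hd eps He) as [e [He1 K]]. exists e. split; auto.
      intros w Hw Hwt. specialize (K w (proj1 Hw)).
      rewrite (Rabs_left1 (w - t)) in K by lra. specialize (K ltac:(lra) x Dx).
      apply (Rle_trans _ _ _ (proj_le_Cmod p q _ Hpq)) in K.
      rewrite !proj_minus, proj_real_mult in K.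
      replace (- (w - t)) with (t - w) in K by ring.
      rewrite <- Rabs_Ropp. eapply Rle_trans; [|exact K]. right. f_equal. ring. }
  intros t x Ht Dx.
  assert (CS : C0C a b (S t phi)) by exact (FP_semigroup_C0C HS t phi (proj1 Ht) Cphi).
  eapply Rle_trans; [apply (supnorm_ge a b (S t phi)); auto|].
  eapply Rle_trans; [apply G; auto|].
  apply Rmult_le_compat; auto. apply supnorm_nonneg; lra. left; apply exp_pos.
  destruct (Req_dec t t0) as [->|Hne]; [lra|]. left. apply exp_increasing.
  apply Rmult_lt_compat_l; lra.
Qed.

(** Here K depends on N. It is used only to obtain continuity and differentiability in time of the
    second derivative. *)
Lemma second_elliptic : exists K, 0 < K /\ forall r m, chain 2 r -> flux h s d r a = 0 ->
    (forall x, Icc a b x -> Rabs (r 0%nat x) <= m /\ Rabs (fp_expr h s d r x) <= m) ->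
    forall x, Icc a b x -> Rabs (r 2%nat x) <= K * m.
Proof.
  destruct Hco as [Cs Cd _ _]. pose proof mesh_bounds. destruct Hbd as [H1 H2 H3 H4].
  apply (elliptic_bound a b h sig M); auto; try lra.
  - apply lo_lt_hi.
  - intros x Dx. apply H3, Icc_sub, Dx.
  - intros i x Hi Dx. apply H4; auto. apply Icc_sub, Dx.
Qed.

Lemma second_C0C t : 0 <= t -> C0C a b (second t).
Proof. intros Ht. exact (proj2 (C2C_C0C N _ (proj1 (proj1 (orbit_dom t Ht))))). Qed.

(** The elliptic estimate is applied to S r phi - S t phi: its flux vanishes at a, it is small by
    continuity of the orbit of phi, and its image under A_N is small by continuity of the orbit of
    A_N phi. *)
Lemma second_continuous t : 0 <= t -> forall eps, 0 < eps -> exists e, 0 < e /\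
  forall r, 0 <= r -> Rabs (r - t) < e -> forall x, Icc a b x ->
    Cmod (second r x - second t x)%C <= eps.
Proof.
  intros Ht eps He. destruct second_elliptic as [K [HK HE]].
  assert (Hq : 0 < eps / K) by (apply Rdiv_lt_0_compat; auto).
  destruct (FP_semigroup_continuous HS phi t phi_C0C Ht (eps / K) Hq) as [e1 [He1 K1]].
  destruct (FP_semigroup_continuous HS (FP_op A B N phi) t op_phi_C0C Ht (eps / K) Hq) as [e2 [He2 K2]].
  exists (Rmin e1 e2). split; [apply Rmin_pos; auto|].
  intros r Hr Hrt x Dx. pose proof (Rmin_l e1 e2). pose proof (Rmin_r e1 e2).
  apply Cmod_le_of_proj. intros p q Hpq.
  destruct (orbit_dom t Ht) as [Dt Et]. destruct (orbit_dom r Hr) as [Dr Err].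
  destruct (FP_dom_chain eta A B s d N _ p q Hco Heta Dt) as [c [Cc [Ec [Fc _]]]].
  destruct (FP_dom_chain eta A B s d N _ p q Hco Heta Dr) as [c' [Cc' [Ec' [Fc' _]]]].
  rewrite proj_minus.
  destruct (Ec x Dx) as [_ [_ [E2 _]]]. destruct (Ec' x Dx) as [_ [_ [E2' _]]].
  rewrite E2, E2'.
  eapply Rle_trans; [apply Rle_abs|].
  (* The vacuous third term allows reuse of the three-term combination lemmas. *)
  replace (c' 2%nat x - c 2%nat x) with ((fun i x => c' i x - c i x - 0 * c i x) 2%nat x) by ring.
  replace eps with (K * (eps / K)) by (field; lra).
  apply (HE (fun i x => c' i x - c i x - 0 * c i x)); auto.
  - apply chain_comb; auto.
  - rewrite flux_comb, Fc, Fc'. ring.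
  - intros y Dy. rewrite fp_expr_comb. cbv beta.
    destruct (Ec y Dy) as [E0 [_ [_ Eo]]]. destruct (Ec' y Dy) as [E0' [_ [_ Eo']]].
    rewrite <- Eo, <- Eo', <- E0, <- E0', Et, Err, !Rmult_0_l, !Rminus_0_r, <- !proj_minus by auto.
    split; (eapply Rle_trans; [apply proj_le_Cmod; auto|]).
    + apply K1; auto; lra.
    + apply K2; auto; lra.
Qed.

(** The elliptic estimate is applied to the first-order remainder S r phi - S t phi - (r - t) S t
    (A_N phi). Its image under A_N is the remainder of the orbit of A_N phi, which is differentiable
    at t > 0 by analyticity although A_N phi itself is only continuous. *)
Lemma second_left_derivative p q t x : p * p + q * q = 1 -> 0 < t -> Icc a b x ->
  left_derivative (fun r => proj p q (second r x)) t
    (proj p q (DC a b (DC a b (S t (FP_op A B N phi))) x)).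
Proof.
  intros Hpq Ht Dx eps He. destruct second_elliptic as [K [HK HE]].
  assert (Hq : 0 < eps / K) by (apply Rdiv_lt_0_compat; auto).
  destruct (FP_semigroup_derivative HS phi t phi_C0C Ht) as [_ [_ D1]].
  destruct (FP_semigroup_derivative HS (FP_op A B N phi) t op_phi_C0C Ht) as [Dg [_ D2]].
  destruct (D1 (eps / K) Hq) as [e1 [He1 K1]]. destruct (D2 (eps / K) Hq) as [e2 [He2 K2]].
  exists (Rmin e1 e2). split; [apply Rmin_pos; auto|].
  intros r [Hr Hrt'] Hrt. pose proof (Rmin_l e1 e2). pose proof (Rmin_r e1 e2).
  assert (Ha : Rabs (r - t) = t - r) by (rewrite Rabs_left1; lra).
  specialize (K1 r Hr). specialize (K2 r Hr). rewrite Ha in K1, K2.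
  specialize (K1 ltac:(lra)). specialize (K2 ltac:(lra)).
  destruct (orbit_dom t ltac:(lra)) as [Dt Et]. destruct (orbit_dom r Hr) as [Dr Err].
  destruct (FP_dom_chain eta A B s d N _ p q Hco Heta Dt) as [c [Cc [Ec [Fc _]]]].
  destruct (FP_dom_chain eta A B s d N _ p q Hco Heta Dr) as [c' [Cc' [Ec' [Fc' _]]]].
  destruct (FP_dom_chain eta A B s d N _ p q Hco Heta Dg) as [g [Cg [Eg [Fg _]]]].
  destruct (Ec x Dx) as [_ [_ [E2 _]]]. destruct (Ec' x Dx) as [_ [_ [E2' _]]].
  destruct (Eg x Dx) as [_ [_ [E2g _]]]. rewrite E2, E2', E2g.
  replace (c 2%nat x - c' 2%nat x - (t - r) * g 2%nat x)
    with (- (fun i x => c' i x - c i x - (r - t) * g i x) 2%nat x) by ring.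
  rewrite Rabs_Ropp.
  replace (eps * (t - r)) with (K * (eps / K * (t - r))) by (field; lra).
  apply (HE (fun i x => c' i x - c i x - (r - t) * g i x)); auto.
  - apply chain_comb; auto.
  - rewrite flux_comb, Fc, Fc', Fg. ring.
  - intros y Dy. rewrite fp_expr_comb. cbv beta.
    destruct (Ec y Dy) as [E0 [_ [_ Eo]]]. destruct (Ec' y Dy) as [E0' [_ [_ Eo']]].
    destruct (Eg y Dy) as [E0g [_ [_ Eog]]].
    rewrite <- Eo, <- Eo', <- Eog, <- E0, <- E0', <- E0g.
    rewrite <- !proj_real_mult, <- !proj_minus.
    split; (eapply Rle_trans; [apply proj_le_Cmod; auto|]).
    + rewrite <- Et by auto. apply K1; auto.
    + rewrite Et, Err by auto. apply K2; auto.
Qed.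

(** The Gronwall argument runs on the norm of v'' plus M0: the constant absorbs the contribution of
    v and turns an inhomogeneous inequality into a homogeneous one. *)
Lemma second_bound M0 U :
  0 <= M0 ->
  (forall t x, 0 <= t <= t0 -> Icc a b x -> Cmod (S t phi x) <= M0) ->
  (forall x, Icc a b x -> Cmod (second 0 x) <= U) ->
  (forall t, 0 < t -> Cmod (second t a) < supnorm a b (second t) /\
     Cmod (second t b) < supnorm a b (second t)) ->
  forall t x, 0 <= t <= t0 -> Icc a b x ->
    Cmod (second t x) <= (U + M0) * exp ((27 * M + 1) * t0).
Proof.
  intros HM0 Hval HU Hconj. pose proof (lo_lt_hi N) as Hab.
  pose proof (M_pos _ _ _ _ _ Hbd) as HM. pose proof mesh_bounds as Hh.
  assert (H0 : supnorm a b (second 0) <= U) by (apply supnorm_le; auto; lra).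
  assert (Hsn : forall t, 0 <= supnorm a b (second t)) by (intros; apply supnorm_nonneg; lra).
  assert (G : forall t, 0 <= t <= t0 ->
     supnorm a b (second t) + M0 <= (supnorm a b (second 0) + M0) * exp ((27 * M + 1) * t)).
  { apply (gronwall_touching (fun t => supnorm a b (second t) + M0) t0 (27 * M)); try lra.
    { specialize (Hsn 0). lra. }
    { intros t Ht eps He.
      destruct (second_continuous t (proj1 Ht) (eps / 2)) as [e [He1 K]]; [lra|].
      exists e. split; auto. intros r Hr Hrt.
      replace (supnorm a b (second r) + M0 - (supnorm a b (second t) + M0))
        with (supnorm a b (second r) - supnorm a b (second t)) by ring.
      apply Rle_lt_trans with (eps / 2); [|lra].
      apply supnorm_close.
      - lra.
      - exact (second_C0C r (proj1 Hr)).
      - exact (second_C0C t (proj1 Ht)).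
      - exact (K r (proj1 Hr) Hrt). }
    intros t Ht _.
    destruct (supnorm_attained a b (second t)) as [x [Dx [Ex Hmax]]]; [lra|apply second_C0C; lra|].
    destruct (Hconj t (proj1 Ht)) as [Ca Cb].
    (* The strict inequalities of the conjectural hypothesis keep the maximum of |v''| away from the
       ends. *)
    assert (Hx : a < x < b).
    { destruct Dx as [Dx1 Dx2]. split.
      - destruct (Req_dec x a) as [E|]; [|lra]. rewrite E in Ex. lra.
      - destruct (Req_dec x b) as [E|]; [|lra]. rewrite E in Ex. lra. }
    destruct (proj_attains (second t x)) as [p [q [Hpq Epq]]].
    destruct (orbit_dom t ltac:(lra)) as [Hdom Et].
    destruct (FP_semigroup_derivative HS (FP_op A B N phi) t op_phi_C0C (proj1 Ht)) as [Dg _].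
    destruct (FP_dom_chain eta A B s d N _ p q Hco Heta Hdom) as [r [Cr [Er _]]].
    destruct (FP_dom_chain eta A B s d N _ p q Hco Heta Dg) as [g [Cg [Eg _]]].
    exists (fun r => proj p q (second r x) + M0), (proj p q (DC a b (DC a b (S t (FP_op A B N phi))) x)).
    assert (Hp : forall z, proj p q z <= Cmod z).
    { intros z. eapply Rle_trans; [apply Rle_abs|]. apply proj_le_Cmod; auto. }
    split; [rewrite Epq, Ex; reflexivity|split; [|split]].
    - intros w Hw. apply Rplus_le_compat_r. apply (Rle_trans _ _ _ (Hp (second w x))).
      exact (supnorm_ge a b (second w) x (second_C0C w (proj1 Hw)) Dx).
    - destruct (Eg x Dx) as [_ [_ [E2g _]]]. rewrite E2g.
      destruct Hco as [Cs Cd _ _].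
      assert (Hr0 : forall y, Icc a b y -> Rabs (r 0%nat y) <= M0).
      { intros y Dy. destruct (Er y Dy) as [<- _]. eapply Rle_trans; [apply proj_le_Cmod; auto|].
        apply Hval; auto. lra. }
      assert (Hr2 : forall y, Icc a b y -> Rabs (r 2%nat y) <= supnorm a b (second t)).
      { intros y Dy. destruct (Er y Dy) as [_ [_ [<- _]]].
        eapply Rle_trans; [apply proj_le_Cmod; auto|]. auto. }
      assert (Hr1 : Rabs (r 1%nat x) <= 2 * (M0 + supnorm a b (second t))).
      { apply (first_derivative_bound r a b); auto. unfold lo, hi. lra. }
      specialize (Hr0 x Dx). pose proof (Hr2 x Dx) as Hr2x.
      assert (Hg2 : g 2%nat x <= 9 * M * (Rabs (r 0%nat x) + Rabs (r 1%nat x) + Rabs (r 2%nat x))).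
      { apply (max_principle_second a b h M s d r g x); auto; try lra.
        - intros y Dy. pose proof (s_ge _ _ _ _ _ Hbd y (Icc_sub y Dy)).
          pose proof (sig_pos _ _ _ _ _ Hbd). lra.
        - intros i Hi. apply (sd_le _ _ _ _ _ Hbd); auto. apply Icc_sub; auto.
        - intros y Dy. destruct (Eg y Dy) as [<- _]. destruct (Er y Dy) as [_ [_ [_ <-]]].
          rewrite Et; auto.
        - intros y Dy. destruct (Er y Dy) as [_ [_ [<- _]]]. destruct (Er x Dx) as [_ [_ [<- _]]].
          rewrite Epq, Ex. eapply Rle_trans; [apply Hp|]. auto. }
      eapply Rle_trans; [exact Hg2|].
      (* |v| <= M0, |v'| <= 2 (M0 + |v''|) and |v''| add up to three times the controlled quantity,
         whence the rate 27 M. *)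
      apply Rle_trans with (9 * M * (3 * (supnorm a b (second t) + M0))); [|right; ring].
      apply Rmult_le_compat_l; lra.
    - intros eps He. destruct (second_left_derivative p q t x Hpq (proj1 Ht) Dx eps He) as [e [He1 K]].
      exists e. split; auto. intros w Hw Hwt. specialize (K w Hw Hwt). cbv beta in K.
      match type of K with Rabs ?X <= _ => replace X with
        (proj p q (second t x) + M0 - (proj p q (second w x) + M0)
         - (t - w) * proj p q (DC a b (DC a b (S t (FP_op A B N phi))) x)) in K by ring end.
      exact K. }
  intros t x Ht Dx.
  pose proof (supnorm_ge a b (second t) x (second_C0C t (proj1 Ht)) Dx) as Q1.
  specialize (G t Ht).
  apply Rle_trans with ((supnorm a b (second 0) + M0) * exp ((27 * M + 1) * t)); [lra|].
  apply Rmult_le_compat; try lra. specialize (Hsn 0); lra. left; apply exp_pos.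
  destruct (Req_dec t t0) as [->|Hne]; [lra|]. left. apply exp_increasing.
  apply Rmult_lt_compat_l; lra.
Qed.
End Bounds.

(** * The error estimate *)

Lemma uniform_upto (P : nat -> R -> Prop) (t : R) (N : nat) :
  (forall k, (k <= N)%nat -> exists e, 0 < e /\ forall r, Rabs (r - t) < e -> P k r) ->
  exists e, 0 < e /\ forall r, Rabs (r - t) < e -> forall k, (k <= N)%nat -> P k r.
Proof.
  induction N as [|N IH]; intros H.
  - destruct (H 0%nat) as [e [He K]]; auto. exists e. split; auto.
    intros r Hr k Hk. replace k with 0%nat by lia. auto.
  - destruct IH as [e1 [He1 K1]]; [intros; apply H; lia|].
    destruct (H (S N)) as [e2 [He2 K2]]; auto.
    exists (Rmin e1 e2). split; [apply Rmin_pos; auto|].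
    intros r Hr k Hk. pose proof (Rmin_l e1 e2). pose proof (Rmin_r e1 e2).
    destruct (Nat.eq_dec k (S N)) as [->|Hne]; [apply K2; lra|apply K1; [lra|lia]].
Qed.

Lemma exp_le_mono (c x y : R) : 0 <= c -> x <= y -> exp (c * x) <= exp (c * y).
Proof.
  intros Hc Hxy. destruct (Req_dec (c * x) (c * y)) as [->|Hne]; [lra|].
  left. apply exp_increasing. assert (c * x <= c * y) by (apply Rmult_le_compat_l; auto). lra.
Qed.

Lemma coef_lipschitz (eta : R) (A B : R -> R) (s d : nat -> R -> R) (sig M : R) :
  0 < eta -> fp_coefs eta A B s d -> fp_bounds eta s d sig M ->
  forall x y, 0 <= x <= 1 -> 0 <= y <= 1 ->
    Rabs (A x - A y) <= M * Rabs (x - y) /\ Rabs (B x - B y) <= M * Rabs (x - y).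
Proof.
  intros He [Cs Cd sE dE] Hb x y Hx Hy.
  assert (L : forall p q, Rabs p = / 2 -> Rabs q = / 2 ->
    Rabs ((p * s 0%nat x + q * d 0%nat x) - (p * s 0%nat y + q * d 0%nat y)) <= M * Rabs (x - y)).
  { intros p q Hp Hq. pose proof (chain_proj 4 p q s d Cs Cd) as [Hc _].
    destruct (MVT_global (fun x => p * s 0%nat x + q * d 0%nat x)
      (fun x => p * s 1%nat x + q * d 1%nat x) y x) as [c [Hc1 E]].
    { intros z. apply (Hc 0%nat). lia. }
    rewrite E. apply abs_mul_le; [|lra].
    destruct (sd_le _ _ _ _ _ Hb 1%nat c ltac:(lia)) as [B1 B2].
    { unfold Icc. unfold Rmin, Rmax in Hc1. repeat destruct Rle_dec; lra. }
    eapply Rle_trans; [apply Rabs_triang|]. rewrite !Rabs_mult, Hp, Hq. lra. }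
  assert (H2 : Rabs (/ 2) = / 2) by (apply Rabs_pos_eq; lra).
  assert (EA : forall z, 0 <= z <= 1 -> A z = / 2 * s 0%nat z + / 2 * d 0%nat z).
  { intros z Hz. rewrite <- sE, <- dE by (unfold Icc; lra). lra. }
  assert (EB : forall z, 0 <= z <= 1 -> B z = / 2 * s 0%nat z + (- / 2) * d 0%nat z).
  { intros z Hz. rewrite <- sE, <- dE by (unfold Icc; lra). lra. }
  rewrite !EA, !EB by auto.
  split; apply L; rewrite ?Rabs_Ropp; exact H2.
Qed.

(** The maximal grid error plus the truncation bound T satisfies a homogeneous growth inequality.
    The error starts at 0, so T alone is amplified. Dividing by Q outside the semigroup lets the
    bounds for phi itself enter. *)
Lemma master_comparison (eta : R) (A B : R -> R) (s d : nat -> R -> R) (sig M : R) (N : nat)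
  (S : R -> (R -> C) -> R -> C) (phi : R -> C) (t0 M0 M2 Q : R) (p0 : nat -> R)
  (pk : nat -> R -> R) :
  0 < eta -> fp_coefs eta A B s d -> fp_bounds eta s d sig M ->
  (0 < N)%nat -> mesh N < eta -> FP_semigroup A B N S -> FP_dom A B N phi ->
  (forall x, 0 <= x <= 1 -> 0 <= A x) -> (forall x, 0 <= x <= 1 -> 0 <= B x) ->
  A 1 = 0 -> B 0 = 0 -> 0 < Q -> 0 <= M0 -> 0 <= M2 ->
  (forall t x, 0 <= t <= t0 -> Icc (lo N) (hi N) x -> Cmod (S t phi x) <= M0) ->
  (forall t x, 0 <= t <= t0 -> Icc (lo N) (hi N) x ->
     Cmod (DC (lo N) (hi N) (DC (lo N) (hi N) (S t phi)) x) <= M2) ->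
  (forall k, (k <= N)%nat -> (RtoC (/ Q) * phi (INR k / INR N)%R)%C = RtoC (p0 k)) ->
  master_solution A B N p0 pk ->
  forall t k, 0 <= t <= t0 -> (k <= N)%nat ->
    Cmod (RtoC (/ Q) * S t phi (INR k / INR N)%R - RtoC (pk k t))%C
    <= 20 * (M * (2 * (M0 + M2) / Q)) * mesh N * exp ((2 * M + 2) * t0).
Proof.
  intros He Hco Hbd HN Heta HS Hphi HA HB A1 B0 HQ HM0 HM2 Hv0 Hv2 Hinit Hpk.
  pose proof (M_pos _ _ _ _ _ Hbd) as HM.
  pose proof (coef_lipschitz eta A B s d sig M He Hco Hbd) as HL.
  assert (Cphi : C0C (lo N) (hi N) phi) by exact (proj1 (C2C_C0C N phi (proj1 Hphi))).
  destruct (INR_mesh N HN) as [Hh _].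
  (* The bound of [truncation_error], with 2 (M0 + M2) / Q bounding the solution and its first two
     space derivatives after division by Q. *)
  set (T := 20 * (M * (2 * (M0 + M2) / Q)) * mesh N).
  assert (Hm : 0 <= 2 * (M0 + M2) / Q).
  { apply Rmult_le_pos; [lra|]. left; apply Rinv_0_lt_compat; auto. }
  assert (HT : 0 <= T).
  { unfold T. apply Rmult_le_pos; [|lra]. apply Rmult_le_pos; [lra|]. apply Rmult_le_pos; lra. }
  assert (HQi : 0 < / Q) by (apply Rinv_0_lt_compat; auto).
  set (X := fun k => INR k / INR N).
  assert (DX : forall k, (k <= N)%nat -> Icc (lo N) (hi N) (X k)).
  { intros k Hk. pose proof (grid_Icc N k HN Hk). unfold Icc, lo, hi, X. lra. }
  set (err := fun k t => (RtoC (/ Q) * S t phi (X k) - RtoC (pk k t))%C).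
  set (E := fun t => max_upto (fun k => Cmod (err k t)) N).
  assert (HE0 : forall t, 0 <= E t).
  { intros t. eapply Rle_trans; [apply (Cmod_ge_0 (err 0%nat t))|].
    apply (max_upto_ge (fun k => Cmod (err k t))). lia. }
  assert (Hstart : E 0 = 0).
  { apply Rle_antisym; auto. destruct (max_upto_attained (fun k => Cmod (err k 0)) N) as [k [Hk Ek]].
    unfold E. rewrite <- Ek. unfold err.
    destruct HS as [[_ [H0 _]] _]. rewrite (H0 phi Cphi) by auto.
    destruct (Hpk k Hk) as [-> _]. unfold X. rewrite Hinit by auto.
    replace (RtoC (p0 k) - RtoC (p0 k))%C with (RtoC 0) by ring. rewrite Cmod_0. lra. }
  assert (Hcont : continuous_upto t0 (fun t => E t + T)).
  { intros t Ht eps Heps.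
    assert (Hk : forall k, (k <= N)%nat -> exists e, 0 < e /\ forall r, Rabs (r - t) < e ->
      0 <= r -> Rabs (Cmod (err k r) - Cmod (err k t)) < eps).
    { intros k Hk.
      destruct (FP_semigroup_continuous HS phi t Cphi (proj1 Ht) (eps / 3 * Q)) as [e1 [He1 K1]]; [nra|].
      destruct (is_derive_within_continuous_at _ _ t _ (proj1 Ht) (proj2 (Hpk k Hk) t (proj1 Ht)) (eps / 3))
        as [e2 [He2 K2]]; [lra|].
      exists (Rmin e1 e2). split; [apply Rmin_pos; auto|]. intros r Hr Hr0.
      pose proof (Rmin_l e1 e2). pose proof (Rmin_r e1 e2).
      specialize (K1 r Hr0 ltac:(lra) (X k) (DX k Hk)). specialize (K2 r Hr0 ltac:(lra)).
      assert (Hd : Cmod (err k r - err k t)%C <= 2 * (eps / 3)).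
      { replace (err k r - err k t)%C with
          (RtoC (/ Q) * (S r phi (X k) - S t phi (X k)) + - RtoC (pk k r - pk k t))%C
          by (unfold err; rewrite RtoC_minus; ring).
        eapply Rle_trans; [apply Cmod_triangle|].
        rewrite Cmod_opp, Cmod_mult, !Cmod_R, (Rabs_pos_eq (/ Q)) by lra.
        assert (/ Q * Cmod (S r phi (X k) - S t phi (X k))%C <= eps / 3); [|lra].
        replace (eps / 3) with (/ Q * (eps / 3 * Q)) by (field; lra).
        apply Rmult_le_compat_l; lra. }
      assert (Cmod (err k r) <= Cmod (err k t) + 2 * (eps / 3)).
      { replace (err k r) with ((err k r - err k t) + err k t)%C by ring.
        eapply Rle_trans; [apply Cmod_triangle|]. lra. }
      assert (Cmod (err k t) <= Cmod (err k r) + 2 * (eps / 3)).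
      { replace (err k t) with (- (err k r - err k t) + err k r)%C by ring.
        eapply Rle_trans; [apply Cmod_triangle|]. rewrite Cmod_opp. lra. }
      apply Rabs_def1; lra. }
    destruct (uniform_upto _ t N Hk) as [e [He1 K]]. exists e. split; auto.
    intros r Hr Hrt. replace (E r + T - (E t + T)) with (E r - E t) by ring.
    apply max_upto_close. intros j Hj. apply K; auto. lra. }
  assert (G : forall t, 0 <= t <= t0 -> E t + T <= (E 0 + T) * exp ((2 * M + 1 + 1) * t)).
  { apply (gronwall_touching (fun t => E t + T) t0 (2 * M + 1)); auto; try lra.
    intros t Ht _. assert (Ht' : 0 <= t <= t0) by lra.
    destruct (max_upto_attained (fun k => Cmod (err k t)) N) as [k [Hk Ek]].
    fold (E t) in Ek.
    destruct (proj_attains (err k t)) as [p [q [Hpq Epq]]].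
    assert (Hp : forall z, proj p q z <= Cmod z).
    { intros z. eapply Rle_trans; [apply Rle_abs|]. apply proj_le_Cmod; auto. }
    destruct (FP_semigroup_derivative HS phi t Cphi (proj1 Ht)) as [Hdom [_ Hd]].
    destruct (FP_dom_chain eta A B s d N _ p q Hco Heta Hdom) as [r [Cr [Er [Fa Fb]]]].
    (* The chain of the solution divided by Q, in the shape of [chain_proj]. *)
    set (rQ := fun i x => / Q * r i x + 0 * r i x).
    assert (CrQ : chain 2 rQ) by (apply (chain_proj 2 (/ Q) 0 r r); auto).
    assert (FrQ : forall x, flux (mesh N) s d rQ x = / Q * flux (mesh N) s d r x).
    { intros x. unfold rQ, flux. ring. }
    assert (Hr0 : forall x, Icc (lo N) (hi N) x -> Rabs (r 0%nat x) <= M0).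
    { intros x Dx. destruct (Er x Dx) as [<- _]. eapply Rle_trans; [apply proj_le_Cmod; auto|]. auto. }
    assert (Hr2 : forall x, Icc (lo N) (hi N) x -> Rabs (r 2%nat x) <= M2).
    { intros x Dx. destruct (Er x Dx) as [_ [_ [<- _]]].
      eapply Rle_trans; [apply proj_le_Cmod; auto|]. auto. }
    assert (Hr1 : forall x, Icc (lo N) (hi N) x -> Rabs (r 1%nat x) <= 2 * (M0 + M2)).
    { apply (first_derivative_bound r (lo N) (hi N)); auto.
      pose proof (mesh_bounds HN). unfold lo, hi. lra. }
    assert (HrQ : forall i x, (i <= 2)%nat -> Icc (lo N) (hi N) x -> Rabs (rQ i x) <= 2 * (M0 + M2) / Q).
    { intros i x Hi Dx. unfold rQ. rewrite Rmult_0_l, Rplus_0_r, Rmult_comm.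
      unfold Rdiv. apply abs_mul_le; [|rewrite Rabs_pos_eq; lra].
      specialize (Hr0 x Dx). specialize (Hr1 x Dx). specialize (Hr2 x Dx).
      destruct i as [|[|[|i]]]; [lra|lra|lra|lia]. }
    assert (Htr : Rabs (fp_expr (mesh N) s d rQ (X k)
       - master_rhs A B N (fun j => rQ 0%nat (INR j / INR N)) k) <= T).
    { apply (truncation_error eta); auto.
      - intros i x Hi Dx. apply (sd_le _ _ _ _ _ Hbd); auto. unfold Icc, lo, hi in *. lra.
      - rewrite FrQ, Fa. ring.
      - rewrite FrQ, Fb. ring. }
    set (l := fp_expr (mesh N) s d rQ (X k) - p * master_rhs A B N (fun j => pk j t) k).
    assert (Eproj : forall j, (j <= N)%nat -> proj p q (err j t) = rQ 0%nat (X j) - p * pk j t).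
    { intros j Hj. unfold err. rewrite proj_minus, proj_real_mult.
      destruct (Er (X j) (DX j Hj)) as [-> _]. unfold rQ, proj, RtoC. simpl. ring. }
    exists (fun r => proj p q (err k r) + T), l.
    split; [rewrite Epq, Ek; reflexivity|split; [|split]].
    - intros w Hw. apply Rplus_le_compat_r. apply (Rle_trans _ _ _ (Hp _)).
      apply (max_upto_ge (fun k => Cmod (err k w))); auto.
    (* At the maximal site the projected error grows at most at rate 2 M E + T, which is at most (2
       M + 1)(E + T). *)
    - assert (Hmax : master_rhs A B N (fun j => rQ 0%nat (INR j / INR N) - p * pk j t) k <= 2 * M * E t).
      { apply master_max_principle; auto; try lra.
        - intros x y Hx Hy. apply (HL x y Hx Hy).
        - intros x y Hx Hy. apply (HL x y Hx Hy).
        - intros j Hj. fold (X j). rewrite <- Eproj by auto. apply (Rle_trans _ _ _ (Hp _)).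
          apply (max_upto_ge (fun k => Cmod (err k t))); auto.
        - fold (X k). rewrite <- Eproj, Epq by auto. exact Ek. }
      rewrite master_rhs_linear in Hmax. apply Rabs_le_between in Htr. unfold l.
      specialize (HE0 t).
      assert (0 <= M * T) by (apply Rmult_le_pos; lra). lra.
    - intros eps Heps.
      destruct (Hd (eps / 2 * Q)) as [e1 [He1 K1]]; [nra|].
      assert (Hp1 : Rabs p <= 1) by (apply Rabs_le; nra).
      destruct (proj1 (is_derive_within_R _ _ t _ (proj1 Ht')) (proj2 (Hpk k Hk) t (proj1 Ht')) (eps / 2))
        as [e2 [He2 K2]]; [lra|].
      exists (Rmin e1 e2). split; [apply Rmin_pos; auto|]. intros w Hw Hwt.
      pose proof (Rmin_l e1 e2). pose proof (Rmin_r e1 e2).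
      assert (Hab : Rabs (w - t) = t - w) by (rewrite Rabs_left1; lra).
      specialize (K1 w (proj1 Hw)). specialize (K2 w (proj1 Hw)). rewrite Hab in K1, K2.
      specialize (K1 ltac:(lra) (X k) (DX k Hk)). specialize (K2 ltac:(lra)).
      apply (Rle_trans _ _ _ (proj_le_Cmod p q _ Hpq)) in K1.
      rewrite !proj_minus, proj_real_mult in K1.
      destruct (Er (X k) (DX k Hk)) as [_ [_ [_ Eop]]]. rewrite Eop in K1.
      set (ds := proj p q (S w phi (X k)) - proj p q (S t phi (X k)) - (w - t) * fp_expr (mesh N) s d r (X k)) in *.
      set (dp := pk k w - pk k t - (w - t) * master_rhs A B N (fun j => pk j t) k) in *.
      assert (Ew : forall u, proj p q (err k u) = / Q * proj p q (S u phi (X k)) - p * pk k u).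
      { intros u. unfold err. rewrite proj_minus, proj_real_mult. unfold proj, RtoC. simpl. ring. }
      replace (proj p q (err k t) + T - (proj p q (err k w) + T) - (t - w) * l) with (- (/ Q * ds) + p * dp).
      2:{ rewrite !Ew. unfold l, ds, dp.
          replace (fp_expr (mesh N) s d rQ (X k)) with (/ Q * fp_expr (mesh N) s d r (X k))
            by (unfold fp_expr, rQ; ring).
          ring. }
      eapply Rle_trans; [apply Rabs_triang|]. rewrite Rabs_Ropp, !Rabs_mult, (Rabs_pos_eq (/ Q)) by lra.
      assert (/ Q * Rabs ds <= eps / 2 * (t - w)).
      { replace (eps / 2 * (t - w)) with (/ Q * (eps / 2 * Q * (t - w))) by (field; lra).
        apply Rmult_le_compat_l; lra. }
      assert (Rabs p * Rabs dp <= 1 * (eps / 2 * (t - w))).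
      { apply Rmult_le_compat; auto; apply Rabs_pos. }
      lra. }
  intros t k Ht Hk.
  apply Rle_trans with (E t).
  { apply (max_upto_ge (fun k => Cmod (err k t))); auto. }
  specialize (G t Ht). rewrite Hstart, Rplus_0_l in G.
  pose proof (exp_le_mono (2 * M + 2) t t0 ltac:(lra) (proj2 Ht)).
  replace (2 * M + 1 + 1) with (2 * M + 2) in G by ring.
  fold T. assert (T * exp ((2 * M + 2) * t) <= T * exp ((2 * M + 2) * t0)) by (apply Rmult_le_compat_l; auto).
  lra.
Qed.

(** * Initial data and conclusion *)

Lemma mesh_anti (N M : nat) : (0 < N)%nat -> (N < M)%nat -> mesh M < mesh N.
Proof.
  intros HN HM. pose proof (lt_0_INR N HN). apply lt_INR in HM. unfold mesh.
  apply Rinv_lt_contravar; nra.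
Qed.

Lemma zero_ext_in (u : R -> R) (x : R) : 0 <= x <= 1 -> zero_ext u x = u x.
Proof. intros H. unfold zero_ext. repeat destruct Rle_dec; try reflexivity; lra. Qed.

Lemma zero_ext_out (u : R -> R) (x : R) : x < 0 \/ 1 < x -> zero_ext u x = 0.
Proof. intros H. unfold zero_ext. repeat destruct Rle_dec; try reflexivity; lra. Qed.

(** For N > 1 the points [lo N] and [hi N] are interior to the interval for N = 1 and outside [0,1].
    Near them the extension is identically 0, so its value and slope vanish and the flux with
    them. *)
Lemma admissible_FP_dom (eta : R) (A B : R -> R) (s d W : nat -> R -> R) (u : R -> R) (N : nat) :
  fp_coefs eta A B s d -> (1 < N)%nat -> mesh N < eta -> chain 2 W ->
  (forall x, Icc (lo 1) (hi 1) x -> zero_ext u x = W 0%nat x) ->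
  FP_dom A B N (fun x => RtoC (zero_ext u x)).
Proof.
  intros Hco HN Heta CW EW. pose proof (lo_lt_hi N) as Hab.
  pose proof (mesh_anti 1 N ltac:(lia) HN) as Hm1. destruct (INR_mesh N ltac:(lia)) as [Hm _].
  set (V := fun (_ : nat) (_ : R) => 0).
  assert (CV : chain 2 V).
  { split; intros; unfold V; [apply is_derive_cst|apply continuous_const]. }
  assert (E : eq_on (lo N) (hi N) (fun x => RtoC (zero_ext u x)) (cpair (W 0%nat) (V 0%nat))).
  { intros x [H1 H2]. unfold cpair, V. rewrite <- EW. reflexivity.
    unfold Icc, lo, hi in *. lra. }
  destruct (FP_cpair eta A B s d N _ W V Hco Heta CW CV E) as [_ Efl].
  assert (Hz : forall x e, 0 < e -> (forall y, Rabs (y - x) < e -> Icc (lo 1) (hi 1) y /\ (y < 0 \/ 1 < y)) ->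
    flux (mesh N) s d W x = 0).
  { intros x e He Hy.
    assert (W0 : forall y, Rabs (y - x) < e -> W 0%nat y = 0).
    { intros y Hyx. destruct (Hy y Hyx) as [K1 K2]. rewrite <- EW by auto. apply zero_ext_out; auto. }
    assert (Hxx : Rabs (x - x) < e) by (rewrite Rminus_diag, Rabs_R0; auto).
    unfold flux. rewrite (W0 x Hxx).
    rewrite (local_max_derive (W 0%nat) x (W 1%nat x) e He).
    - ring.
    - intros y Hyx. rewrite (W0 y Hyx), (W0 x Hxx). lra.
    - apply CW. lia. }
  split; [exact (proj1 (C2C_of_chain _ _ _ W V Hab CW CV E))|].
  split; rewrite Efl by (split; lra); unfold cpair.
  - rewrite (Hz (lo N) (Rmin (mesh N) (mesh 1 - mesh N))).
    + unfold flux, V, RtoC. f_equal. ring.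
    + apply Rmin_pos; lra.
    + intros y Hy. pose proof (Rmin_l (mesh N) (mesh 1 - mesh N)). pose proof (Rmin_r (mesh N) (mesh 1 - mesh N)).
      apply Rabs_def2 in Hy. unfold Icc, lo, hi in *. lra.
  - rewrite (Hz (hi N) (Rmin (mesh N) (mesh 1 - mesh N))).
    + unfold flux, V, RtoC. f_equal. ring.
    + apply Rmin_pos; lra.
    + intros y Hy. pose proof (Rmin_l (mesh N) (mesh 1 - mesh N)). pose proof (Rmin_r (mesh N) (mesh 1 - mesh N)).
      apply Rabs_def2 in Hy. unfold Icc, lo, hi in *. lra.
Qed.

(** Since W comes from the interval for N = 1, the initial second derivative is bounded by one
    constant for all N. *)
Lemma second_initial (A B : R -> R) (N : nat) (S : R -> (R -> C) -> R -> C) (W : nat -> R -> R)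
  (u : R -> R) :
  (1 < N)%nat -> FP_semigroup A B N S -> chain 2 W ->
  (forall x, Icc (lo 1) (hi 1) x -> zero_ext u x = W 0%nat x) ->
  forall x, Icc (lo N) (hi N) x ->
    DC (lo N) (hi N) (DC (lo N) (hi N) (S 0 (fun x => RtoC (zero_ext u x)))) x = RtoC (W 2%nat x).
Proof.
  intros HN HS CW EW x Dx. pose proof (lo_lt_hi N) as Hab.
  pose proof (mesh_anti 1 N ltac:(lia) HN) as Hm1.
  set (V := fun (_ : nat) (_ : R) => 0).
  assert (CV : chain 2 V).
  { split; intros; unfold V; [apply is_derive_cst|apply continuous_const]. }
  assert (E : eq_on (lo N) (hi N) (fun x => RtoC (zero_ext u x)) (cpair (W 0%nat) (V 0%nat))).
  { intros y [H1 H2]. unfold cpair, V. rewrite <- EW. reflexivity.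
    unfold Icc, lo, hi in *. lra. }
  assert (C0 : C0C (lo N) (hi N) (fun x => RtoC (zero_ext u x))).
  { apply (continuous_on_cpair _ _ _ _ _ E); intros y; apply (chain_continuous 2); auto. }
  assert (E0 : eq_on (lo N) (hi N) (S 0 (fun x => RtoC (zero_ext u x))) (cpair (W 0%nat) (V 0%nat))).
  { destruct HS as [[_ [H0 _]] _]. exact (eq_on_trans _ _ _ _ _ (H0 _ C0) E). }
  destruct (C2C_of_chain _ _ _ W V Hab CW CV E0) as [_ [_ E2]].
  rewrite E2 by auto. reflexivity.
Qed.

(* The function called C in the mathematics is B here: C is the type of complex numbers. *)
Theorem theorem15 (eta : R) (A B : R -> R) (N0 : nat)
  (SN : nat -> R -> (R -> C) -> R -> C)
  (eta_pos : 0 < eta)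
  (A_C4 : Ck_on 4 (- eta) (1 + eta) A)
  (B_C4 : Ck_on 4 (- eta) (1 + eta) B)
  (A_nonneg : forall x, 0 <= x <= 1 -> 0 <= A x)
  (B_nonneg : forall x, 0 <= x <= 1 -> 0 <= B x)
  (AB_pos : forall x, - eta <= x <= 1 + eta -> 0 < A x + B x)
  (A_1 : A 1 = 0)
  (B_0 : B 0 = 0)
  (AB_left : forall x, - eta <= x <= 0 -> 0 < A x - B x)
  (AB_right : forall x, 1 <= x <= 1 + eta -> A x - B x < 0)
  (N0_pos : (0 < N0)%nat)
  (N0_large : / (2 * eta) < INR N0)
  (N0_drift : forall x, (- eta <= x <= 0 \/ 1 <= x <= 1 + eta) ->
     Rabs (Derive_on (- eta) (1 + eta) A x + Derive_on (- eta) (1 + eta) B x)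
       < 2 * INR N0 * Rabs (A x - B x))
  (SN_semigroup : forall N : nat, (N0 < N)%nat -> FP_semigroup A B N (SN N))
  (conjecture : forall w0 : R -> R, admissible w0 -> nonzero01 w0 ->
     forall (t : R) (N : nat), 0 < t -> (N0 < N)%nat ->
       let w2 := DC (lo N) (hi N)
                   (DC (lo N) (hi N) (SN N t (fun x => RtoC (zero_ext w0 x)))) in
       Cmod (w2 (lo N)) < supnorm (lo N) (hi N) w2 /\
       Cmod (w2 (hi N)) < supnorm (lo N) (hi N) w2)
  (u0 : R -> R) (u0_adm : admissible u0) (u0_nz : nonzero01 u0)
  (t0 : R) (t0_pos : 0 < t0) :
  exists K : R, forall N : nat, (N0 < N)%nat -> 0 < mass u0 N ->
    forall p : nat -> R -> R,
      master_solution A B N (fun k => u0 (INR k / INR N) / mass u0 N) p ->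
      let v := fun t => SN N t (fun x => RtoC (zero_ext u0 x / mass u0 N)) in
      forall (t : R) (k : nat), 0 <= t <= t0 -> (k <= N)%nat ->
        Cmod (v t (INR k / INR N)%R - RtoC (p k t))%C <= K / INR N ^ 2.
Proof.
  assert (Hab : - eta < 1 + eta) by lra.
  destruct (Ck_on_chain 4 _ _ A Hab A_C4) as [ca [Ca Ea]].
  destruct (Ck_on_chain 4 _ _ B Hab B_C4) as [cb [Cb Eb]].
  set (s := fun i x => 1 * ca i x + 1 * cb i x).
  set (d := fun i x => 1 * ca i x + (-1) * cb i x).
  assert (Cs : chain 4 s) by (apply (chain_proj 4 1 1); auto).
  assert (Cd : chain 4 d) by (apply (chain_proj 4 1 (-1)); auto).
  assert (Hco : fp_coefs eta A B s d).
  { split; auto; intros x Dx; unfold s, d; rewrite Ea, Eb by auto; ring. }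
  destruct (chain_bounded 4 s (- eta) (1 + eta) Cs) as [Ms [HMs Bs]].
  destruct (chain_bounded 4 d (- eta) (1 + eta) Cd) as [Md [HMd Bd]].
  set (M := Rmax Ms Md).
  assert (HM : 0 < M) by (unfold M; pose proof (Rmax_l Ms Md); lra).
  assert (Hbd : exists sig, fp_bounds eta s d sig M).
  { destruct (continuity_ab_min (s 0%nat) (- eta) (1 + eta)) as [x [Hx Dx]]; [lra| |].
    { intros c _. apply continuity_pt_filterlim. apply (chain_continuous 4); auto; lia. }
    exists (s 0%nat x). split; auto.
    - rewrite <- (coef_sE _ _ _ _ _ Hco) by exact Dx. apply AB_pos. exact Dx.
    - intros i y Hi Dy. specialize (Bs i y Hi Dy). specialize (Bd i y Hi Dy). unfold M.
      pose proof (Rmax_l Ms Md). pose proof (Rmax_r Ms Md). lra. }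
  destruct Hbd as [sig Hbd].
  pose proof u0_adm as [u0_nn [u0_C2 [_ [_ [_ [_ u0_ext]]]]]].
  (* N = 1 gives the largest interval; every N > N0 is at least 2, so this one chain serves them
     all. *)
  destruct (Ck_on_chain 2 _ _ _ (lo_lt_hi 1) (u0_ext 1%nat ltac:(lia))) as [W [CW EW]].
  destruct (chain_bounded 2 W (lo 1) (hi 1) CW) as [U [HU BW]].
  assert (u0_cont : continuous_on (Icc 0 1) u0).
  { apply (is_derive_within_continuous_on 0 1 u0 (Derive_on 0 1 u0)).
    intros x Dx. destruct (proj1 u0_C2 x Dx) as [l Hl].
    rewrite (Derive_on_eq 0 1 u0 x l); auto. lra. }
  destruct (mass_lower_bound u0 u0_nn u0_cont u0_nz) as [kap [Hkap Hmass]].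
  set (M0 := U * exp ((2 * M + 1) * t0)).
  set (M2 := (U + M0) * exp ((27 * M + 1) * t0)).
  assert (HM0 : 0 <= M0).
  { apply Rmult_le_pos; [lra|]. left; apply exp_pos. }
  assert (HM2 : 0 <= M2).
  { apply Rmult_le_pos; [lra|]. left; apply exp_pos. }
  (* From 20 M (2 (M0 + M2) / Q_N) h with Q_N >= kap N and h = 1/(2N): one factor 1/N comes from the
     mass, the other from the mesh, and the 2 cancels. *)
  exists (20 * (M * (M0 + M2)) / kap * exp ((2 * M + 2) * t0)).
  intros N HN Hpos p Hp v t k Ht Hk.
  assert (HN0 : (0 < N)%nat) by lia.
  pose proof (lt_0_INR N HN0) as HNR.
  destruct (INR_mesh N HN0) as [Hmesh _].
  assert (HNN : INR N0 < INR N) by (apply lt_INR; auto).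
  assert (Heta : mesh N < eta).
  { assert (Hx : / (2 * eta) < INR N) by lra.
    apply (Rmult_lt_compat_r (2 * eta)) in Hx; [|lra]. rewrite Rinv_l in Hx by lra.
    unfold mesh. apply (Rmult_lt_reg_r (2 * INR N)); [lra|]. rewrite Rinv_l by lra. lra. }
  (* The condition assumed for N0 is inherited by larger N; multiplied by h, with 2 N h = 1, it
     gives the sign conditions at the ends. *)
  assert (Hdrift : forall x, (- eta <= x <= 0 \/ 1 <= x <= 1 + eta) ->
    mesh N * Rabs (s 1%nat x) < Rabs (d 0%nat x)).
  { intros x Hx. assert (Dx : Icc (- eta) (1 + eta) x) by (unfold Icc; lra).
    specialize (N0_drift x Hx).
    rewrite (Derive_on_eq _ _ A x (ca 1%nat x)), (Derive_on_eq _ _ B x (cb 1%nat x)) in N0_drift; auto.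
    2:{ apply (is_derive_within_of_is_derive _ _ (cb 0%nat)); auto. apply Cb. lia. }
    2:{ apply (is_derive_within_of_is_derive _ _ (ca 0%nat)); auto. apply Ca. lia. }
    replace (ca 1%nat x + cb 1%nat x) with (s 1%nat x) in N0_drift by (unfold s; ring).
    rewrite (coef_dE _ _ _ _ _ Hco) in N0_drift by auto.
    pose proof (Rabs_pos (d 0%nat x)).
    assert (Hlt : Rabs (s 1%nat x) < 2 * INR N * Rabs (d 0%nat x)).
    { eapply Rlt_le_trans; [exact N0_drift|]. apply Rmult_le_compat_r; lra. }
    apply (Rmult_lt_compat_l (mesh N)) in Hlt; auto.
    replace (mesh N * (2 * INR N * Rabs (d 0%nat x))) with (Rabs (d 0%nat x)) in Hlt
      by (unfold mesh; field; lra).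
    exact Hlt. }
  assert (Da : 0 < d 0%nat (lo N) - mesh N * s 1%nat (lo N)).
  { assert (Hx : - eta <= lo N <= 0) by (unfold lo; lra).
    specialize (Hdrift (lo N) (or_introl Hx)). specialize (AB_left (lo N) Hx).
    rewrite (coef_dE _ _ _ _ _ Hco) in AB_left by (unfold Icc; lra).
    rewrite (Rabs_pos_eq (d 0%nat (lo N))) in Hdrift by lra.
    pose proof (Rle_abs (s 1%nat (lo N))). nra. }
  assert (Db : d 0%nat (hi N) - mesh N * s 1%nat (hi N) < 0).
  { assert (Hx : 1 <= hi N <= 1 + eta) by (unfold hi; lra).
    specialize (Hdrift (hi N) (or_intror Hx)). specialize (AB_right (hi N) Hx).
    rewrite (coef_dE _ _ _ _ _ Hco) in AB_right by (unfold Icc; lra).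
    rewrite (Rabs_left (d 0%nat (hi N))) in Hdrift by lra.
    pose proof (Rle_abs (- s 1%nat (hi N))) as Q. rewrite Rabs_Ropp in Q. nra. }
  set (phi := fun x => RtoC (zero_ext u0 x)).
  assert (HS := SN_semigroup N HN).
  assert (Hphi : FP_dom A B N phi).
  { apply (admissible_FP_dom eta A B s d W u0 N Hco); auto. lia. }
  assert (Hsub : forall x, Icc (lo N) (hi N) x -> Icc (lo 1) (hi 1) x).
  { pose proof (mesh_anti 1 N ltac:(lia) ltac:(lia)). unfold Icc, lo, hi. intros x Hx. lra. }
  assert (Hval : forall t x, 0 <= t <= t0 -> Icc (lo N) (hi N) x -> Cmod (SN N t phi x) <= M0).
  { apply (value_bound Hco Hbd HN0 Heta HS Hphi U Da Db).
    intros x Dx. unfold phi. rewrite Cmod_R, EW by auto. apply BW; auto. }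
  assert (Hsec : forall t x, 0 <= t <= t0 -> Icc (lo N) (hi N) x ->
     Cmod (DC (lo N) (hi N) (DC (lo N) (hi N) (SN N t phi)) x) <= M2).
  { apply (second_bound Hco Hbd HN0 Heta HS Hphi M0 U HM0 Hval).
    - intros x Dx. unfold phi. rewrite (second_initial A B N (SN N) W u0); auto; [|lia].
      rewrite Cmod_R. apply BW; auto.
    - intros r Hr. exact (conjecture u0 u0_adm u0_nz r N Hr HN). }
  set (Q := mass u0 N) in *.
  (* Linearity moves the normalisation outside the semigroup, where the uniform bounds for the orbit
     of u0 apply. *)
  assert (Ev : v t (INR k / INR N) = (RtoC (/ Q) * SN N t phi (INR k / INR N)%R)%C).
  { unfold v.
    replace (fun x => RtoC (zero_ext u0 x / Q)) with (fun x => (RtoC (/ Q) * phi x)%C).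
    2:{ apply functional_extensionality. intros x. unfold phi. rewrite <- RtoC_mult. f_equal. unfold Rdiv. ring. }
    destruct HS as [[Hb _] _]. destruct (Hb t (proj1 Ht)) as [_ [_ [Hs _]]].
    apply Hs. exact (proj1 (C2C_C0C N phi (proj1 Hphi))).
    pose proof (grid_Icc N k HN0 Hk). unfold Icc, lo, hi. lra. }
  rewrite Ev.
  eapply Rle_trans.
  { apply (master_comparison eta A B s d sig M N (SN N) phi t0 M0 M2 Q
      (fun k => u0 (INR k / INR N) / Q) p); auto.
    intros j Hj. unfold phi. rewrite zero_ext_in by (apply grid_Icc; auto).
    rewrite <- RtoC_mult. f_equal. unfold Rdiv. ring. }
  specialize (Hmass N HN0 Hpos). fold Q in Hmass.
  assert (HkN : 0 < kap * INR N) by (apply Rmult_lt_0_compat; auto).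
  assert (Hinv : / Q <= / (kap * INR N)) by (apply Rinv_le_contravar; auto).
  replace (20 * (M * (M0 + M2)) / kap * exp ((2 * M + 2) * t0) / INR N ^ 2)
    with (20 * (M * (2 * (M0 + M2) * / (kap * INR N))) * mesh N * exp ((2 * M + 2) * t0))
    by (unfold mesh; field; lra).
  apply Rmult_le_compat_r; [left; apply exp_pos|].
  apply Rmult_le_compat_r; [lra|].
  apply Rmult_le_compat_l; [lra|].
  apply Rmult_le_compat_l; [lra|].
  unfold Rdiv. apply Rmult_le_compat_l; lra.
Qed.
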